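(* Assume that $\{\omega_n : n\geq 1\}$ is a set of states such that $\omega_n$ is a state of ${\cal O}_n$ with Gel'fand–Naimark–Segal triple $({\cal H}_n,\pi_n,\Omega_n)$ for each $n\geq 1$, and $$\omega_n\otimes_{\varphi}\omega_m=\omega_{nm}\qquad (n,m\geq 1).$$ Then there exists, for each $n,m\geq 1$, a nonzero partial isometry $W^{(n,m)}$ from ${\cal H}_{nm}\otimes{\cal H}_m$ to ${\cal H}_n\otimes{\cal H}_m$ such that the following holds: (i) For each $n,m\geq 1$, $$W^{(n,m)}(\pi_{nm}(X)\otimes I_m)=(\pi_n\otimes_{\varphi}\pi_m)(X)\,W^{(n,m)}\qquad (X\in{\cal O}_{nm}),$$ where $I_m$ denotes the identity operator on ${\cal H}_m$. (ii) In addition, if $\Omega_n\otimes\Omega_m$ is a cyclic vector for $({\cal H}_n\otimes{\cal H}_m,\pi_n\otimes_{\varphi}\pi_m)$, then $W^{(n,m)}$ can be chosen such that $(W^{(n,m)})^*$ is an isometry. (iii) For each $n,m,l\geq 1$, $$W^{(n,m)}_{12}W^{(nm,l)}_{13}W^{(m,l)}_{23}=W^{(m,l)}_{23}W^{(n,ml)}_{12}$$ as operators from ${\cal H}_{nml}\otimes{\cal H}_{ml}\otimes{\cal H}_l$ to ${\cal H}_n\otimes{\cal H}_m\otimes{\cal H}_l$. (iv) Define $${\cal H}\equiv\bigoplus_{n\in{\bf N}}{\cal H}_n,\qquad \pi\equiv\bigoplus_{n\in{\bf N}}\pi_n,\qquad W\equiv\bigoplus_{n,m\in{\bf N}}W^{(n,m)}.$$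 Then $({\cal H},\pi,W)$ is a pentagonal quasi-covariant representation of $({\cal O}_*,\Delta_{\varphi})$. In addition, if $\Omega_n\otimes\Omega_m$ is a cyclic vector for $({\cal H}_n\otimes{\cal H}_m,\pi_n\otimes_{\varphi}\pi_m)$ for each $n,m\geq 1$ (with $W^{(n,m)}$ chosen as in (ii)), then $({\cal H},\pi,W)$ is a pentagonal covariant representation of $({\cal O}_*,\Delta_{\varphi})$.
   Context: ${\bf N}=\{1,2,3,\ldots\}$. All tensor products of C$^*$-algebras are minimal. Cuntz algebras. For $2\leq n<\infty$, ${\cal O}_n$ is the Cuntz algebra, the universal unital C$^*$-algebra with canonical generators $s^{(n)}_1,\ldots,s^{(n)}_n$ satisfying $(s^{(n)}_i)^*s^{(n)}_j=\delta_{ij}I_n$ and $\sum_{i=1}^n s^{(n)}_i(s^{(n)}_i)^*=I_n$, with $I_n$ the unit. By convention ${\cal O}_1={\bf C}$ and $s^{(1)}_1=I_1=1$. For $n,m\in{\bf N}$, $\varphi_{n,m}:{\cal O}_{nm}\to{\cal O}_n\otimes{\cal O}_m$ is the unital $*$-homomorphism given by $$\varphi_{n,m}(s^{(nm)}_{m(i-1)+j})=s^{(n)}_i\otimes s^{(m)}_j\quad(i=1,\ldots,n,\ j=1,\ldots,m).$$ For states $\omega$ of ${\cal O}_n$ and $\omega'$ of ${\cal O}_m$, $\omega\otimes_{\varphi}\omega'\equiv(\omega\otimes\omega')\circ\varphi_{n,m}$, a state of ${\cal O}_{nm}$. For $*$-representations $\pi_1$ of ${\cal O}_n$ and $\pi_2$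 of ${\cal O}_m$, $\pi_1\otimes_{\varphi}\pi_2\equiv(\pi_1\otimes\pi_2)\circ\varphi_{n,m}$, a $*$-representation of ${\cal O}_{nm}$. The C$^*$-bialgebra $({\cal O}_*,\Delta_\varphi)$. ${\cal O}_*\equiv\bigoplus_{n\in{\bf N}}{\cal O}_n=\{(x_n):\|(x_n)\|\to0\text{ as }n\to\infty\}$ (the $c_0$-direct sum, $x_n\in{\cal O}_n$), and $\Delta_\varphi:{\cal O}_*\to{\cal O}_*\otimes{\cal O}_*$ is the $*$-homomorphism $\Delta_\varphi=\bigoplus_n\Delta_\varphi^{(n)}$ with $\Delta^{(n)}_\varphi(x)=\sum_{(m,l)\in{\bf N}^2,\,ml=n}\varphi_{m,l}(x)$ for $x\in{\cal O}_n$ (each ${\cal O}_m\otimes{\cal O}_l$ being regarded as a direct summand of ${\cal O}_*\otimes{\cal O}_*$). It is a strictly proper C$^*$-bialgebra, i.e. the comultiplication is coassociative, takes values in ${\cal O}_*\otimes{\cal O}_*$, and the linear span of $\{\Delta_\varphi(a)(b\otimes c)\}$ is norm dense in ${\cal O}_*\otimes{\cal O}_*$. Covariant representations. Let $(A,\Delta)$ be a strictly proper C$^*$-bialgebra. A triplet $({\cal H},\pi,W)$ is a quasi-covariant representation of $(A,\Delta)$ if $({\cal H},\pi)$ is a $*$-representation of the C$^*$-algebra $A$ and $W$ is a nonzero partial isometry on ${\cal H}\otimes{\cal H}$ such that $W(\pi(a)\otimes I)=\{(\pi\otimes\pi)\circ\Delta\}(a)W$ for all $a\in A$, where $I$ is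 the identity operator on ${\cal H}$. If in addition $W^*$ is an isometry, $({\cal H},\pi,W)$ is called a covariant representation. A (quasi-)covariant representation is pentagonal if $W_{12}W_{13}W_{23}=W_{23}W_{12}$ on ${\cal H}\otimes{\cal H}\otimes{\cal H}$. Leg numbering: for an operator $T$ between two-fold tensor products, $T_{ij}$ acts as $T$ on the $i$-th and $j$-th tensor factors and as the identity on the remaining factor. E.g. $W^{(m,l)}_{23}:{\cal H}_{nml}\otimes{\cal H}_{ml}\otimes{\cal H}_l\to{\cal H}_{nml}\otimes{\cal H}_m\otimes{\cal H}_l$, $W^{(nm,l)}_{13}:{\cal H}_{nml}\otimes{\cal H}_m\otimes{\cal H}_l\to{\cal H}_{nm}\otimes{\cal H}_m\otimes{\cal H}_l$, $W^{(n,m)}_{12}:{\cal H}_{nm}\otimes{\cal H}_m\otimes{\cal H}_l\to{\cal H}_n\otimes{\cal H}_m\otimes{\cal H}_l$, $W^{(n,ml)}_{12}:{\cal H}_{nml}\otimes{\cal H}_{ml}\otimes{\cal H}_l\to{\cal H}_n\otimes{\cal H}_{ml}\otimes{\cal H}_l$. The operator $W=\bigoplus W^{(n,m)}$ on ${\cal H}\otimes{\cal H}=\bigoplus_{a,b}{\cal H}_a\otimes{\cal H}_b$ is the operator which equals $W^{(n,m)}$ on ${\cal H}_{nm}\otimes{\cal H}_m$ (with values in ${\cal H}_n\otimes{\cal H}_m$) and vanishes on ${\cal H}_a\otimes{\cal H}_b$ whenever $b$ does not divide $a$. The representation $\pi=\bigoplus\pi_n$ of ${\cal O}_*$ is $\pi((x_n))=\bigoplus_n\pi_n(x_n)$.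 *)

(* Defs.v *)
From HB Require Import structures.
From mathcomp Require Import all_boot all_order all_algebra.
From mathcomp Require Import all_classical all_reals all_analysis.
From mathcomp.real_closed Require Import complex.

Set Implicit Arguments.
Unset Strict Implicit.
Unset Printing Implicit Defensive.

Import Order.TTheory GRing.Theory Num.Theory.
Import numFieldNormedType.Exports.

Local Open Scope classical_set_scope.
Local Open Scope ring_scope.

(** Many objects below (tensor products of operators, of *-homomorphisms, of
    states, ...) are "the unique map such that ..."; they are defined by
    [the_map P], a map satisfying [P] (and the zero map if there is none). *)
Definition the_map {X : Type} {Y : zmodType} (P : (X -> Y) -> Prop) : X -> Y :=
  xget (fun=> 0) [set f : {classic X -> Y} | P f].

Lemma the_mapP {X : Type} {Y : zmodType} (P : (X -> Y) -> Prop) :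
  (exists f, P f) -> P (the_map P).
Proof. by move=> exP; exact: (xgetPex (T := {classic X -> Y}) _ exP). Qed.

(** * The index set {1, 2, 3, ...} *)

Record posN := PosN { posN_val :> nat; posN_gt0 : (0 < posN_val)%N }.
HB.instance Definition _ := [isSub for posN_val].
HB.instance Definition _ := [Countable of posN by <:].

Lemma pmul_gt0 (n m : posN) : (0 < n * m)%N.
Proof. by rewrite muln_gt0 !posN_gt0. Qed.

Definition pmul (n m : posN) : posN := PosN (pmul_gt0 n m).

Lemma pmulA (n m l : posN) : pmul n (pmul m l) = pmul (pmul n m) l.
Proof. by apply: val_inj; rewrite /= mulnA. Qed.

(** * Hilbert spaces *)

(** Inner products are linear in the second variable. *)
HB.mixin Record isHilbert (R : realType) H of CompleteNormedModule R[i] H := {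
  hdot : H -> H -> R[i];
  hdot_linear : forall x, scalar (hdot x);
  hdotC : forall x y, hdot y x = (hdot x y)^*;
  hdot_norm : forall x, hdot x x = `|x| ^+ 2
}.

#[short(type="hilbertType")]
HB.structure Definition Hilbert (R : realType) :=
  { H of isHilbert R H & CompleteNormedModule R[i] H }.

Definition bounded_linear (R : realType) (V W : normedModType R[i])
    (T : V -> W) : Prop :=
  linear T /\ exists M : R[i], forall x, `|T x| <= M * `|x|.

Definition the_operator (R : realType) (V W : normedModType R[i])
    (P : (V -> W) -> Prop) : V -> W :=
  the_map (fun T => bounded_linear T /\ P T).

Definition isometric_op (R : realType) (V W : normedModType R[i]) (T : V -> W)
  : Prop := linear T /\ forall x, `|T x| = `|x|.

Definition partial_isometry (R : realType) (H K : hilbertType R) (T : H -> K)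
    : Prop :=
  bounded_linear T /\
  forall x, (forall z, T z = 0 -> hdot z x = 0) -> `|T x| = `|x|.

Definition adjoint (R : realType) (H K : hilbertType R) (T : H -> K) : K -> H :=
  the_operator (fun S : K -> H => forall x y, hdot (T x) y = hdot x (S y)).

(** A Hilbert space tensor product of H and K, determined up to a unique
    unitary compatible with the elementary tensors. *)
Record htensor (R : realType) (H K : hilbertType R) := HTensor {
  ht_sort :> hilbertType R;
  ht_map : H -> K -> ht_sort;
  ht_linearl : forall y, linear (ht_map^~ y);
  ht_linearr : forall x, linear (ht_map x);
  ht_dot : forall x x' y y',
    hdot (ht_map x y) (ht_map x' y') = hdot x x' * hdot y y';
  ht_dense : closure [set z | exists s : seq (H * K),
    z = \sum_(p <- s) ht_map p.1 p.2] = setT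
}.

Definition htensors (R : realType) := forall H K : hilbertType R, htensor H K.

Notation "x ⊗[ ht ] y" := (ht_map (ht _ _) x y)
  (at level 40, left associativity, format "x  ⊗[ ht ]  y").

Definition htens_op (R : realType) (ht : htensors R)
    (H1 H2 K1 K2 : hilbertType R) (T1 : H1 -> K1) (T2 : H2 -> K2)
  : ht H1 H2 -> ht K1 K2 :=
  the_operator (fun V : ht H1 H2 -> ht K1 K2 =>
    forall x y, V (x ⊗[ht] y) = T1 x ⊗[ht] T2 y).

(** The threefold tensor product of H1, H2, H3 is [ht (ht H1 H2) H3]. *)
Definition htens_assoc (R : realType) (ht : htensors R)
    (H1 H2 H3 : hilbertType R) : ht (ht H1 H2) H3 -> ht H1 (ht H2 H3) :=
  the_operator (fun V : ht (ht H1 H2) H3 -> ht H1 (ht H2 H3) =>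
    forall x y z, V (x ⊗[ht] y ⊗[ht] z) = x ⊗[ht] (y ⊗[ht] z)).

Definition htens_assocV (R : realType) (ht : htensors R)
    (H1 H2 H3 : hilbertType R) : ht H1 (ht H2 H3) -> ht (ht H1 H2) H3 :=
  the_operator (fun V : ht H1 (ht H2 H3) -> ht (ht H1 H2) H3 =>
    forall x y z, V (x ⊗[ht] (y ⊗[ht] z)) = x ⊗[ht] y ⊗[ht] z).

Definition htens_swap23 (R : realType) (ht : htensors R)
    (H1 H2 H3 : hilbertType R) : ht (ht H1 H2) H3 -> ht (ht H1 H3) H2 :=
  the_operator (fun V : ht (ht H1 H2) H3 -> ht (ht H1 H3) H2 =>
    forall x y z, V (x ⊗[ht] y ⊗[ht] z) = x ⊗[ht] z ⊗[ht] y).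

Definition leg12 (R : realType) (ht : htensors R)
    (H1 H2 K1 K2 H3 : hilbertType R) (T : ht H1 H2 -> ht K1 K2)
  : ht (ht H1 H2) H3 -> ht (ht K1 K2) H3 :=
  htens_op T id.

Definition leg13 (R : realType) (ht : htensors R)
    (H1 H3 K1 K3 H2 : hilbertType R) (T : ht H1 H3 -> ht K1 K3)
  : ht (ht H1 H2) H3 -> ht (ht K1 H2) K3 :=
  @htens_swap23 R ht K1 K3 H2 \o htens_op T id \o @htens_swap23 R ht H1 H2 H3.

Definition leg23 (R : realType) (ht : htensors R)
    (H2 H3 K2 K3 H1 : hilbertType R) (T : ht H2 H3 -> ht K2 K3)
  : ht (ht H1 H2) H3 -> ht (ht H1 K2) K3 :=
  @htens_assocV R ht H1 K2 K3 \o htens_op id T \o @htens_assoc R ht H1 H2 H3.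

(** A Hilbert space direct sum of a family. *)
Record hdsum (R : realType) (I : Type) (H : I -> hilbertType R) := HDSum {
  hds_sort :> hilbertType R;
  hds_inj : forall i, H i -> hds_sort;
  hds_isometry : forall i, isometric_op (@hds_inj i);
  hds_orth : forall i j (x : H i) (y : H j), i <> j -> hdot (hds_inj x) (hds_inj y) = 0;
  hds_dense : closure [set z | exists s : seq {i : I & H i},
    z = \sum_(p <- s) hds_inj (tagged p)] = setT
}.
Arguments hds_inj {R I H} S i x : rename.

Definition hdsum_op (R : realType) (I : Type) (H : I -> hilbertType R)
    (S : hdsum H) (T : forall i, H i -> H i) : S -> S :=
  the_operator (fun V : S -> S =>
    forall i x, V (hds_inj S i x) = hds_inj S i (T i x)).

(** * C*-algebras (not necessarily unital) *)

HB.mixin Record isCstar (R : realType) A of CompleteNormedModule R[i] A := {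
  cmul : A -> A -> A;
  cstar : A -> A;
  cmulA : associative cmul;
  cmul_linearl : forall b, linear (cmul^~ b);
  cmul_linearr : forall a, linear (cmul a);
  cstarK : involutive cstar;
  cstarM : forall a b, cstar (cmul a b) = cmul (cstar b) (cstar a);
  cstarP : forall (c : R[i]) a b, cstar (c *: a + b) = c^* *: cstar a + cstar b;
  cnormM : forall a b, `|cmul a b| <= `|a| * `|b|;
  cnorm_star : forall a, `|cmul (cstar a) a| = `|a| ^+ 2
}.

#[short(type="cstarType")]
HB.structure Definition Cstar (R : realType) :=
  { A of isCstar R A & CompleteNormedModule R[i] A }.

Definition is_cunit (R : realType) (A : cstarType R) (e : A) : Prop :=
  forall a, cmul e a = a /\ cmul a e = a.

Definition star_hom (R : realType) (A B : cstarType R) (f : A -> B) : Prop :=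
  [/\ linear f, {morph f : a b / cmul a b} & {morph f : a / cstar a}].

Definition is_state (R : realType) (A : cstarType R) (w : A -> R[i]) : Prop :=
  [/\ scalar w, forall a, 0 <= w (cmul (cstar a) a),
      forall a, `|w a| <= `|a| &
      forall M : R[i], (forall a, `|w a| <= M * `|a|) -> 1 <= M].

(** *-representations on a Hilbert space, written out as maps A -> H -> H;
    they need not be unital or nondegenerate. *)
Definition is_rep (R : realType) (A : cstarType R) (H : hilbertType R)
    (pi : A -> H -> H) : Prop :=
  [/\ forall a, bounded_linear (pi a),
      forall x, linear (pi^~ x),
      forall a b x, pi (cmul a b) x = pi a (pi b x) &
      forall a x y, hdot (pi (cstar a) x) y = hdot x (pi a y)].

Definition cyclic_vector (R : realType) (A : cstarType R) (H : hilbertType R)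
    (pi : A -> H -> H) (v : H) : Prop :=
  closure [set pi a v | a in [set: A]] = setT.

Definition is_GNS (R : realType) (A : cstarType R) (w : A -> R[i])
    (H : hilbertType R) (pi : A -> H -> H) (v : H) : Prop :=
  [/\ is_rep pi, cyclic_vector pi v & forall a, w a = hdot v (pi a v)].

(** A minimal tensor product of A and B: a completion of the algebraic tensor
    product for the norm
    |z|_min = sup { |(pi1 (x) pi2)(z)| : pi1, pi2 representations of A, B }. *)
Record mtensor (R : realType) (ht : htensors R) (A B : cstarType R) :=
  MTensor {
  mt_sort :> cstarType R;
  mt_map : A -> B -> mt_sort;
  mt_linearl : forall b, linear (mt_map^~ b);
  mt_linearr : forall a, linear (mt_map a);
  mt_mul : forall a a' b b',
    cmul (mt_map a b) (mt_map a' b') = mt_map (cmul a a') (cmul b b');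
  mt_star : forall a b, cstar (mt_map a b) = mt_map (cstar a) (cstar b);
  mt_dense : closure [set z | exists s : seq (A * B),
    z = \sum_(p <- s) mt_map p.1 p.2] = setT;
  mt_norm : forall (s : seq (A * B)) (M : R[i]), 0 <= M ->
    (`|\sum_(p <- s) mt_map p.1 p.2| <= M) <->
    (forall (H K : hilbertType R) (pi1 : A -> H -> H) (pi2 : B -> K -> K),
       is_rep pi1 -> is_rep pi2 -> forall u : ht H K,
       `|\sum_(p <- s) htens_op (pi1 p.1) (pi2 p.2) u| <= M * `|u|)
}.

Definition mtensors (R : realType) (ht : htensors R) :=
  forall A B : cstarType R, mtensor ht A B.

Notation "a ⊗m[ ct ] b" := (mt_map (ct _ _) a b)
  (at level 40, left associativity, format "a  ⊗m[ ct ]  b").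

Definition tens_hom (R : realType) (ht : htensors R) (ct : mtensors ht)
    (A1 A2 B1 B2 : cstarType R) (f1 : A1 -> B1) (f2 : A2 -> B2)
  : ct A1 A2 -> ct B1 B2 :=
  the_map (fun f : ct A1 A2 -> ct B1 B2 => star_hom f /\
    forall a b, f (a ⊗m[ct] b) = f1 a ⊗m[ct] f2 b).

Definition tens_state (R : realType) (ht : htensors R) (ct : mtensors ht)
    (A B : cstarType R) (w1 : A -> R[i]) (w2 : B -> R[i])
  : ct A B -> R[i] :=
  the_map (fun w : ct A B -> R[i] => is_state w /\
    forall a b, w (a ⊗m[ct] b) = w1 a * w2 b).

Definition tens_rep (R : realType) (ht : htensors R) (ct : mtensors ht)
    (A B : cstarType R) (H K : hilbertType R)
    (pi1 : A -> H -> H) (pi2 : B -> K -> K) : ct A B -> ht H K -> ht H K :=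
  the_map (fun pi : ct A B -> ht H K -> ht H K => is_rep pi /\
    forall a b, pi (a ⊗m[ct] b) = htens_op (pi1 a) (pi2 b)).

(** The c_0-direct sum: elements are identified with the families (x_n) such
    that |x_n| tends to 0, via the projections [c0_proj]; the norm is
    sup_n |x_n|. *)
Definition vanishing (R : realType) (A : posN -> cstarType R)
    (f : forall n, A n) : Prop :=
  forall eps : R[i], 0 < eps ->
    exists N : nat, forall n : posN, (N <= n)%N -> `|f n| < eps.

Record c0sum (R : realType) (A : posN -> cstarType R) := C0Sum {
  c0_sort :> cstarType R;
  c0_proj : forall n, c0_sort -> A n;
  c0_hom : forall n, star_hom (c0_proj n);
  c0_norm : forall x (M : R[i]), 0 <= M ->
    (`|x| <= M) <-> (forall n, `|c0_proj n x| <= M);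
  c0_vanishing : forall x, vanishing (fun n => c0_proj n x);
  c0_surj : forall f : (forall n, A n), vanishing f ->
    exists x, forall n, c0_proj n x = f n
}.
Arguments c0_proj {R A} S n x : rename.

Definition c0_inj (R : realType) (A : posN -> cstarType R) (S : c0sum A)
    (n : posN) : A n -> S :=
  the_map (fun j : A n -> S => forall x, c0_proj S n (j x) = x /\
    forall k, k <> n -> c0_proj S k (j x) = 0).
Arguments c0_inj {R A} S n _.

(** * Cuntz algebras *)

Definition cuntz_relations (R : realType) (n : nat) (A : cstarType R)
    (e : A) (s : 'I_n -> A) : Prop :=
  [/\ is_cunit e,
      forall i j, cmul (cstar (s i)) (s j) = if i == j then e else 0 &
      \sum_i cmul (s i) (cstar (s i)) = e].

Definition is_cuntz (R : realType) (n : nat) (A : cstarType R)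
    (e : A) (s : 'I_n -> A) : Prop :=
  if n == 1%N then
    (* O_1 is the algebra of complex numbers, with s_1 = 1 *)
    [/\ is_cunit e, e <> 0, forall a, exists c : R[i], a = c *: e &
        forall i, s i = e]
  else
    cuntz_relations e s /\
    forall (B : cstarType R) (e' : B) (t : 'I_n -> B), cuntz_relations e' t ->
      exists! f : A -> B, [/\ star_hom f, f e = e' & forall i, f (s i) = t i].

(** Generators are numbered from 0: [cz_gen i] is s^{(n)}_{i+1}. *)
Record cuntz (R : realType) (n : nat) := Cuntz {
  cz_sort :> cstarType R;
  cz_one : cz_sort;
  cz_gen : 'I_n -> cz_sort;
  cz_spec : is_cuntz cz_one cz_gen
}.

Definition cuntz_phi (R : realType) (ht : htensors R) (ct : mtensors ht)
    (O : forall n : posN, cuntz R n) (n m : posN)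
  : O (pmul n m) -> ct (O n) (O m) :=
  the_map (fun f : O (pmul n m) -> ct (O n) (O m) =>
    [/\ star_hom f,
        f (cz_one (O (pmul n m))) = cz_one (O n) ⊗m[ct] cz_one (O m) &
        forall (k : 'I_(pmul n m)) (i : 'I_n) (j : 'I_m),
          k = (m * i + j)%N :> nat ->
          f (cz_gen (O (pmul n m)) k) =
            cz_gen (O n) i ⊗m[ct] cz_gen (O m) j]).
Arguments cuntz_phi {R ht} ct O n m _.

Definition state_phi (R : realType) (ht : htensors R) (ct : mtensors ht)
    (O : forall n : posN, cuntz R n) (n m : posN)
    (w1 : O n -> R[i]) (w2 : O m -> R[i]) : O (pmul n m) -> R[i] :=
  tens_state w1 w2 \o cuntz_phi ct O n m.
Arguments state_phi {R ht} ct O {n m} w1 w2 _.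

Definition rep_phi (R : realType) (ht : htensors R) (ct : mtensors ht)
    (O : forall n : posN, cuntz R n) (n m : posN) (H K : hilbertType R)
    (pi1 : O n -> H -> H) (pi2 : O m -> K -> K)
  : O (pmul n m) -> ht H K -> ht H K :=
  tens_rep pi1 pi2 \o cuntz_phi ct O n m.
Arguments rep_phi {R ht} ct O {n m H K} pi1 pi2 _ _.

(** In the sum below p.1 * p.2 and n are equal but not convertible:
    [c0_proj S (pmul p.1 p.2) (c0_inj S n x)] is x seen in O_(p.1 * p.2). *)
Definition cuntz_delta (R : realType) (ht : htensors R) (ct : mtensors ht)
    (O : forall n : posN, cuntz R n) (S : c0sum (fun n => O n)) : S -> ct S S :=
  the_map (fun D : S -> ct S S => star_hom D /\
    forall n (x : O n), D (c0_inj S n x) =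
      \sum_(p \in [set p : posN * posN | pmul p.1 p.2 = n])
        tens_hom (c0_inj S p.1) (c0_inj S p.2)
          (cuntz_phi ct O p.1 p.2 (c0_proj S (pmul p.1 p.2) (c0_inj S n x)))).
Arguments cuntz_delta {R ht} ct {O} S _.

(** * Covariant representations of (A, D) *)

Definition quasi_covariant (R : realType) (ht : htensors R) (ct : mtensors ht)
    (A : cstarType R) (D : A -> ct A A) (H : hilbertType R)
    (pi : A -> H -> H) (W : ht H H -> ht H H) : Prop :=
  [/\ is_rep pi, partial_isometry W, exists u, W u <> 0 &
      forall a, W \o htens_op (pi a) id =1 tens_rep pi pi (D a) \o W].

Definition covariant (R : realType) (ht : htensors R) (ct : mtensors ht)
    (A : cstarType R) (D : A -> ct A A) (H : hilbertType R)
    (pi : A -> H -> H) (W : ht H H -> ht H H) : Prop :=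
  quasi_covariant D pi W /\ isometric_op (adjoint W).

Definition pentagonal (R : realType) (ht : htensors R) (H : hilbertType R)
    (W : ht H H -> ht H H) : Prop :=
  leg12 W \o leg13 W \o leg23 W =1 leg23 W \o leg12 (H3 := H) W.

Definition dsum_rep (R : realType) (A : posN -> cstarType R) (S : c0sum A)
    (H : posN -> hilbertType R) (HS : hdsum H)
    (pi : forall n, A n -> H n -> H n) : S -> HS -> HS :=
  fun x => hdsum_op (S := HS) (fun n => pi n (c0_proj S n x)).
Arguments dsum_rep {R A} S {H} HS pi _ _.

Definition dsum_W (R : realType) (ht : htensors R) (H : posN -> hilbertType R)
    (HS : hdsum H)
    (W : forall n m, ht (H (pmul n m)) (H m) -> ht (H n) (H m))
  : ht HS HS -> ht HS HS :=
  the_operator (fun V : ht HS HS -> ht HS HS =>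
    (forall n m u, V (htens_op (hds_inj HS (pmul n m)) (hds_inj HS m) u) =
                   htens_op (hds_inj HS n) (hds_inj HS m) (W n m u)) /\
    (forall a b : posN, ~~ (b %| a)%N ->
       forall u, V (htens_op (hds_inj HS a) (hds_inj HS b) u) = 0)).
Arguments dsum_W {R ht H} HS W _.

(* Main.v *)
Require Import Defs.
From HB Require Import structures.
From mathcomp Require Import all_boot all_order all_algebra.
From mathcomp Require Import all_classical all_reals all_analysis.
From mathcomp.real_closed Require Import complex.
From mathcomp Require Import ring.

Set Implicit Arguments.
Unset Strict Implicit.
Unset Printing Implicit Defensive.

Import Order.TTheory GRing.Theory Num.Theory.
Import numFieldNormedType.Exports.

Local Open Scope classical_set_scope.
Local Open Scope ring_scope.

(** The isometries are given by uniqueness of the GNS construction. The vector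
    state of [Omega_n (x) Omega_m] under [pi_n (x)_phi pi_m] is
    [omega_n (x)_phi omega_m = omega_(nm)], so that
    [pi_(nm)(X) Omega_(nm) |-> (pi_n (x)_phi pi_m)(X) (Omega_n (x) Omega_m)]
    extends to an isometry [U] from [H_(nm)] to [H_n (x) H_m], which intertwines
    the two representations ([gns_embed_intertwine]). Put
    [W (x (x) y) = <Omega_m, y> U x]. This is a partial isometry with initial
    space [H_(nm) (x) Omega_m] ([gns_W_partial]), it inherits the intertwining
    property from [U], and it is coisometric as soon as [U] is onto, which is what
    cyclicity of [Omega_n (x) Omega_m] means ([gns_W_coisometry]).

    The pentagon equation for the [W] ([gns_pentagon]) reduces to coassociativity
    of the isometries, [(U (x) 1) U = (1 (x) U) U] ([gns_embed_coassoc]). The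
    latter holds because both sides send [pi(X) Omega] to the action of [X] on
    [Omega (x) Omega (x) Omega] under an iterated tensor product of
    representations, and the two iterated products agree on the generators of the
    Cuntz algebra ([rep_phi_assoc]). That agreement on generators is enough
    ([cuntz_generated]) follows from the universal property: applied to a closed
    *-subalgebra containing the generators, it yields a *-homomorphism which,
    followed by the inclusion, can only be the identity.

    The global operator is treated block by block: [H (x) H] is the direct sum of
    the [H_a (x) H_b] ([hdsum2]), the blocks of [W] act between mutually orthogonal
    summands ([dsum_W_spec]), and each property of [W] is a property of the blocks,
    up to bookkeeping of divisibility ([dsum_W_pentagonal]). Covariance moreover
    uses that [Delta_phi X] acts on [H_n (x) H_m] through the component of [X] in
    [O_(nm)] only ([delta_block]).

    The analytic content lies in the existence of the maps that appear in the
    definitions. Tensor products of bounded operators are bounded on finite sums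
    of elementary tensors after orthonormalizing one factor ([gram_schmidt]).
    Representations of C*-algebras are contractive ([rep_contractive]); as the
    minimal norm is computed by representations, *-homomorphisms into minimal
    tensor products are contractive too ([star_hom_contractive]), whence the
    convergence of the comultiplication on the c_0-direct sum
    ([cuntz_delta_spec]). Existence of the embeddings [phi_(n,m)] and of the
    product states is implied by the hypothesis on the states, since the states
    [omega_(nm)] are not zero ([cuntz_phi_spec]). *)

(** * Bounded linear maps and closed subspaces *)

Section LinearMaps.
Context (R : pzRingType) (U V W : lmodType R).
Implicit Types f g : U -> V.

Lemma lin0 f : linear f -> f 0 = 0.
Proof. by move=> fL; have := fL (-1) 0 0; rewrite scaler0 addr0 scaleN1r addNr. Qed.

Lemma linD f x y : linear f -> f (x + y) = f x + f y.
Proof. by move=> fL; have := fL 1 x y; rewrite !scale1r. Qed.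

Lemma linZ f a x : linear f -> f (a *: x) = a *: f x.
Proof. by move=> fL; have := fL a x 0; rewrite !addr0 (lin0 fL) addr0. Qed.

Lemma linB f x y : linear f -> f (x - y) = f x - f y.
Proof. by move=> fL; rewrite -scaleN1r addrC fL scaleN1r addrC. Qed.

Lemma lin_sum f (I : Type) (r : seq I) (F : I -> U) :
  linear f -> f (\sum_(i <- r) F i) = \sum_(i <- r) f (F i).
Proof.
move=> fL; elim: r => [|i r IH]; first by rewrite !big_nil lin0.
by rewrite !big_cons linD// IH.
Qed.

Lemma lin_comp f (g : V -> W) : linear f -> linear g -> linear (g \o f).
Proof. by move=> fL gL a x y /=; rewrite fL gL. Qed.


Lemma lin_cst0 : linear ((fun=> 0) : U -> V).
Proof. by move=> a x y /=; rewrite scaler0 addr0. Qed.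

End LinearMaps.

Section Bounded.
Context (R : realType).
Notation C := R[i].
Implicit Types V W X : normedModType C.

Lemma le_eps (x y : C) : (forall e, 0 < e -> x <= y + e) -> x <= y.
Proof.
move=> h; have xy : x - y \is Num.real.
  have := h 1 ltr01; rewrite -subr_ge0 => /ger0_real.
  move=> h1; rewrite (_ : x - y = 1 - (y + 1 - x)); first exact: realB.
  by ring.
rewrite -subr_le0 real_leNgt ?real0//; apply/negP => xy0.
have e0 : 0 < (x - y) / 2 by rewrite divr_gt0.
have := h _ e0; rewrite -lerBlDl => h'.
have : x - y < x - y.
  by apply: le_lt_trans h' _; rewrite ltr_pdivrMr// mulr_natr mulr2n ltrDl.
by rewrite ltxx.
Qed.

Lemma small_eps (M e : C) : 0 <= M -> 0 < e -> exists2 d, 0 < d & M * d <= e.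
Proof.
move=> M0 e0; exists (e / (M + 1)); first by rewrite divr_gt0// ltr_wpDl.
rewrite mulrCA ler_piMr//; first exact: ltW.
by rewrite ler_pdivrMr ?mul1r ?lerDl// ltr_wpDl.
Qed.

Definition bounded_by V W (M : C) (T : V -> W) :=
  linear T /\ forall x, `|T x| <= M * `|x|.

Lemma bounded_byW V W M (T : V -> W) : bounded_by M T -> bounded_linear T.
Proof. by case=> TL Tb; split=> //; exists M. Qed.

(** The constant in [bounded_linear] is an arbitrary complex number; it may
    always be replaced by its modulus. *)
Lemma bounded_linear_ge0 V W (T : V -> W) :
  bounded_linear T -> exists2 M, 0 <= M & bounded_by M T.
Proof.
case=> TL [M TM]; exists `|M| => //; split=> // x.
apply: le_trans (TM x) _.
have := le_trans (normr_ge0 _) (TM x) => /normr_idP <-.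
by rewrite normrM normr_id.
Qed.

Lemma bl_linear V W (T : V -> W) : bounded_linear T -> linear T.
Proof. by case. Qed.

Lemma bl_comp V W X (S : W -> X) (T : V -> W) :
  bounded_linear S -> bounded_linear T -> bounded_linear (S \o T).
Proof.
move=> /bounded_linear_ge0[M M0 [SL SM]] /bounded_linear_ge0[N N0 [TL TN]].
split; first exact: lin_comp.
exists (M * N) => x /=; apply: le_trans (SM _) _.
by rewrite -mulrA ler_wpM2l.
Qed.

Lemma bl_id V : bounded_linear (@id V).
Proof. by split=> //; exists 1 => x; rewrite mul1r. Qed.

Lemma bl_cst0 V W : bounded_linear ((fun=> 0) : V -> W).
Proof. by split; [exact: lin_cst0|exists 0 => x; rewrite normr0 mul0r]. Qed.

Lemma bl_lin2 V W (a : C) (S T : V -> W) :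
  bounded_linear S -> bounded_linear T -> bounded_linear (fun x => a *: S x + T x).
Proof.
move=> /bounded_linear_ge0[M M0 [SL SM]] /bounded_linear_ge0[N N0 [TL TN]].
split.
  move=> b x y; rewrite SL TL scalerDr !scalerA mulrC -scalerA.
  by rewrite [in RHS]scalerDr scalerA addrACA mulrC.
exists (`|a| * M + N) => x; apply: le_trans (ler_normD _ _) _.
by rewrite normrZ mulrDl lerD// -mulrA ler_wpM2l.
Qed.

Lemma bl_scale V W (a : C) (T : V -> W) :
  bounded_linear T -> bounded_linear (fun x => a *: T x).
Proof.
move=> /bounded_linear_ge0[M M0 [TL TM]]; split.
  by move=> b x y; rewrite TL scalerDr !scalerA mulrC.
by exists (`|a| * M) => x; rewrite normrZ -mulrA ler_wpM2l.
Qed.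

Lemma isometric_bl V W (T : V -> W) : isometric_op T -> bounded_linear T.
Proof. by case=> TL TN; split=> //; exists 1 => x; rewrite TN mul1r. Qed.

Lemma isometric_comp V W X (S : W -> X) (T : V -> W) :
  isometric_op S -> isometric_op T -> isometric_op (S \o T).
Proof. by move=> [SL SN] [TL TN]; split=> [|x /=]; [exact: lin_comp|rewrite SN TN]. Qed.

Definition closed_subspace V (P : V -> Prop) :=
  [/\ P 0, forall a x y, P x -> P y -> P (a *: x + y) &
      forall x, (forall e, 0 < e -> exists2 y, P y & `|x - y| < e) -> P x].

(** Totality in the form in which it is used: a property that defines a
    closed subspace holds everywhere as soon as it holds for the [p i]. *)
Definition total_family V (J : Type) (p : J -> V) :=
  forall P, closed_subspace P -> (forall i, P (p i)) -> forall x, P x.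

(** Together with the next lemmas, this recognizes the conditions to which
    totality is applied. *)
Lemma closed_preimage V W (T : V -> W) P :
  bounded_linear T -> closed_subspace P -> closed_subspace (P \o T).
Proof.
move=> /bounded_linear_ge0[M M0 [TL TM]] [P0 PL Pc]; split=> /=.
- by rewrite lin0.
- by move=> a x y Px Py; rewrite TL; exact: PL.
- move=> x h; apply: Pc => e e0.
  have [d d0 de] := small_eps M0 (divr_gt0 e0 (ltr0n C 2)).
  have [y Py xy] := h d d0; exists (T y) => //.
  rewrite -(linB _ _ TL) (le_lt_trans (TM _))//.
  apply: le_lt_trans (ler_wpM2l M0 (ltW xy)) _; apply: le_lt_trans de _.
  by rewrite ltr_pdivrMr// mulr_natr mulr2n ltrDl.
Qed.

Lemma closed_eq0 V : closed_subspace (fun x : V => x = 0).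
Proof.
split=> // [a x y -> ->|x h]; first by rewrite scaler0 addr0.
apply/eqP; rewrite -normr_le0; apply: le_eps => e /h[y ->].
by rewrite subr0 add0r => /ltW.
Qed.

Lemma closed_equalizer V W (S T : V -> W) :
  bounded_linear S -> bounded_linear T -> closed_subspace (fun x => S x = T x).
Proof.
move=> Sb Tb; have [P0 PL Pc] := closed_preimage (bl_lin2 (-1) Sb Tb) (closed_eq0 W).
have E x : (S x = T x) <-> -1 *: S x + T x = 0.
  rewrite scaleN1r addrC; split=> [->|]; first by rewrite subrr.
  by move/eqP; rewrite subr_eq0 => /eqP.
split.
- exact/E.
- by move=> a x y /E + /E + ; move=> hx hy; apply/E; exact: PL.
- by move=> x h; apply/E; apply: Pc => e /h[y /E]; exists y.
Qed.

Lemma closed_forall V (I : Type) (P : I -> V -> Prop) :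
  (forall i, closed_subspace (P i)) -> closed_subspace (fun x => forall i, P i x).
Proof.
move=> h; split.
- by move=> i; case: (h i).
- by move=> a x y Px Py i; have [_ L _] := h i; exact: L.
- move=> x hx i; have [_ _ cl] := h i; apply: cl => e /hx[y Py xy].
  by exists y.
Qed.

Lemma bl_eq_total V W (J : Type) (p : J -> V) (S T : V -> W) :
  total_family p -> bounded_linear S -> bounded_linear T ->
  (forall i, S (p i) = T (p i)) -> S =1 T.
Proof. by move=> pt Sb Tb E; exact: (pt _ (closed_equalizer Sb Tb)). Qed.

Lemma closureP V (A : set V) : closure A = setT ->
  forall x e, 0 < e -> exists2 y, A y & `|x - y| < e.
Proof.
move=> Ad x e e0; have : closure A x by rewrite Ad.
move=> /(_ (ball x e)) []; first exact: nbhsx_ballx.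
by move=> y [Ay]; rewrite -ball_normE /= => xy; exists y.
Qed.

(** Operators are constructed as closures of their graphs on a dense
    subspace. The value [T x] is the limit of the [y] with [G x' y] as [x']
    tends to [x]; it is determined by [|T x - y| <= M * |x - x'|] for all pairs
    of [G], and linearity and boundedness are read off this estimate. *)
Lemma graph_extension V (W : completeNormedModType C) (G : V -> W -> Prop) (M : C) :
  0 <= M ->
  (forall a x y x' y', G x y -> G x' y' -> G (a *: x + x') (a *: y + y')) ->
  (forall x y, G x y -> `|y| <= M * `|x|) ->
  (forall x e, 0 < e -> exists x' y, G x' y /\ `|x - x'| < e) ->
  exists2 T : V -> W, bounded_by M T & forall x y, G x y -> T x = y.
Proof.
move=> M0 GL GM Gd.
have GB x y x' y' : G x y -> G x' y' -> `|y - y'| <= M * `|x - x'|.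
  move=> h h'; have := GL (-1) _ _ _ _ h' h.
  by rewrite !scaleN1r addrC [- y' + y]addrC; exact: GM.
have key x : exists y, forall x' w, G x' w -> `|y - w| <= M * `|x - x'|.
  (* the values of G near x generate a Cauchy filter *)
  pose F : set_system W := [set A | exists2 e : C, 0 < e &
    forall x' w, G x' w -> `|x - x'| < e -> A w].
  have FF : ProperFilter F.
    split.
      by move=> -[e e0 h]; have [x' [w [g xx']]] := Gd x e e0; exact: (h x' w).
    split.
    - by exists 1.
    - move=> A B [e e0 he] [d d0 hd]; exists (Num.min e d).
        by rewrite /Num.min; case: ifP.
      move=> x' w g; rewrite /Num.min.
      have er := gtr0_real e0; have dr := gtr0_real d0.
      move=> xx'; split; [apply: (he x')|apply: (hd x')] => //.
        by move: xx'; case: ifP => // /negbT; rewrite -real_leNgt// => de /lt_le_trans; apply.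
      by move: xx'; case: ifP => // ed /lt_trans; apply.
    - by move=> A B AB [e e0 h]; exists e => // x' w g /(h _ _ g)/AB.
  have : cauchy F.
    apply: cauchy_exP => e e0.
    have [d d0 de] := small_eps M0 (divr_gt0 e0 (ltr0n C 2)).
    have d20 : 0 < d / 2 by rewrite divr_gt0.
    have [x0 [w0 [g0 xx0]]] := Gd x _ d20.
    exists w0, (d / 2) => // x' w g xx'.
    rewrite -ball_normE /=; apply: le_lt_trans (GB _ _ _ _ g0 g) _.
    apply: (@le_lt_trans _ _ (M * d)).
      apply: ler_wpM2l => //.
      rewrite (_ : x0 - x' = - (x - x0) + (x - x')); last first.
        by rewrite opprB addrA addrNK.
      apply: le_trans (ler_normD _ _) _; rewrite normrN.
      by rewrite [d]splitr lerD// ltW.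
    by apply: le_lt_trans de _; rewrite ltr_pdivrMr// mulr_natr mulr2n ltrDl.
  move=> /cauchy_cvg => Fc; exists (lim F) => x' w g; apply: le_eps => e e0.
  have e20 : 0 < e / 2 by rewrite divr_gt0.
  have [d d0 de] := small_eps M0 e20.
  have := Fc _ (nbhsx_ballx (lim F) _ e20) => -[r r0 hr].
  have [m [m0 md mr]] : exists m, [/\ 0 < m, m <= d & m <= r].
    have [dr|rd] := real_leP (gtr0_real d0) (gtr0_real r0).
      by exists d.
    by exists r; split => //; exact: ltW.
  have [x1 [w1 [g1 xx1]]] := Gd x m m0.
  have := hr _ _ g1 (lt_le_trans xx1 mr); rewrite -ball_normE /= => h1.
  rewrite (_ : lim F - w = (lim F - w1) + (w1 - w)); last by rewrite addrA addrNK.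
  apply: le_trans (ler_normD _ _) _; rewrite addrC [e]splitr addrA.
  apply: lerD; last exact: ltW.
  apply: le_trans (GB _ _ _ _ g1 g) _.
  rewrite (_ : x1 - x' = (x - x') - (x - x1)); last first.
    by rewrite opprB [RHS]addrC addrA addrNK.
  apply: le_trans (ler_wpM2l M0 (ler_normB _ _)) _.
  rewrite mulrDr lerD2l; apply: le_trans de; apply: ler_wpM2l => //.
  exact: le_trans (ltW xx1) md.
have [T hT] := choice key.
have hG x y : G x y -> T x = y.
  move=> g; apply/eqP; rewrite -subr_eq0 -normr_le0.
  by apply: le_trans (hT x _ _ g) _; rewrite subrr normr0 mulr0.
have Tnear x e : 0 < e -> exists x' y, [/\ G x' y, `|x - x'| <= e & `|T x - y| <= e].
  move=> e0; have [d d0 de] := small_eps M0 e0.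
  have [m [m0 md mr]] : exists m, [/\ 0 < m, m <= d & m <= e].
    have [dr|rd] := real_leP (gtr0_real d0) (gtr0_real e0).
      by exists d.
    by exists e; split => //; exact: ltW.
  have [x' [y [g xx']]] := Gd x m m0; exists x', y; split=> //.
    exact: le_trans (ltW xx') mr.
  apply: le_trans (hT _ _ _ g) _; apply: le_trans de; apply: ler_wpM2l => //.
  exact: le_trans (ltW xx') md.
exists T => //; split.
  move=> a x y; apply/eqP; rewrite -subr_eq0 -normr_le0; apply: le_eps => e e0.
  pose K := (M + 1) * (`|a| + 1).
  have K0 : 0 <= K by rewrite mulr_ge0// addr_ge0.
  have [d d0 de] := small_eps K0 e0.
  have [x1 [u1 [g1 xx1 tu1]]] := Tnear x d d0.
  have [y1 [v1 [g2 yy1 tv1]]] := Tnear y d d0.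
  have := hT (a *: x + y) _ _ (GL a _ _ _ _ g1 g2).
  rewrite (_ : a *: x + y - _ = a *: (x - x1) + (y - y1)); last first.
    by rewrite scalerBr opprD addrACA.
  move=> h; rewrite (_ : T (a *: x + y) - _ =
     (T (a *: x + y) - (a *: u1 + v1)) - (a *: (T x - u1) + (T y - v1))); last first.
    by rewrite scalerBr addrACA -opprD opprB addrA addrNK.
  apply: le_trans (ler_normB _ _) _; rewrite add0r; apply: le_trans de.
  have bnd (V' : normedModType C) (s t : V') : `|s| <= d -> `|t| <= d ->
      `|a *: s + t| <= (`|a| + 1) * d.
    move=> hs ht; apply: le_trans (ler_normD _ _) _.
    by rewrite normrZ mulrDl mul1r lerD// ler_wpM2l.
  rewrite /K -mulrA [X in _ <= X]mulrDl mul1r lerD//; last exact: bnd.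
  by apply: le_trans h _; apply: ler_wpM2l => //; exact: bnd.
move=> x; apply: le_eps => e e0.
have K0 : 0 <= M + 1 by rewrite addr_ge0.
have [d d0 de] := small_eps K0 e0.
have [x1 [u1 [g1 xx1 tu1]]] := Tnear x d d0.
rewrite -[T x](addrNK u1); apply: le_trans (ler_normD _ _) _.
rewrite addrC; apply: le_trans (_ : M * (`|x| + d) + d <= _).
  rewrite lerD//; apply: le_trans (GM _ _ g1) _; apply: ler_wpM2l => //.
  rewrite (_ : x1 = x - (x - x1)); last by rewrite opprB addrC addrNK.
  by apply: le_trans (ler_normB _ _) _; rewrite lerD2l.
by rewrite mulrDr -addrA lerD2l; apply: le_trans de; rewrite mulrDl mul1r.
Qed.

Definition lin_comb V (J : Type) (p : J -> V) (s : seq (C * J)) : V :=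
  \sum_(t <- s) t.1 *: p t.2.

Lemma lin_combP V (J : Type) (p : J -> V) a s s' :
  lin_comb p ([seq (a * t.1, t.2) | t <- s] ++ s') = a *: lin_comb p s + lin_comb p s'.
Proof.
rewrite /lin_comb big_cat big_map /= scaler_sumr; congr (_ + _).
by apply: eq_bigr => t _; rewrite scalerA.
Qed.

(** The vectors approximable by finite combinations form a closed subspace. *)
Lemma total_dense V (J : Type) (p : J -> V) : total_family p ->
  forall x e, 0 < e -> exists s, `|x - lin_comb p s| < e.
Proof.
move=> pt; apply: (pt (fun x => forall e : C, 0 < e -> exists s, `|x - lin_comb p s| < e)).
  split.
  - by move=> e e0; exists [::]; rewrite /lin_comb big_nil subrr normr0.
  - move=> a x y hx hy e e0; have e20 : 0 < e / 2 by rewrite divr_gt0.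
    have [d d0 de] := small_eps (normr_ge0 a) e20.
    have [s hs] := hx d d0; have [s' hs'] := hy _ e20.
    exists ([seq (a * t.1, t.2) | t <- s] ++ s').
    rewrite lin_combP opprD addrACA -scalerBr.
    apply: le_lt_trans (ler_normD _ _) _; rewrite [e]splitr normrZ.
    by apply: ler_ltD => //; apply: le_trans de; apply: ler_wpM2l => //; exact: ltW.
  - move=> x hx e e0; have e20 : 0 < e / 2 by rewrite divr_gt0.
    have [y hy xy] := hx _ e20; have [s hs] := hy _ e20; exists s.
    rewrite -[x](addrNK y) -addrA; apply: le_lt_trans (ler_normD _ _) _.
    by rewrite [e]splitr ltrD.
move=> i e e0; exists [:: (1, i)].
by rewrite /lin_comb big_seq1 scale1r subrr normr0.
Qed.

Lemma total_closure V (J : Type) (p : J -> V) (A : set V) : closure A = setT ->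
  (forall x, A x -> exists s : seq (C * J), x = lin_comb p s) -> total_family p.
Proof.
move=> Ad Ap P [P0 PL Pc] Pp x; apply: Pc => e e0.
have [y Ay xy] := closureP Ad x e0; exists y => //.
have [s ->] := Ap _ Ay; rewrite /lin_comb; elim: s => [|t s IH].
  by rewrite big_nil.
by rewrite big_cons; exact: PL.
Qed.

End Bounded.

(** * Hilbert spaces *)

Section HilbertBasics.
Context (R : realType).
Notation C := R[i].
Implicit Types H K L : hilbertType R.

Lemma hdot0r H (x : H) : hdot x 0 = 0.
Proof. by have := hdot_linear x (-1) 0 0; rewrite scaler0 addr0 mulN1r addNr. Qed.

Lemma hdotDr H (x y z : H) : hdot x (y + z) = hdot x y + hdot x z.
Proof. by have := hdot_linear x 1 y z; rewrite scale1r mul1r. Qed.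

Lemma hdotZr H a (x y : H) : hdot x (a *: y) = a * hdot x y.
Proof. by have := hdot_linear x a y 0; rewrite hdot0r !addr0. Qed.

Lemma hdotBr H (x y z : H) : hdot x (y - z) = hdot x y - hdot x z.
Proof. by rewrite -scaleN1r hdotDr hdotZr mulN1r. Qed.

Lemma hdot_sumr H (I : Type) (r : seq I) (x : H) (F : I -> H) :
  hdot x (\sum_(i <- r) F i) = \sum_(i <- r) hdot x (F i).
Proof.
by elim: r => [|i r IH]; rewrite ?big_nil ?hdot0r// !big_cons hdotDr IH.
Qed.

Lemma hdot0l H (x : H) : hdot 0 x = 0.
Proof. by rewrite hdotC hdot0r rmorph0. Qed.

Lemma hdotDl H (x y z : H) : hdot (x + y) z = hdot x z + hdot y z.
Proof. by rewrite hdotC hdotDr rmorphD /= -!hdotC. Qed.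

Lemma hdotZl H a (x y : H) : hdot (a *: x) y = a^* * hdot x y.
Proof. by rewrite hdotC hdotZr rmorphM /= -hdotC. Qed.

Lemma hdotBl H (x y z : H) : hdot (x - y) z = hdot x z - hdot y z.
Proof. by rewrite hdotC hdotBr rmorphB /= -!hdotC. Qed.

Lemma hdot_suml H (I : Type) (r : seq I) (x : H) (F : I -> H) :
  hdot (\sum_(i <- r) F i) x = \sum_(i <- r) hdot (F i) x.
Proof.
by elim: r => [|i r IH]; rewrite ?big_nil ?hdot0l// !big_cons hdotDl IH.
Qed.

Lemma hdot_eq0 H (x : H) : hdot x x = 0 -> x = 0.
Proof. by rewrite hdot_norm => /eqP; rewrite expf_eq0 /= normr_eq0 => /eqP. Qed.

Lemma hdot0C H (x y : H) : hdot x y = 0 -> hdot y x = 0.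
Proof. by move=> h; rewrite hdotC h rmorph0. Qed.

Lemma hdot_ge0 H (x : H) : 0 <= hdot x x.
Proof. by rewrite hdot_norm exprn_ge0. Qed.

Lemma hdot_inj H (x y : H) : (forall z, hdot z x = hdot z y) -> x = y.
Proof.
move=> h; apply/eqP; rewrite -subr_eq0; apply/eqP/hdot_eq0.
by rewrite hdotBr h subrr.
Qed.

Lemma norm_le_hdot H K (x : H) (y : K) (M : C) : 0 <= M ->
  hdot y y <= M ^+ 2 * hdot x x -> `|y| <= M * `|x|.
Proof.
move=> M0; rewrite !hdot_norm -exprMn.
by rewrite ler_pXn2r// ?nnegrE// mulr_ge0.
Qed.

Lemma norm_eq_hdot H K (x : H) (y : K) : hdot x x = hdot y y -> `|x| = `|y|.
Proof.
rewrite !hdot_norm => /eqP; rewrite eqrXn2// ?normr_ge0// => /eqP//.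
Qed.

Lemma pythagoras H (x y : H) : hdot x y = 0 ->
  hdot (x + y) (x + y) = hdot x x + hdot y y.
Proof.
by move=> xy; rewrite hdotDl !hdotDr xy (hdot0C xy) addr0 add0r.
Qed.

Lemma cauchy_schwarz H (x y : H) : `|hdot x y| <= `|x| * `|y|.
Proof.
have [->|x0] := eqVneq x 0; first by rewrite hdot0l !normr0 mul0r.
have X0 : 0 < hdot x x by rewrite hdot_norm exprn_gt0// normr_gt0.
have := hdot_ge0 (hdot x x *: y - hdot x y *: x).
rewrite hdotBl !hdotBr !hdotZl !hdotZr.
have -> : (hdot x x)^* = hdot x x by rewrite -hdotC.
rewrite -(hdotC x y).
set X := hdot x x; set Y := hdot y y; set Z := hdot x y; set Z' := hdot y x.
have -> : X * (X * Y) - X * (Z * Z') - (Z' * (X * Z) - Z' * (Z * X)) = X * (X * Y - Z * Z').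
  by ring.
rewrite pmulr_rge0// subr_ge0 /Z' hdotC -normCK => h.
rewrite -(ler_pXn2r (n := 2))// ?nnegrE ?mulr_ge0// exprMn.
by rewrite -!hdot_norm.
Qed.

Lemma bl_hdot H (x : H) : bounded_linear (hdot x : H -> C^o).
Proof. by split; [exact: hdot_linear|exists `|x|; exact: cauchy_schwarz]. Qed.

Lemma closed_hdot2 H K L (x : K) (y : L) (S : H -> K) (T : H -> L) :
  bounded_linear S -> bounded_linear T ->
  closed_subspace (fun z => hdot x (S z) = hdot y (T z)).
Proof.
move=> Sb Tb; exact: (closed_equalizer (bl_comp (bl_hdot x) Sb) (bl_comp (bl_hdot y) Tb)).
Qed.

(** Sesquilinear identities propagate from total families one variable at a
    time, the antilinear variable being reached by conjugating. *)
Lemma hdot_total H1 H2 K L (I J : Type) (p : I -> H1) (q : J -> H2)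
    (S : H1 -> K) (S' : H2 -> K) (T : H1 -> L) (T' : H2 -> L) :
  total_family p -> total_family q ->
  bounded_linear S -> bounded_linear S' -> bounded_linear T -> bounded_linear T' ->
  (forall i j, hdot (S (p i)) (S' (q j)) = hdot (T (p i)) (T' (q j))) ->
  forall x y, hdot (S x) (S' y) = hdot (T x) (T' y).
Proof.
move=> pt qt Sb Sb' Tb Tb' h x y; move: y; apply: (qt _ (closed_hdot2 _ _ Sb' Tb')) => j.
rewrite hdotC [RHS]hdotC; congr (_^*).
move: x; apply: (pt _ (closed_hdot2 _ _ Sb Tb)) => i.
by rewrite hdotC h -hdotC.
Qed.

Lemma isometric_hdot H K (T : H -> K) : isometric_op T ->
  forall x y, hdot (T x) (T y) = hdot x y.
Proof.
move=> [TL TN] x; pose d y := hdot (T x) (T y) - hdot x y.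
have N y : hdot (T y) (T y) = hdot y y by rewrite !hdot_norm TN.
have dd y : d y + (d y)^* = 0.
  have := N (x + y); rewrite linD// !hdotDl !hdotDr !N.
  rewrite /d rmorphB /= -!hdotC => h.
  rewrite [LHS](_ : _ = (hdot x x + hdot (T x) (T y) + (hdot (T y) (T x) + hdot y y))
     - (hdot x x + hdot x y + (hdot y x + hdot y y))); last by ring.
  by rewrite h subrr.
move=> y; apply/eqP; rewrite -subr_eq0 -/(d y).
have di : d ('i *: y) = 'i * d y by rewrite /d linZ// !hdotZr mulrBr.
have := dd ('i *: y); rewrite di rmorphM /= conjCi mulNr -mulrBr => /eqP.
rewrite mulf_eq0 (negPf (neq0Ci _)) /= subr_eq0 => /eqP e.
by have := dd y; rewrite -e => /eqP; rewrite -mulr2n mulrn_eq0.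
Qed.

(** Equality of inner products makes the prescription [p i |-> q i] well defined
    and isometric on linear combinations. Associativity of tensor products, the
    exchange of factors and the GNS embeddings are all obtained in this way. *)
Lemma isometry_extension H K (J : Type) (p : J -> H) (q : J -> K) :
  total_family p -> (forall i j, hdot (p i) (p j) = hdot (q i) (q j)) ->
  exists2 T : H -> K, isometric_op T & forall i, T (p i) = q i.
Proof.
move=> pt pq.
have NE s s' : hdot (lin_comb p s) (lin_comb p s') = hdot (lin_comb q s) (lin_comb q s').
  rewrite /lin_comb !hdot_suml; apply: eq_bigr => t _.
  rewrite !hdot_sumr; apply: eq_bigr => t' _.
  by rewrite !hdotZl !hdotZr pq.
pose G x y := exists s, x = lin_comb p s /\ y = lin_comb q s.
have GN x y : G x y -> `|y| = `|x|.
  by move=> [s [-> ->]]; apply: norm_eq_hdot; rewrite NE.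
have [||||T [TL TM] TG] := @graph_extension R H K G 1.
- exact: ler01.
- move=> a x y x' y' [s [-> ->]] [s' [-> ->]].
  by exists ([seq (a * t.1, t.2) | t <- s] ++ s'); rewrite !lin_combP.
- by move=> x y /GN ->; rewrite mul1r.
- move=> x e e0; have [s hs] := total_dense pt x e0.
  by exists (lin_comb p s), (lin_comb q s); split=> //; exists s.
exists T; last first.
  by move=> i; apply: TG; exists [:: (1, i)]; rewrite /lin_comb !big_seq1 !scale1r.
split=> //.
have Tb : bounded_linear T by split=> //; exists 1.
move=> x; apply: norm_eq_hdot; rewrite -[RHS]/(hdot (id x) (id x)).
apply: (hdot_total (S := T) (S' := T) (T := id) (T' := id) pt pt) => //; try exact: bl_id.
move=> i j; have E k : G (p k) (q k).
  by exists [:: (1, k)]; rewrite /lin_comb !big_seq1 !scale1r.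
by rewrite !(TG _ _ (E _)) pq.
Qed.

(** Here [Q] plays the part of [T* T], and the second hypothesis says that it is
    a projection; then [1 - Q] maps onto the kernel of [T]. *)
Lemma partial_isometry_criterion H K (T : H -> K) (Q : H -> H) :
  bounded_linear T -> (forall x y, hdot x (Q y) = hdot (T x) (T y)) ->
  (forall x, T (Q x) = T x) -> partial_isometry T.
Proof.
move=> Tb QT TQ; split=> // x xker.
have TL := bl_linear Tb.
have z0 : T (x - Q x) = 0 by rewrite linB// TQ subrr.
have e : x - Q x = 0.
  apply: hdot_eq0; rewrite hdotBr (xker _ z0) QT z0 hdot0l.
  by rewrite subr0.
apply/eqP; rewrite -(eqrXn2 (n := 2))// ?normr_ge0//; rewrite -!hdot_norm -QT.
by move/eqP: e; rewrite subr_eq0 => /eqP <-.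
Qed.

Lemma adjointP H K (T : H -> K) (S : K -> H) : bounded_linear S ->
  (forall x y, hdot (T x) y = hdot x (S y)) -> adjoint T =1 S.
Proof.
move=> Sb TS; have : exists f : K -> H, bounded_linear f /\
   forall x y, hdot (T x) y = hdot x (f y) by exists S.
by move=> /the_mapP[_ h] y; apply: hdot_inj => z; rewrite -h TS.
Qed.

(** The vector [S y] is shortest in the fibre of [T] over [y], hence orthogonal
    to the kernel of [T]; this identifies [S] with the adjoint of [T]. *)
Lemma adjoint_isometric H K (T : H -> K) (S : K -> H) :
  bounded_by 1 T -> isometric_op S -> (forall y, T (S y) = y) ->
  isometric_op (adjoint T).
Proof.
move=> [TL T1] Si TS; have SL := Si.1.
(* minimality of the norm of [S y] in the fibre of [T] over [y] *)
have orth k y : T k = 0 -> hdot k (S y) = 0.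
  move=> Tk.
  have [->|k0] := eqVneq k 0; first exact: hdot0l.
  have K0 : 0 < hdot k k by rewrite hdot_norm exprn_gt0// normr_gt0.
  (* the c for which [c *: k + S y] is orthogonal to k *)
  pose c := - (hdot k (S y) / hdot k k).
  have := T1 (c *: k + S y); rewrite TL Tk scaler0 add0r TS mul1r -(Si.2 y).
  rewrite -(ler_pXn2r (n := 2))// ?nnegrE// -!hdot_norm.
  rewrite hdotDl !hdotDr !hdotZl !hdotZr.
  set a := hdot k (S y); have -> : hdot (S y) k = a^* by rewrite hdotC.
  rewrite -subr_ge0 (_ : _ - _ = - (`|a| ^+ 2 / hdot k k)); last first.
    rewrite normCK /c rmorphN rmorphM fmorphV /= -hdotC -/a.
    by field; rewrite fmorph_eq0 gt_eqF.
  rewrite oppr_ge0 pmulr_lle0 ?invr_gt0// => h.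
  have : `|a| ^+ 2 == 0 by rewrite eq_le h exprn_ge0.
  by rewrite expf_eq0 /= normr_eq0 => /eqP.
have Sb : bounded_linear S by exact: isometric_bl.
have E x y : hdot (T x) y = hdot x (S y).
  rewrite -[x in RHS](addrNK (S (T x))) hdotDl orth ?add0r ?isometric_hdot//.
  by rewrite linB// TS subrr.
have A := adjointP Sb E.
split; first by move=> a x y; rewrite !A SL.
by move=> x; rewrite A Si.2.
Qed.

(** The inverse, prescribed on the total family [p], extends to the whole
    space. *)
Lemma isometry_onto H K (T : H -> K) (J : Type) (p : J -> K) :
  isometric_op T -> total_family p -> (forall i, exists x, T x = p i) ->
  exists2 S : K -> H, isometric_op S & forall y, T (S y) = y.
Proof.
move=> Ti pt pT; have [f fT] := choice pT.
have [S Si SE] : exists2 S : K -> H, isometric_op S & forall i, S (p i) = f i.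
  by apply: isometry_extension => // i j; rewrite -!fT isometric_hdot.
exists S => //; apply: (bl_eq_total (S := T \o S) (T := id) pt).
- by apply: bl_comp; exact: isometric_bl.
- exact: bl_id.
- by move=> i /=; rewrite SE.
Qed.

End HilbertBasics.

(** * Tensor products of Hilbert spaces *)

Section HilbertTensor.
Context (R : realType).
Notation C := R[i].

Section OneTensor.
Context (H K : hilbertType R) (t : htensor H K).

Lemma norm_tens x y : `|ht_map t x y| = `|x| * `|y|.
Proof.
apply/eqP; rewrite -(eqrXn2 (n := 2))// ?mulr_ge0//.
by rewrite exprMn -!hdot_norm ht_dot.
Qed.

Lemma bl_tensr x : bounded_linear (ht_map t x).
Proof.
by split; [exact: ht_linearr|exists `|x| => y; rewrite norm_tens].
Qed.

Lemma bl_tensl y : bounded_linear (ht_map t ^~ y).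
Proof.
by split; [exact: ht_linearl|exists `|y| => x; rewrite norm_tens mulrC].
Qed.

Lemma tens0l y : ht_map t 0 y = 0.
Proof. by have := lin0 (ht_linearl t y). Qed.

Lemma tens0r x : ht_map t x 0 = 0.
Proof. by have := lin0 (ht_linearr t x). Qed.

Lemma tensZl a x y : ht_map t (a *: x) y = a *: ht_map t x y.
Proof. by have := linZ a x (ht_linearl t y). Qed.

Lemma tensZr a x y : ht_map t x (a *: y) = a *: ht_map t x y.
Proof. by have := linZ a y (ht_linearr t x). Qed.

Definition elementary (p : H * K) : t := ht_map t p.1 p.2.

Lemma total_elementary : total_family elementary.
Proof.
apply: (total_closure (ht_dense t)) => _ [s ->].
exists [seq (1, p) | p <- s]; rewrite /lin_comb big_map.
by apply: eq_bigr => p _; rewrite scale1r.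
Qed.

Lemma total_tens (I J : Type) (p : I -> H) (q : J -> K) :
  total_family p -> total_family q ->
  total_family (fun ij : I * J => ht_map t (p ij.1) (q ij.2)).
Proof.
move=> pt qt P Pc h; apply: (total_elementary Pc) => -[x y] /=.
apply: (pt _ (closed_preimage (bl_tensl y) Pc)) => i /=.
apply: (qt _ (closed_preimage (bl_tensr (p i)) Pc)) => j /=.
exact: (h (i, j)).
Qed.

Lemma bl_eq_tens (V : normedModType C) (S T : t -> V) :
  bounded_linear S -> bounded_linear T ->
  (forall x y, S (ht_map t x y) = T (ht_map t x y)) -> S =1 T.
Proof.
by move=> Sb Tb h; apply: (bl_eq_total total_elementary Sb Tb) => -[x y]; exact: h.
Qed.

Lemma flip_dense : closure [set z : t | exists s : seq (K * H),
  z = \sum_(p <- s) ht_map t p.2 p.1] = setT.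
Proof.
rewrite -(ht_dense t); congr closure; apply/seteqP; split=> z [s ->] /=.
  by exists [seq (p.2, p.1) | p <- s]; rewrite big_map.
by exists [seq (p.2, p.1) | p <- s]; rewrite big_map.
Qed.

(** The same space, seen as a tensor product of [K] and [H]; statements about
    the first factor become statements about the second one. *)
Definition flip : htensor K H :=
  @HTensor R K H t (fun y x => ht_map t x y)
    (fun x => ht_linearr t x) (fun y => ht_linearl t y)
    (fun y y' x x' => etrans (ht_dot t x x' y y') (mulrC _ _)) flip_dense.

End OneTensor.
Arguments total_elementary {H K} t.
Arguments total_tens {H K} t {I J p q}.

Fixpoint orthonormal (K : hilbertType R) (es : seq K) : Prop :=
  if es is e :: es' then
    [/\ hdot e e = 1, forall e', e' \in es' -> hdot e e' = 0 & orthonormal es']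
  else True.

Lemma orthonormal_residual (K : hilbertType R) (es : seq K) (y e : K) :
  orthonormal es -> e \in es ->
  hdot e (y - \sum_(f <- es) hdot f y *: f) = 0.
Proof.
elim: es => //= f es IH [ff fes oes]; rewrite inE big_cons => /predU1P[->|ees].
  rewrite hdotBr hdotDr hdotZr ff mulr1 hdot_sumr big_seq big1 ?addr0 ?subrr//.
  by move=> g ges; rewrite hdotZr fes// mulr0.
rewrite opprD addrCA hdotDr IH// addr0 -scaleN1r !hdotZr.
by rewrite (hdot0C (fes _ ees)) !mulr0.
Qed.

(** Gram-Schmidt on the second components. The rewriting only uses bilinearity,
    so that it is valid at once for the sums of [x (x) y] and of [T x (x) y]. *)
Lemma gram_schmidt (H K : hilbertType R) (s : seq (H * K)) :
  exists2 u : seq (H * K), orthonormal [seq p.2 | p <- u] &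
    forall (V : lmodType C) (b : H -> K -> V),
      (forall y, linear (b ^~ y)) -> (forall x, linear (b x)) ->
      \sum_(p <- s) b p.1 p.2 = \sum_(p <- u) b p.1 p.2.
Proof.
elim: s => [|[x y] s [u ou IH]]; first by exists [::].
pose es := [seq p.2 | p <- u].
pose r := y - \sum_(f <- es) hdot f y *: f.
pose u1 := [seq (p.1 + hdot p.2 y *: x, p.2) | p <- u].
have u1E : [seq p.2 | p <- u1] = es by rewrite /u1 -map_comp.
have bE (V : lmodType C) (b : H -> K -> V) :
    (forall y, linear (b ^~ y)) -> (forall x, linear (b x)) ->
    \sum_(p <- (x, y) :: s) b p.1 p.2 = b x r + \sum_(p <- u1) b p.1 p.2.
  move=> bl br; rewrite big_cons /= (IH _ _ bl br).
  have yE : y = r + \sum_(p <- u) hdot p.2 y *: p.2.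
    by rewrite /r /es big_map addrNK.
  rewrite {1}yE (linD _ _ (br x)) (lin_sum _ _ (br x)) -addrA; congr (_ + _).
  rewrite /u1 big_map -big_split /=; apply: eq_bigr => p _.
  have h2 := linD p.1 (hdot p.2 y *: x) (bl p.2).
  have h1 := linZ (hdot p.2 y) x (bl p.2).
  rewrite /= in h1 h2.
  by rewrite h2 h1 (linZ _ _ (br x)) addrC.
have r_orth f : f \in es -> hdot f r = 0 by exact: orthonormal_residual.
have [r0|r0] := eqVneq r 0.
  exists u1; first by rewrite u1E.
  by move=> V b bl br; rewrite bE// r0 (lin0 (br x)) add0r.
have nr0 : `|r| != 0 by rewrite normr_eq0.
exists ((`|r| *: x, `|r|^-1 *: r) :: u1) => /=.
  rewrite u1E; split=> //.
    rewrite hdot_norm normrZ ger0_norm ?invr_ge0//.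
    by rewrite mulVf// expr1n.
  by move=> f fes; rewrite hdotZl (hdot0C (r_orth _ fes)) mulr0.
move=> V b bl br; rewrite bE// big_cons /=; congr (_ + _).
have h1 := linZ `|r| x (bl (`|r|^-1 *: r)); rewrite /= in h1.
by rewrite h1 (linZ _ _ (br x)) scalerA mulfV// scale1r.
Qed.

Lemma orthonormal_norm (H K : hilbertType R) (t : htensor H K) (u : seq (H * K)) :
  orthonormal [seq p.2 | p <- u] ->
  hdot (\sum_(p <- u) ht_map t p.1 p.2) (\sum_(p <- u) ht_map t p.1 p.2)
    = \sum_(p <- u) hdot p.1 p.1.
Proof.
elim: u => [|p u IH] /=; first by rewrite !big_nil hdot0r.
move=> [ee ort ou]; rewrite !big_cons pythagoras ?IH ?ht_dot ?ee ?mulr1//.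
rewrite hdot_sumr big_seq big1// => q qu.
by rewrite ht_dot ort ?mulr0//; apply: map_f.
Qed.

(** When the second components are orthonormal, [|sum x (x) e|^2 = sum |x|^2];
    this makes [T (x) 1] bounded on finite sums by a bound of [T]. *)
Lemma tens_op_left (H H' K : hilbertType R) (t : htensor H K) (t' : htensor H' K)
    (T : H -> H') (M : C) : 0 <= M -> bounded_by M T ->
  exists2 V : t -> t', bounded_by M V &
    forall x y, V (ht_map t x y) = ht_map t' (T x) y.
Proof.
move=> M0 [TL TM].
pose G z w := exists s : seq (H * K),
  z = \sum_(p <- s) ht_map t p.1 p.2 /\ w = \sum_(p <- s) ht_map t' (T p.1) p.2.
have [||||V Vb VG] := @graph_extension R t t' G M.
- exact: M0.
- move=> a z w z' w' [s [-> ->]] [s' [-> ->]].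
  exists ([seq (a *: p.1, p.2) | p <- s] ++ s'); rewrite !big_cat !big_map /=.
  split; congr (_ + _); rewrite scaler_sumr; apply: eq_bigr => p _.
    by rewrite tensZl.
  by rewrite linZ// tensZl.
- move=> z w [s [-> ->]]; have [u ou uE] := gram_schmidt s.
  rewrite (uE _ (fun x y => ht_map t x y) (ht_linearl t) (ht_linearr t)).
  rewrite (uE _ (fun x y => ht_map t' (T x) y)); last first.
  - by move=> x; exact: ht_linearr.
  - by move=> y; exact: (lin_comp TL (ht_linearl t' y)).
  apply: norm_le_hdot => //; rewrite orthonormal_norm//.
  have -> : \sum_(p <- u) ht_map t' (T p.1) p.2 =
      \sum_(p <- [seq (T p.1, p.2) | p <- u]) ht_map t' p.1 p.2 by rewrite big_map.
  rewrite orthonormal_norm; last by rewrite -map_comp.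
  rewrite big_map mulr_sumr /=; apply: ler_sum => p _.
  by rewrite !hdot_norm -exprMn ler_pXn2r// ?nnegrE ?mulr_ge0.
- move=> z e e0; have [_ [s ->] zs] := closureP (ht_dense t) z e0.
  by exists (\sum_(p <- s) ht_map t p.1 p.2), (\sum_(p <- s) ht_map t' (T p.1) p.2);
    split=> //; exists s.
exists V => // x y; apply: VG; exists [:: (x, y)].
by rewrite !big_seq1.
Qed.

Context (ht : htensors R).

Section HtensOp.
Context (H1 H2 K1 K2 : hilbertType R) (T1 : H1 -> K1) (T2 : H2 -> K2).

Lemma htens_op_bounded (M1 M2 : C) : 0 <= M1 -> 0 <= M2 ->
  bounded_by M1 T1 -> bounded_by M2 T2 ->
  exists2 V : ht H1 H2 -> ht K1 K2, bounded_by (M2 * M1) V &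
    forall x y, V (x ⊗[ht] y) = T1 x ⊗[ht] T2 y.
Proof.
move=> M10 M20 T1b T2b.
have [V [VL VM] VE] := tens_op_left (ht H1 H2) (ht K1 H2) M10 T1b.
have [W [WL WM] WE] := tens_op_left (flip (ht K1 H2)) (flip (ht K1 K2)) M20 T2b.
exists (W \o V); last by move=> x y /=; rewrite VE; exact: (WE y (T1 x)).
split; first exact: lin_comp.
move=> x /=; apply: le_trans (WM _) _; rewrite -mulrA.
exact: ler_wpM2l (VM x).
Qed.

Hypotheses (T1b : bounded_linear T1) (T2b : bounded_linear T2).

Lemma htens_op_spec : bounded_linear (htens_op (ht := ht) T1 T2) /\
  forall x y, htens_op T1 T2 (x ⊗[ht] y) = T1 x ⊗[ht] T2 y.
Proof.
apply: (the_mapP (P := fun V : ht H1 H2 -> ht K1 K2 => bounded_linear V /\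
  forall x y, V (x ⊗[ht] y) = T1 x ⊗[ht] T2 y)).
have [M1 M10 b1] := bounded_linear_ge0 T1b; have [M2 M20 b2] := bounded_linear_ge0 T2b.
have [V Vb VE] := htens_op_bounded M10 M20 b1 b2.
by exists V; split=> //; exact: bounded_byW Vb.
Qed.

Lemma bl_htens_op : bounded_linear (htens_op (ht := ht) T1 T2).
Proof. by case: htens_op_spec. Qed.

Lemma htens_opE x y : htens_op T1 T2 (x ⊗[ht] y) = T1 x ⊗[ht] T2 y.
Proof. by case: htens_op_spec. Qed.

Lemma htens_op_unique (V : ht H1 H2 -> ht K1 K2) : bounded_linear V ->
  (forall x y, V (x ⊗[ht] y) = T1 x ⊗[ht] T2 y) -> htens_op T1 T2 =1 V.
Proof.
move=> Vb VE; apply: (bl_eq_tens bl_htens_op Vb) => x y.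
by rewrite htens_opE VE.
Qed.

Lemma htens_op_norm (M1 M2 : C) : 0 <= M1 -> 0 <= M2 ->
  bounded_by M1 T1 -> bounded_by M2 T2 -> forall u, `|htens_op (ht := ht) T1 T2 u| <= M2 * M1 * `|u|.
Proof.
move=> M10 M20 b1 b2 u; have [V Vb VE] := htens_op_bounded M10 M20 b1 b2.
by rewrite (htens_op_unique (bounded_byW Vb) VE); case: Vb.
Qed.

End HtensOp.

Lemma htens_op_isometric (H1 H2 K1 K2 : hilbertType R) (T1 : H1 -> K1) (T2 : H2 -> K2) :
  isometric_op T1 -> isometric_op T2 -> isometric_op (htens_op (ht := ht) T1 T2).
Proof.
move=> i1 i2; have b1 := isometric_bl i1; have b2 := isometric_bl i2.
have B := bl_htens_op b1 b2.
split; first exact: bl_linear.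
move=> x; apply: norm_eq_hdot.
have tot := total_elementary (ht H1 H2); have Ib := @bl_id R (ht H1 H2).
apply: (@hdot_total R _ _ _ _ _ _ _ _ _ _ id id tot tot B B Ib Ib).
move=> [x1 y1] [x2 y2]; rewrite /elementary /= !htens_opE// !ht_dot.
by rewrite !isometric_hdot.
Qed.

Lemma total_tens3 (H1 H2 H3 : hilbertType R) :
  total_family (fun p : (H1 * H2) * H3 => p.1.1 ⊗[ht] p.1.2 ⊗[ht] p.2).
Proof.
apply: (total_tens (ht (ht H1 H2) H3) (p := elementary (ht H1 H2)) (q := id)).
  exact: total_elementary.
by move=> P _ h x; exact: h.
Qed.

Lemma total_tens3r (H1 H2 H3 : hilbertType R) :
  total_family (fun p : H1 * (H2 * H3) => p.1 ⊗[ht] (p.2.1 ⊗[ht] p.2.2)).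
Proof.
apply: (total_tens (ht H1 (ht H2 H3)) (q := elementary (ht H2 H3)) (p := id)).
  by move=> P _ h x; exact: h.
exact: total_elementary.
Qed.

Lemma bl_eq_tens3 (H1 H2 H3 : hilbertType R) (V : normedModType C)
    (S T : ht (ht H1 H2) H3 -> V) : bounded_linear S -> bounded_linear T ->
  (forall x y z, S (x ⊗[ht] y ⊗[ht] z) = T (x ⊗[ht] y ⊗[ht] z)) -> S =1 T.
Proof.
move=> Sb Tb h; apply: (bl_eq_total (@total_tens3 _ _ _) Sb Tb) => -[[x y] z].
exact: h.
Qed.

Section Associativity.
Context (H1 H2 H3 : hilbertType R).
Let A := @htens_assoc R ht H1 H2 H3.
Let AV := @htens_assocV R ht H1 H2 H3.
Let X := @htens_swap23 R ht H1 H2 H3.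

Lemma htens_assoc_spec :
  bounded_linear A /\ forall x y z, A (x ⊗[ht] y ⊗[ht] z) = x ⊗[ht] (y ⊗[ht] z).
Proof.
apply: (the_mapP (P := fun V : ht (ht H1 H2) H3 -> ht H1 (ht H2 H3) =>
  bounded_linear V /\ forall x y z, V (x ⊗[ht] y ⊗[ht] z) = x ⊗[ht] (y ⊗[ht] z))).
have [|V Vi VE] := isometry_extension (@total_tens3 H1 H2 H3)
    (q := fun p => p.1.1 ⊗[ht] (p.1.2 ⊗[ht] p.2)).
  by move=> i j; rewrite !ht_dot mulrA.
exists V; split; first exact: isometric_bl.
by move=> x y z; exact: (VE ((x, y), z)).
Qed.

Lemma htens_assocV_spec :
  bounded_linear AV /\ forall x y z, AV (x ⊗[ht] (y ⊗[ht] z)) = x ⊗[ht] y ⊗[ht] z.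
Proof.
apply: (the_mapP (P := fun V : ht H1 (ht H2 H3) -> ht (ht H1 H2) H3 =>
  bounded_linear V /\ forall x y z, V (x ⊗[ht] (y ⊗[ht] z)) = x ⊗[ht] y ⊗[ht] z)).
have [|V Vi VE] := isometry_extension (@total_tens3r H1 H2 H3)
    (q := fun p => p.1 ⊗[ht] p.2.1 ⊗[ht] p.2.2).
  by move=> i j; rewrite !ht_dot mulrA.
exists V; split; first exact: isometric_bl.
by move=> x y z; exact: (VE (x, (y, z))).
Qed.

Lemma htens_swap_spec :
  bounded_linear X /\ forall x y z, X (x ⊗[ht] y ⊗[ht] z) = x ⊗[ht] z ⊗[ht] y.
Proof.
apply: (the_mapP (P := fun V : ht (ht H1 H2) H3 -> ht (ht H1 H3) H2 =>
  bounded_linear V /\ forall x y z, V (x ⊗[ht] y ⊗[ht] z) = x ⊗[ht] z ⊗[ht] y)).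
have [|V Vi VE] := isometry_extension (@total_tens3 H1 H2 H3)
    (q := fun p => p.1.1 ⊗[ht] p.2 ⊗[ht] p.1.2).
  by move=> i j; rewrite !ht_dot mulrAC.
exists V; split; first exact: isometric_bl.
by move=> x y z; exact: (VE ((x, y), z)).
Qed.

Lemma bl_assoc : bounded_linear A. Proof. exact: htens_assoc_spec.1. Qed.
Lemma htens_assocE x y z : A (x ⊗[ht] y ⊗[ht] z) = x ⊗[ht] (y ⊗[ht] z).
Proof. exact: htens_assoc_spec.2. Qed.
Lemma bl_assocV : bounded_linear AV. Proof. exact: htens_assocV_spec.1. Qed.
Lemma htens_assocVE x y z : AV (x ⊗[ht] (y ⊗[ht] z)) = x ⊗[ht] y ⊗[ht] z.
Proof. exact: htens_assocV_spec.2. Qed.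
Lemma bl_swap : bounded_linear X. Proof. exact: htens_swap_spec.1. Qed.
Lemma htens_swapE x y z : X (x ⊗[ht] y ⊗[ht] z) = x ⊗[ht] z ⊗[ht] y.
Proof. exact: htens_swap_spec.2. Qed.

End Associativity.

Section Legs.
Context (H1 H2 K1 K2 L : hilbertType R).

Lemma bl_leg12 (T : ht H1 H2 -> ht K1 K2) : bounded_linear T ->
  bounded_linear (leg12 (H3 := L) T).
Proof. by move=> Tb; apply: bl_htens_op => //; exact: bl_id. Qed.

Lemma leg12E (T : ht H1 H2 -> ht K1 K2) u z : bounded_linear T ->
  leg12 T (u ⊗[ht] z) = T u ⊗[ht] z :> ht _ L.
Proof. by move=> Tb; rewrite /leg12 htens_opE//; exact: bl_id. Qed.

Lemma bl_leg13 (T : ht H1 H2 -> ht K1 K2) : bounded_linear T ->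
  bounded_linear (leg13 (H2 := L) T).
Proof.
move=> Tb; apply: bl_comp (bl_swap _ _ _) _ => //.
by apply: bl_comp (bl_swap _ _ _) => //; apply: bl_htens_op => //; exact: bl_id.
Qed.

Lemma leg13E (T : ht H1 H2 -> ht K1 K2) x y z : bounded_linear T ->
  leg13 T (x ⊗[ht] y ⊗[ht] z) = htens_swap23 (T (x ⊗[ht] z) ⊗[ht] (y : L)).
Proof.
by move=> Tb; rewrite /leg13 /= htens_swapE htens_opE//; exact: bl_id.
Qed.

Lemma bl_leg23 (T : ht H1 H2 -> ht K1 K2) : bounded_linear T ->
  bounded_linear (leg23 (H1 := L) T).
Proof.
move=> Tb; apply: bl_comp (bl_assocV _ _ _) _ => //.
by apply: bl_comp (bl_assoc _ _ _) => //; apply: bl_htens_op => //; exact: bl_id.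
Qed.

Lemma leg23E (T : ht H1 H2 -> ht K1 K2) x y z : bounded_linear T ->
  leg23 T (x ⊗[ht] y ⊗[ht] z) = htens_assocV ((x : L) ⊗[ht] T (y ⊗[ht] z)).
Proof.
by move=> Tb; rewrite /leg23 /= htens_assocE htens_opE//; exact: bl_id.
Qed.

End Legs.
End HilbertTensor.
Arguments total_elementary {R H K} t.
Arguments total_tens {R H K} t {I J p q}.

(** * Representations of C*-algebras are contractive *)

Section Contraction.
Context (R : realType).
Notation C := R[i].

Lemma expr_small (q e : C) : 0 <= q -> q < 1 -> 0 < e -> exists n, q ^+ n < e.
Proof.
move=> q0 q1 e0.
have qE : ((complex.Re q)%:C)%C = q by rewrite RRe_real// ger0_real.
have eE : ((complex.Re e)%:C)%C = e by rewrite RRe_real// gtr0_real.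
move: q0 q1 e0; rewrite -qE -eE; set r := complex.Re q; set d := complex.Re e.
rewrite ler0c (ltcR r 1) (ltcR 0 d) => r0 r1 d0.
have : (fun n => r ^+ n) @ \oo --> (0 : R) by apply: cvg_expr; rewrite ger0_norm.
move=> /cvgrPdist_lt /(_ d d0) [n _ /(_ n (leqnn n))] /=.
rewrite sub0r normrN ger0_norm ?exprn_ge0// => h.
by exists n; rewrite -rmorphXn ltcR.
Qed.

(** The iterates from [0] stay bounded by [D], so [u (n + m) - u n] is of order
    [q ^ n]. *)
Lemma contraction_fixpoint (V : completeNormedModType C) (f : V -> V) (q : C) :
  0 <= q -> q < 1 -> (forall u v, `|f u - f v| <= q * `|u - v|) ->
  exists u, f u = u.
Proof.
move=> q0 q1 fq; pose u n := iter n f 0.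
have q1' : 0 < 1 - q by rewrite subr_gt0.
pose D := `|f 0| / (1 - q); have D0 : 0 <= D by rewrite divr_ge0// ltW.
have ub n : `|u n| <= D.
  elim: n => [|n IH]; first by rewrite /= normr0.
  rewrite /= -[f _](subrK (f 0)); apply: le_trans (ler_normD _ _) _.
  have : `|f (u n) - f 0| <= q * D.
    by apply: le_trans (fq _ _) _; rewrite subr0; exact: ler_wpM2l.
  move=> h; apply: le_trans (lerD h (lexx _)) _.
  rewrite (_ : `|f 0| = (1 - q) * D); last by rewrite /D mulrC divfK ?gt_eqF.
  by rewrite -mulrDl addrC subrK mul1r.
have ud n m : `|u (n + m)%N - u n| <= q ^+ n * D.
  elim: n => [|n IH]; first by rewrite add0n subr0 expr0 mul1r.
  rewrite addSn /=; apply: le_trans (fq _ _) _.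
  by rewrite exprS -mulrA; exact: ler_wpM2l.
have near_u e : 0 < e -> exists n, forall m, (n <= m)%N -> `|u m - u n| < e.
  move=> e0; have [d d0 de] := small_eps D0 (divr_gt0 e0 (ltr0n C 2)).
  have [n qn] := expr_small q0 q1 d0; exists n => m nm.
  rewrite -(subnKC nm); apply: le_lt_trans (ud _ _) _.
  rewrite mulrC; apply: le_lt_trans (ler_wpM2l D0 (ltW qn)) _.
  apply: le_lt_trans de _.
  by rewrite ltr_pdivrMr// mulr_natr mulr2n ltrDl.
have : cauchy (u @ \oo).
  apply: cauchy_exP => e e0; have [n hn] := near_u e e0.
  exists (u n); exists n => // m /hn; rewrite -ball_normE /=.
  by rewrite distrC.
move=> /cauchy_cvg uc; set l := lim _ in uc.
have ul e : 0 < e -> exists n, forall m, (n <= m)%N -> `|l - u m| < e.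
  move=> e0; have := uc _ (nbhsx_ballx l e e0) => -[n _ hn].
  by exists n => m nm; have := hn m nm; rewrite /= -ball_normE.
exists l; apply/eqP; rewrite -subr_eq0 -normr_le0; apply: le_eps => e e0; rewrite add0r.
have e20 : 0 < e / 2 by rewrite divr_gt0.
have [n hn] := ul _ e20.
rewrite (_ : f l - l = (f l - u n.+1) - (l - u n.+1)); last first.
  by rewrite opprB addrA addrNK.
apply: le_trans (ler_normB _ _) _; rewrite [e]splitr lerD//; last exact/ltW/hn.
apply: le_trans (fq _ _) _; apply: le_trans (_ : 1 * `|l - u n| <= _).
  by apply: ler_wpM2r => //; exact: ltW.
by rewrite mul1r; exact/ltW/hn.
Qed.

Lemma bounded_linear_bound (V W : normedModType C) (T : V -> W) :
  bounded_linear T -> exists2 M, 1 <= M & bounded_by M T.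
Proof.
move=> /bounded_linear_ge0[M M0 [TL TM]]; exists (M + 1); first by rewrite lerDr.
by split=> // x; apply: le_trans (TM x) _; rewrite mulrDl lerDl mul1r.
Qed.

(** The number [N] is the square of the operator norm. *)
Lemma best_square_bound (H K : hilbertType R) (T : H -> K) : bounded_linear T ->
  exists N : C, [/\ 0 <= N, forall x, hdot (T x) (T x) <= N * hdot x x &
    forall M, 0 <= M -> (forall x, hdot (T x) (T x) <= M * hdot x x) -> N <= M].
Proof.
move=> Tb; have TL := bl_linear Tb.
pose rat x := hdot (T x) (T x) / hdot x x.
have rat0 x : 0 <= rat x by rewrite divr_ge0 ?hdot_ge0.
have ratE x : ((complex.Re (rat x))%:C)%C = rat x by rewrite RRe_real// ger0_real.
have rat_le x M : 0 <= M -> hdot (T x) (T x) <= M * hdot x x -> rat x <= M.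
  move=> M0 h; have [x0|x0] := eqVneq (hdot x x) 0.
    by rewrite /rat x0 invr0 mulr0.
  by rewrite ler_pdivrMr// lt_def x0 hdot_ge0.
have le_rat x M : rat x <= M -> hdot (T x) (T x) <= M * hdot x x.
  move=> h; have [x0|x0] := eqVneq (hdot x x) 0.
    by rewrite (hdot_eq0 x0) (lin0 TL) !hdot0r mulr0.
  by rewrite -ler_pdivrMr// lt_def x0 hdot_ge0.
pose E : set R := [set r | exists x, r = complex.Re (rat x)].
have [M M1 [_ TM]] := bounded_linear_bound Tb.
have M0 : 0 <= M by apply: le_trans M1.
have ratM x : rat x <= M ^+ 2.
  apply: rat_le; first exact: exprn_ge0.
  by rewrite !hdot_norm -exprMn ler_pXn2r// ?nnegrE ?mulr_ge0.
have M2E : ((complex.Re (M ^+ 2))%:C)%C = M ^+ 2.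
  by rewrite RRe_real// ger0_real ?exprn_ge0.
have Eub : has_ubound E.
  by exists (complex.Re (M ^+ 2)) => _ [x ->]; rewrite -lecR ratE M2E.
have E0 : E !=set0 by exists (complex.Re (rat 0)), 0.
have supE x : rat x <= ((sup E)%:C)%C.
  by rewrite -ratE lecR; apply: ub_le_sup => //; exists x.
exists ((sup E)%:C)%C; split.
- exact: le_trans (rat0 0) (supE 0).
- by move=> x; exact/le_rat/supE.
- move=> N N0 hN; have NE : ((complex.Re N)%:C)%C = N by rewrite RRe_real// ger0_real.
  rewrite -NE lecR; apply: ge_sup => // _ [x ->].
  by rewrite -lecR ratE NE; exact: rat_le.
Qed.

Lemma square_le (H : hilbertType R) (S : H -> H) : linear S ->
  (forall x y, hdot (S x) y = hdot x (S y)) ->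
  (forall x, 0 <= hdot x (S x)) -> (forall x, hdot x (S x) <= hdot x x) ->
  forall x, hdot (S x) (S x) <= hdot x (S x).
Proof.
move=> SL Ssa S0 S1 x.
(* S - S^2 = (1 - S) S (1 - S) + S (1 - S) S *)
have := addr_ge0 (S0 (x - S x)) (_ : 0 <= hdot (S x) (S x) - hdot (S x) (S (S x))).
rewrite subr_ge0 => /(_ (S1 _)).
rewrite (linB _ _ SL) !hdotBl !hdotBr -!Ssa => h; rewrite -subr_ge0.
move: h; congr (0 <= _); ring.
Qed.

Context (A : cstarType R).

(** In the unitization, [1 + k] is a left inverse of [1 - h]; the Neumann series
    is replaced by a fixed point of the contraction [k |-> h + k h]. *)
Lemma quasi_inverse (h : A) : `|h| < 1 -> exists k, h + cmul k h = k.
Proof.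
move=> h1; apply: (contraction_fixpoint (f := fun k => h + cmul k h) (q := `|h|)) => //.
move=> u v; rewrite opprD addrACA subrr add0r.
rewrite -(linB u v (cmul_linearl h)) /= mulrC; exact: cnormM.
Qed.

Section Representation.
Context (H : hilbertType R) (pi : A -> H -> H).
Hypothesis pi_rep : is_rep pi.

Lemma rep_bl a : bounded_linear (pi a). Proof. by case: pi_rep. Qed.
Lemma rep_linear x : linear (pi^~ x). Proof. by case: pi_rep. Qed.
Lemma repM a b x : pi (cmul a b) x = pi a (pi b x). Proof. by case: pi_rep. Qed.
Lemma rep_star a x y : hdot (pi (cstar a) x) y = hdot x (pi a y).
Proof. by case: pi_rep. Qed.

Lemma rep_square a x : hdot x (pi (cmul (cstar a) a) x) = hdot (pi a x) (pi a x).
Proof. by rewrite repM -rep_star cstarK. Qed.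

(** If [N = |pi a|^2] exceeded [|a|^2], then [1 - a* a / N] would be invertible
    in the (unitized) algebra, although its image [1 - T / N], with
    [T = pi (a* a)] and [N = |T|], is not bounded below. *)
Lemma rep_contractive a x : `|pi a x| <= `|a| * `|x|.
Proof.
have [N [N0 piN Nmin]] := best_square_bound (rep_bl a).
apply: norm_le_hdot => //; apply: le_trans (piN x) _.
apply: ler_wpM2r; first exact: hdot_ge0.
rewrite -cnorm_star; set h := cmul (cstar a) a.
have Nr : N \is Num.real by exact: ger0_real.
rewrite real_leNgt// ?ger0_real//; apply/negP => hN.
have Np : 0 < N by apply: le_lt_trans hN.
pose h' := N^-1 *: h.
have [k kE] : exists k, h' + cmul k h' = k.
  apply: quasi_inverse; rewrite normrZ ger0_norm ?invr_ge0//.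
  by rewrite mulrC ltr_pdivrMr// mul1r.
have SE y : pi h' y = N^-1 *: pi h y by exact: (linZ N^-1 h (rep_linear y)).
have S0 y : 0 <= hdot y (pi h' y).
  by rewrite SE hdotZr rep_square mulr_ge0 ?invr_ge0// hdot_ge0.
have S1 y : hdot y (pi h' y) <= hdot y y.
  by rewrite SE hdotZr rep_square mulrC ler_pdivrMr// mulrC.
have hstar : cstar h = h by rewrite /h cstarM cstarK.
have Ssa y z : hdot (pi h' y) z = hdot y (pi h' z).
  rewrite !SE hdotZl hdotZr geC0_conj ?invr_ge0//; congr (_ * _).
  by rewrite -[in LHS]hstar rep_star.
have Qb : bounded_linear (fun y => 1 *: y + pi k y).
  by apply: bl_lin2; [exact: bl_id|exact: rep_bl].
have QP y : 1 *: (y - pi h' y) + pi k (y - pi h' y) = y.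
  rewrite scale1r (linB _ _ (bl_linear (rep_bl k))) -repM.
  have e := linD h' (cmul k h') (rep_linear y); rewrite /= kE in e.
  by rewrite {1}e addrK addrNK.
have [M M1 [_ QM]] := bounded_linear_bound Qb.
have M0 : 0 < M by apply: lt_le_trans M1.
(* |y|^2 <= M^2 |(1 - S) y|^2 <= M^2 (|y|^2 - <y, S y>), where S = pi h' *)
have key y : hdot (pi a y) (pi a y) <= N * (1 - M ^- 2) * hdot y y.
  have h1 : hdot y y <= M ^+ 2 * hdot (y - pi h' y) (y - pi h' y).
    rewrite !hdot_norm -exprMn ler_pXn2r// ?nnegrE ?mulr_ge0 ?(ltW M0)//.
    by have := QM (y - pi h' y); rewrite QP.
  have h2 : hdot (y - pi h' y) (y - pi h' y) <= hdot y y - hdot y (pi h' y).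
    have := square_le (bl_linear (rep_bl h')) Ssa S0 S1 y.
    rewrite hdotBl !hdotBr Ssa -subr_ge0 => h2; rewrite -subr_ge0.
    move: h2; rewrite Ssa; congr (0 <= _); ring.
  have M20 : 0 < M ^+ 2 by rewrite exprn_gt0.
  have h3 : hdot y y / M ^+ 2 <= hdot y y - hdot y (pi h' y).
    by rewrite ler_pdivrMr// mulrC; apply: le_trans h1 _; rewrite ler_pM2l.
  have -> : hdot (pi a y) (pi a y) = N * hdot y (pi h' y).
    by rewrite SE hdotZr rep_square mulrA mulfV ?gt_eqF// mul1r.
  rewrite -mulrA ler_pM2l// mulrBl mul1r mulrC lerBrDl -lerBrDr.
  exact: h3.
have : N <= N * (1 - M ^- 2).
  apply: Nmin => //; rewrite mulr_ge0// subr_ge0 invf_le1 ?exprn_gt0//.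
  exact: exprn_ege1.
rewrite -subr_ge0 mulrBr mulr1 addrAC subrr add0r oppr_ge0 pmulr_rle0//.
by rewrite invr_le0 => /(lt_le_trans (exprn_gt0 2 M0)); rewrite ltxx.
Qed.

Lemma rep_bl_alg x : bounded_linear (pi^~ x).
Proof.
by split; [exact: rep_linear|exists `|x| => a; rewrite mulrC rep_contractive].
Qed.

End Representation.
End Contraction.

(** * Tensor products of C*-algebras *)

Section CstarBasics.
Context (R : realType).
Notation C := R[i].
Implicit Types A B : cstarType R.

Lemma bl_cmulr A (a : A) : bounded_linear (cmul a).
Proof. by split; [exact: cmul_linearr|exists `|a| => b; exact: cnormM]. Qed.

Lemma bl_cmull A (b : A) : bounded_linear (cmul^~ b).
Proof.
by split; [exact: cmul_linearl|exists `|b| => a; rewrite mulrC cnormM].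
Qed.

Lemma cstar0 A : cstar (0 : A) = 0.
Proof.
have := cstarP (-1) (0 : A) 0.
by rewrite scaler0 addr0 rmorphN1 scaleN1r addNr.
Qed.

Lemma cmul0l A (a : A) : cmul 0 a = 0.
Proof. exact: (lin0 (cmul_linearl a)). Qed.

Lemma cmul0r A (a : A) : cmul a 0 = 0.
Proof. exact: (lin0 (cmul_linearr a)). Qed.

Lemma norm_cstar A (a : A) : `|cstar a| = `|a|.
Proof.
have le (b : A) : `|b| <= `|cstar b| :> C.
  have [->|b0] := eqVneq b 0; first by rewrite normr0.
  have nb : 0 < `|b| :> C by rewrite normr_gt0.
  by rewrite -(ler_pM2r nb) -expr2 -cnorm_star cnormM.
apply/eqP; rewrite eq_le le andbT.
by have := le (cstar a); rewrite cstarK.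
Qed.

(** Conjugating a linear map by the involutions gives a linear map, so that
    compatibility with the involutions is a linear condition. *)
Lemma bl_star_conj A B (f : A -> B) : bounded_linear f ->
  bounded_linear (fun x => cstar (f (cstar x))).
Proof.
move=> /bounded_linear_ge0[M M0 [fL fM]]; split.
  by move=> a x y; rewrite cstarP fL cstarP conjCK.
by exists M => x; rewrite norm_cstar (le_trans (fM _))// norm_cstar.
Qed.

Lemma bl_state A (w : A -> C) : is_state w -> bounded_linear (w : A -> C^o).
Proof. by move=> [wL _ wN _]; split=> //; exists 1 => a; rewrite mul1r. Qed.

Lemma star_hom_total A B (f : A -> B) (J : Type) (p : J -> A) :
  total_family p -> bounded_linear f ->
  (forall i j, f (cmul (p i) (p j)) = cmul (f (p i)) (f (p j))) ->
  (forall i, f (cstar (p i)) = cstar (f (p i))) -> star_hom f.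
Proof.
move=> pt fb fM fS; split; first exact: bl_linear.
  move=> x y /=; move: x.
  apply: (bl_eq_total (S := f \o cmul^~ y) (T := cmul^~ (f y) \o f) pt).
  - by apply: bl_comp => //; exact: bl_cmull.
  - by apply: bl_comp => //; exact: bl_cmull.
  move=> i /=; move: y.
  apply: (bl_eq_total (S := f \o cmul (p i)) (T := cmul (f (p i)) \o f) pt) => //.
  - by apply: bl_comp => //; exact: bl_cmulr.
  - by apply: bl_comp => //; exact: bl_cmulr.
  - by move=> j /=; rewrite fM.
move=> x /=; apply: (can_inj (@cstarK R B)); rewrite (cstarK (f x)); move: x.
apply: (bl_eq_total (S := fun x => cstar (f (cstar x))) pt) => //.
  exact: bl_star_conj.
by move=> i; rewrite fS cstarK.
Qed.

Lemma star_hom_comp A B (D : cstarType R) (g : B -> D) (f : A -> B) :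
  star_hom g -> star_hom f -> star_hom (g \o f).
Proof.
move=> [gL gM gS] [fL fM fS]; split; first exact: lin_comp.
- by move=> a b /=; rewrite fM gM.
- by move=> a /=; rewrite fS gS.
Qed.

Lemma rep_star_hom A B (f : A -> B) (H : hilbertType R) (pi : B -> H -> H) :
  star_hom f -> is_rep pi -> is_rep (pi \o f).
Proof.
move=> [fL fM fS] [pb pL pM pS]; split=> /=.
- by move=> a; exact: pb.
- by move=> x; exact: (lin_comp fL (pL x)).
- by move=> a b x; rewrite fM pM.
- by move=> a x y; rewrite fS pS.
Qed.

End CstarBasics.

Section CstarTensor.
Context (R : realType) (ht : htensors R) (ct : mtensors ht).
Notation C := R[i].

Section OneTensor.
Context (A B : cstarType R).

Lemma mtensZl c (a : A) (b : B) : (c *: a) ⊗m[ct] b = c *: (a ⊗m[ct] b).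
Proof. by have := linZ c a (mt_linearl (ct A B) b). Qed.

Definition melementary (p : A * B) : ct A B := p.1 ⊗m[ct] p.2.

Lemma total_melementary : total_family melementary.
Proof.
apply: (total_closure (mt_dense (ct A B))) => _ [s ->].
exists [seq (1, p) | p <- s]; rewrite /lin_comb big_map.
by apply: eq_bigr => p _; rewrite scale1r.
Qed.

Lemma bl_eq_mtens (V : normedModType C) (S T : ct A B -> V) :
  bounded_linear S -> bounded_linear T ->
  (forall a b, S (a ⊗m[ct] b) = T (a ⊗m[ct] b)) -> S =1 T.
Proof.
move=> Sb Tb h.
by apply: (bl_eq_total total_melementary Sb Tb) => -[x y]; exact: h.
Qed.

(** The bound on finite sums contains the additivity of [b] in each variable. *)
Lemma mtensor_extension (W : completeNormedModType C) (b : A -> B -> W) (M : C) :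
  0 <= M -> (forall c x y, b (c *: x) y = c *: b x y) ->
  (forall s : seq (A * B), `|\sum_(p <- s) b p.1 p.2|
                     <= M * `|\sum_(p <- s) p.1 ⊗m[ct] p.2|) ->
  exists2 T : ct A B -> W, bounded_by M T & forall x y, T (x ⊗m[ct] y) = b x y.
Proof.
move=> M0 bZ bM.
pose G z w := exists s : seq (A * B),
  z = \sum_(p <- s) p.1 ⊗m[ct] p.2 /\ w = \sum_(p <- s) b p.1 p.2.
have [||||T Tb TG] := @graph_extension R (ct A B) W G M.
- exact: M0.
- move=> c z w z' w' [s [-> ->]] [s' [-> ->]].
  exists ([seq (c *: p.1, p.2) | p <- s] ++ s'); rewrite !big_cat !big_map /=.
  split; congr (_ + _); rewrite scaler_sumr; apply: eq_bigr => p _.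
    by rewrite mtensZl.
  by rewrite bZ.
- by move=> z w [s [-> ->]].
- move=> z e e0; have [_ [s ->] zs] := closureP (mt_dense (ct A B)) z e0.
  by exists (\sum_(p <- s) p.1 ⊗m[ct] p.2), (\sum_(p <- s) b p.1 p.2); split=> //; exists s.
exists T => // x y; apply: TG; exists [:: (x, y)].
by rewrite !big_seq1.
Qed.

Section TensRep.
Context (H K : hilbertType R) (pi1 : A -> H -> H) (pi2 : B -> K -> K).
Hypotheses (r1 : is_rep pi1) (r2 : is_rep pi2).

Lemma bl_rep_op a b : bounded_linear (htens_op (ht := ht) (pi1 a) (pi2 b)).
Proof. by apply: bl_htens_op; exact: rep_bl. Qed.

Lemma rep_opE a b x y :
  htens_op (pi1 a) (pi2 b) (x ⊗[ht] y) = pi1 a x ⊗[ht] pi2 b y.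
Proof. by rewrite htens_opE//; exact: rep_bl. Qed.

(** The defining formula of the minimal norm says that [sum pi1 a (x) pi2 b],
    applied to a fixed vector [u], depends continuously on [sum a (x) b]. It
    thus extends to the completion, one [u] at a time; the algebraic properties
    are then checked on elementary tensors. *)
Lemma tens_rep_spec : is_rep (tens_rep (ct := ct) pi1 pi2) /\
  forall a b, tens_rep pi1 pi2 (a ⊗m[ct] b) = htens_op (pi1 a) (pi2 b).
Proof.
apply: (the_mapP (P := fun pi : ct A B -> ht H K -> ht H K => is_rep pi /\
  forall a b, pi (a ⊗m[ct] b) = htens_op (pi1 a) (pi2 b))).
have ex (u : ht H K) : exists T : ct A B -> ht H K, bounded_by `|u| T /\
    forall a b, T (a ⊗m[ct] b) = htens_op (pi1 a) (pi2 b) u.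
  have [|||T Tb TE] := @mtensor_extension (ht H K)
    (fun a b => htens_op (pi1 a) (pi2 b) u) `|u|; last by exists T.
  - exact: normr_ge0.
  - move=> c a b; move: u; apply: bl_eq_tens; first exact: bl_rep_op.
      exact/bl_scale/bl_rep_op.
    move=> x y; rewrite !rep_opE.
    by have := linZ c a (rep_linear r1 x) => /= ->; rewrite tensZl.
  - move=> s; rewrite mulrC.
    exact: ((mt_norm (ct A B) s (normr_ge0 _)).1 (lexx _) _ _ _ _ r1 r2).
have [T TP] := choice ex.
have Tb u : bounded_linear (T u) by exact: bounded_byW (TP u).1.
have TE u a b : T u (a ⊗m[ct] b) = htens_op (pi1 a) (pi2 b) u by rewrite (TP u).2.
have opL z : linear (T^~ z).
  move=> c u v; move: z; apply: bl_eq_mtens => //; first exact: bl_lin2.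
  by move=> a b; rewrite !TE (bl_linear (bl_rep_op a b)).
have opb z : bounded_linear (T^~ z).
  by split=> //; exists `|z| => u; have [[_ h] _] := TP u; rewrite mulrC.
exists (fun z u => T u z); split; last first.
  by move=> a b; apply/funext => u; rewrite TE.
split=> //.
- by move=> u; exact: bl_linear (Tb u).
- move=> z z' u; move: z.
  apply: (bl_eq_mtens (S := T u \o cmul^~ z')) => //.
    by apply: bl_comp => //; exact: bl_cmull.
  move=> a b /=; rewrite TE; move: z'.
  apply: (bl_eq_mtens (S := T u \o cmul (a ⊗m[ct] b))
     (T := htens_op (pi1 a) (pi2 b) \o T u)).
  - by apply: bl_comp => //; exact: bl_cmulr.
  - by apply: bl_comp => //; exact: bl_rep_op.
  move=> a' b' /=; rewrite mt_mul !TE; move: u.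
  apply: (bl_eq_tens (T := htens_op _ _ \o htens_op _ _)); first exact: bl_rep_op.
    by apply: bl_comp; exact: bl_rep_op.
  by move=> x y /=; rewrite !rep_opE// (repM r1) (repM r2).
- move=> z x y.
  suff : hdot x (T y z) = (hdot y (T x (cstar z)))^* by move=> ->; rewrite -hdotC.
  move: z; apply: (bl_eq_mtens (V := C^o) (S := hdot x \o T y)
     (T := fun z => (hdot y (T x (cstar z)))^*)).
  - by apply: bl_comp => //; exact: bl_hdot.
  - split.
      move=> c z z'; rewrite cstarP (bl_linear (Tb x)) hdotDr hdotZr.
      by rewrite rmorphD rmorphM /= conjCK.
    have [[_ h] _] := TP x; exists (`|y| * `|x|) => z.
    rewrite norm_conjC (le_trans (cauchy_schwarz _ _))// -mulrA ler_wpM2l//.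
    by rewrite (le_trans (h _))// norm_cstar.
  move=> a b /=; rewrite mt_star !TE -hdotC.
  (* both sides are sesquilinear in x and y *)
  apply: esym.
  have Ib := @bl_id R (ht H K).
  refine (@hdot_total R _ _ _ _ _ _ _ _ (htens_op (pi1 (cstar a)) (pi2 (cstar b)))
     id id (htens_op (pi1 a) (pi2 b)) (total_elementary (ht H K))
     (total_elementary (ht H K)) (bl_rep_op _ _) Ib Ib (bl_rep_op _ _) _ x y) => -[p p'] [q q'].
  by rewrite /elementary /= !rep_opE !ht_dot (rep_star r1) (rep_star r2).
Qed.

Lemma tens_rep_rep : is_rep (tens_rep (ct := ct) pi1 pi2).
Proof. by case: tens_rep_spec. Qed.

Lemma tens_repE a b x y :
  tens_rep pi1 pi2 (a ⊗m[ct] b) (x ⊗[ht] y) = pi1 a x ⊗[ht] pi2 b y.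
Proof. by have [_ ->] := tens_rep_spec; rewrite rep_opE. Qed.

End TensRep.

(** The norm formula, known for finite sums, survives the passage to limits
    because representations are contractive. *)
Lemma mtensor_norm_le (z : ct A B) (M : C) : 0 <= M ->
  (forall (H K : hilbertType R) (pi1 : A -> H -> H) (pi2 : B -> K -> K),
     is_rep pi1 -> is_rep pi2 -> forall u, `|tens_rep pi1 pi2 z u| <= M * `|u|) ->
  `|z| <= M.
Proof.
move=> M0 zM; apply: le_eps => e e0; have e20 : 0 < e / 2 by rewrite divr_gt0.
have [_ [s ->] zs] := closureP (mt_dense (ct A B)) z e20.
set z' := \sum_(p <- s) _ in zs.
have : `|z'| <= M + e / 2.
  apply/(mt_norm (ct A B) s); first by rewrite addr_ge0// ltW.
  move=> H K pi1 pi2 r1 r2 u; have [rt rE] := tens_rep_spec r1 r2.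
  have -> : \sum_(p <- s) htens_op (pi1 p.1) (pi2 p.2) u = tens_rep pi1 pi2 z' u.
    rewrite (lin_sum _ _ (rep_linear rt u)); apply: eq_bigr => p _.
    by rewrite rE.
  rewrite (_ : z' = z - (z - z')); last by rewrite opprB addrC addrNK.
  rewrite (linB _ _ (rep_linear rt u)) mulrDl.
  apply: le_trans (ler_normB _ _) _; rewrite lerD ?zM//.
  apply: le_trans (rep_contractive rt _ _) _.
  by apply: ler_wpM2r => //; exact: ltW.
move=> h; rewrite -[z](subrK z'); apply: le_trans (ler_normD _ _) _.
by rewrite [e]splitr addrA [_ + e / 2]addrC lerD// ltW.
Qed.

(** The norm of the target is computed by representations, and a representation
    composed with [f] is a representation of [D]. *)
Lemma star_hom_contractive (D : cstarType R) (f : D -> ct A B) :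
  star_hom f -> forall x, `|f x| <= `|x|.
Proof.
move=> fh x; apply: mtensor_norm_le => // H K pi1 pi2 r1 r2 u.
exact: (rep_contractive (rep_star_hom fh (tens_rep_rep r1 r2)) x u).
Qed.

Lemma bl_star_hom (D : cstarType R) (f : D -> ct A B) : star_hom f -> bounded_linear f.
Proof.
move=> fh; split; first by case: fh.
by exists 1 => x; rewrite mul1r star_hom_contractive.
Qed.

End OneTensor.

Section TensHom.
Context (A1 A2 B1 B2 : cstarType R) (f1 : A1 -> B1) (f2 : A2 -> B2).
Hypotheses (h1 : star_hom f1) (h2 : star_hom f2).

(** Representations of [B1] and [B2] pull back along [f1] and [f2], so the norm of
    a finite sum does not increase. *)
Lemma tens_hom_spec : star_hom (tens_hom (ct := ct) f1 f2) /\
  forall a b, tens_hom f1 f2 (a ⊗m[ct] b) = f1 a ⊗m[ct] f2 b.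
Proof.
apply: (the_mapP (P := fun f : ct A1 A2 -> ct B1 B2 => star_hom f /\
    forall a b, f (a ⊗m[ct] b) = f1 a ⊗m[ct] f2 b)).
have [L1 M1 S1] := h1; have [L2 M2 S2] := h2.
have [|||T Tb TE] := @mtensor_extension A1 A2 (ct B1 B2)
    (fun a b => f1 a ⊗m[ct] f2 b) 1.
- exact: ler01.
- by move=> c a b; rewrite linZ// mtensZl.
- move=> s; rewrite mul1r.
  have := mt_norm (ct B1 B2) [seq (f1 p.1, f2 p.2) | p <- s] (normr_ge0 (\sum_(p <- s) p.1 ⊗m[ct] p.2)).
  rewrite big_map => -[_]; apply => H K pi1 pi2 r1 r2 u; rewrite big_map.
  exact: ((mt_norm (ct A1 A2) s (normr_ge0 _)).1 (lexx _) _ _ _ _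
     (rep_star_hom h1 r1) (rep_star_hom h2 r2)).
exists T; split=> //.
apply: (star_hom_total (@total_melementary A1 A2)).
- exact: bounded_byW Tb.
- move=> [a b] [a' b']; rewrite /melementary /=.
  by rewrite mt_mul !TE mt_mul M1 M2.
- by move=> [a b]; rewrite /melementary /= mt_star !TE mt_star S1 S2.
Qed.

Lemma tens_hom_hom : star_hom (tens_hom (ct := ct) f1 f2).
Proof. by case: tens_hom_spec. Qed.

Lemma tens_homE a b : tens_hom f1 f2 (a ⊗m[ct] b) = f1 a ⊗m[ct] f2 b.
Proof. by case: tens_hom_spec. Qed.

End TensHom.

(** Both sides are continuous in [z] and in [u], so that it suffices to compare
    them on elementary tensors. *)
Lemma tens_rep_intertwine (A B : cstarType R) (H1 K1 H2 K2 : hilbertType R)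
    (pi1 : A -> H1 -> H1) (pi2 : B -> K1 -> K1)
    (rho1 : A -> H2 -> H2) (rho2 : B -> K2 -> K2) (S : H1 -> H2) (T : K1 -> K2) :
  is_rep pi1 -> is_rep pi2 -> is_rep rho1 -> is_rep rho2 ->
  bounded_linear S -> bounded_linear T ->
  (forall a x, S (pi1 a x) = rho1 a (S x)) ->
  (forall b y, T (pi2 b y) = rho2 b (T y)) ->
  forall (z : ct A B) u,
  htens_op (ht := ht) S T (tens_rep pi1 pi2 z u) = tens_rep rho1 rho2 z (htens_op S T u).
Proof.
move=> r1 r2 s1 s2 Sb Tb hS hT z u.
have STb := bl_htens_op ht Sb Tb.
have rp := tens_rep_rep r1 r2; have rr := tens_rep_rep s1 s2.
move: z; apply: (bl_eq_mtens (S := htens_op S T \o tens_rep pi1 pi2 ^~ u)).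
- by apply: bl_comp => //; exact: rep_bl_alg.
- exact: rep_bl_alg.
move=> a b /=; move: u.
apply: (bl_eq_tens (S := htens_op S T \o tens_rep pi1 pi2 _)
   (T := tens_rep rho1 rho2 _ \o htens_op S T)).
- by apply: bl_comp => //; exact: rep_bl.
- by apply: bl_comp => //; exact: rep_bl.
by move=> x y /=; rewrite tens_repE// !htens_opE// tens_repE// hS hT.
Qed.

End CstarTensor.

(** * Closed *-subalgebras and the Cuntz algebras *)

Section ClosedSubalgebra.
Context (R : realType) (A : cstarType R).
Notation C := R[i].

Definition closed_star_subalgebra (D : A -> Prop) :=
  [/\ closed_subspace D, forall a b, D a -> D b -> D (cmul a b) &
      forall a, D a -> D (cstar a)].

Record subalgebra (D : A -> Prop) (Dcl : closed_star_subalgebra D) :=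
  Subalgebra { subalg_val : A; subalg_in : `[< D subalg_val >] }.

Context (D : A -> Prop) (Dcl : closed_star_subalgebra D).
Notation S := (subalgebra Dcl).
Notation val := (@subalg_val D Dcl).

HB.instance Definition _ := [isSub for val].
HB.instance Definition _ := [Choice of S by <:].

Let insub (x : A) (Dx : D x) : S := Subalgebra Dcl (asboolT Dx).
Let valD (x : S) : D (val x). Proof. by case: x => x /= /asboolP. Qed.

Let D0 : D 0. Proof. by case: Dcl => [[]]. Qed.
Let DL a x y : D x -> D y -> D (a *: x + y).
Proof. by case: Dcl => [[_ h _] _ _]; exact: h. Qed.
Let Dlim x : (forall e : C, 0 < e -> exists2 y, D y & `|x - y| < e) -> D x.
Proof. by case: Dcl => [[_ _ h] _ _]; exact: h. Qed.
Let DM a b : D a -> D b -> D (cmul a b). Proof. by case: Dcl => _ h _; exact: h. Qed.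
Let DS a : D a -> D (cstar a). Proof. by case: Dcl => _ _; apply. Qed.
Let DD x y : D x -> D y -> D (x + y).
Proof. by move=> Dx Dy; rewrite -[x]scale1r; exact: DL. Qed.
Let DZ a x : D x -> D (a *: x).
Proof. by move=> Dx; rewrite -[_ *: _]addr0; exact: DL. Qed.
Let DN x : D x -> D (- x).
Proof. by move=> Dx; rewrite -scaleN1r; exact: DZ. Qed.

Let zero : S := insub D0.
Let add (x y : S) : S := insub (DD (valD x) (valD y)).
Let opp (x : S) : S := insub (DN (valD x)).
Let scale a (x : S) : S := insub (DZ a (valD x)).
Let mul (x y : S) : S := insub (DM (valD x) (valD y)).
Let star (x : S) : S := insub (DS (valD x)).

Let addA : associative add.
Proof. by move=> x y z; apply: val_inj; exact: addrA. Qed.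
Let addC : commutative add.
Proof. by move=> x y; apply: val_inj; exact: addrC. Qed.
Let add0 : left_id zero add.
Proof. by move=> x; apply: val_inj; exact: add0r. Qed.
Let addN : left_inverse zero opp add.
Proof. by move=> x; apply: val_inj; exact: addNr. Qed.

HB.instance Definition _ := GRing.isZmodule.Build S addA addC add0 addN.

Let scaleA a b (x : S) : scale a (scale b x) = scale (a * b) x.
Proof. by apply: val_inj; exact: scalerA. Qed.
Let scale1 : left_id 1 scale.
Proof. by move=> x; apply: val_inj; exact: scale1r. Qed.
Let scaleDr : right_distributive scale +%R.
Proof. by move=> a x y; apply: val_inj; exact: scalerDr. Qed.
Let scaleDl (x : S) : {morph scale^~ x : a b / a + b}.
Proof. by move=> a b; apply: val_inj; exact: scalerDl. Qed.

HB.instance Definition _ :=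
  GRing.Zmodule_isLmodule.Build C S scaleA scale1 scaleDr scaleDl.

Let norm (x : S) : C := `|val x|.
Let normD (x y : S) : norm (x + y) <= norm x + norm y.
Proof. exact: ler_normD. Qed.
Let normZ a (x : S) : norm (a *: x) = `|a| * norm x.
Proof. exact: normrZ. Qed.
Let norm0 (x : S) : norm x = 0 -> x = 0.
Proof. by move=> /normr0_eq0 h; exact: val_inj. Qed.

HB.instance Definition _ := Lmodule_isNormed.Build C S normD normZ norm0.

Let ballE (x y : S) (e : C) : ball x e y = (`|val x - val y| < e).
Proof. by rewrite -ball_normE. Qed.

Let complete (F : set_system S) : ProperFilter F -> cauchy F -> cvg F.
Proof.
move=> FF Fc.
have : cauchy (val @ F).
  apply: cauchy_exP => e e0; have /cauchyP/(_ e e0)[x Fx] := Fc.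
  exists (val x); change (F (val @^-1` ball (val x) e)).
  apply: filterS Fx => y; rewrite ballE /=.
  by rewrite -ball_normE.
move=> /cauchy_cvg; set l := lim _ => Fl.
have near_l e : 0 < e -> F [set x | `|l - val x| < e].
  by move=> e0; have := Fl _ (nbhsx_ballx l e e0); rewrite -ball_normE.
have Dl : D l.
  apply: Dlim => e e0; have /filter_ex[x xl] := near_l e e0.
  by exists (val x).
apply/cvg_ex; exists (insub Dl) => B /nbhs_ballP[e /= e0 eB].
apply: filterS (near_l e e0) => x /= xl; apply: eB.
by rewrite ballE.
Qed.

HB.instance Definition _ := Uniform_isComplete.Build S complete.

Let mulA : associative mul.
Proof. by move=> x y z; apply: val_inj; exact: cmulA. Qed.
Let mul_linl (y : S) : linear (mul^~ y).
Proof. by move=> a x x'; apply: val_inj; exact: (cmul_linearl (val y)). Qed.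
Let mul_linr (x : S) : linear (mul x).
Proof. by move=> a y y'; apply: val_inj; exact: (cmul_linearr (val x)). Qed.
Let starK : involutive star.
Proof. by move=> x; apply: val_inj; exact: cstarK. Qed.
Let starM x y : star (mul x y) = mul (star y) (star x).
Proof. by apply: val_inj; exact: cstarM. Qed.
Let starP (c : C) (x y : S) : star (c *: x + y) = c^* *: star x + star y.
Proof. by apply: val_inj; exact: cstarP. Qed.
Let norm_mul (x y : S) : `|mul x y| <= `|x| * `|y|.
Proof. exact: cnormM. Qed.
Let norm_star (x : S) : `|mul (star x) x| = `|x| ^+ 2.
Proof. exact: cnorm_star. Qed.

HB.instance Definition _ := isCstar.Build R S
  mulA mul_linl mul_linr starK starM starP norm_mul norm_star.

Lemma subalg_val_hom : star_hom (val : S -> A).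
Proof. by []. Qed.

Lemma subalg_sub (x : A) : D x -> exists y : S, val y = x.
Proof. by move=> Dx; exists (insub Dx). Qed.

End ClosedSubalgebra.

Section Cuntz.
Context (R : realType).
Notation C := R[i].

Lemma cuntz_unit (n : nat) (O : cuntz R n) : is_cunit (cz_one O).
Proof. by have := cz_spec O; rewrite /is_cuntz; case: ifP => _ [] // []. Qed.

Lemma cunit_star (A : cstarType R) (e : A) : is_cunit e -> cstar e = e.
Proof.
move=> eu; have := (eu (cstar e)).1 => h.
by rewrite -[RHS]cstarK -h cstarM cstarK h.
Qed.

(** The universal property, applied to the subalgebra, produces a *-homomorphism
    with values in it; followed by the inclusion, it fixes the generators, and
    is the identity by uniqueness. *)
Lemma cuntz_generated (n : nat) (O : cuntz R n) (D : O -> Prop) :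
  closed_star_subalgebra D -> D (cz_one O) -> (forall i, D (cz_gen O i)) ->
  forall x, D x.
Proof.
move=> Dcl D1 Dg x; have := cz_spec O; rewrite /is_cuntz; case: ifP => _.
  move=> [_ _ h _]; have [c ->] := h x.
  by case: Dcl => -[D0 DL _] _ _; rewrite -[_ *: _]addr0; exact: DL.
move=> [rel univ].
pose S := subalgebra Dcl : cstarType R; pose v : S -> O := @subalg_val _ _ D Dcl.
have vI : injective v by exact: val_inj.
have [vL vM vS] : star_hom v by exact: subalg_val_hom.
have [e1 e1E] := subalg_sub Dcl D1.
have [t tE] := choice (fun i => subalg_sub Dcl (Dg i)).
have trel : cuntz_relations (e1 : S) (t : 'I_n -> S).
  have [ru rs rsum] := rel; split.
  - by move=> a; split; apply: vI; rewrite vM; rewrite /v e1E; apply ru.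
  - move=> i j; apply: vI; rewrite vM vS /v !tE rs.
    by case: ifP.
  - apply: vI; rewrite (lin_sum _ _ vL) /v e1E -rsum; apply: eq_bigr => i _.
    by have := vM (t i) (cstar (t i)); rewrite vS /v !tE.
have [f [[fh f1 fg] _]] := univ _ _ _ trel.
have [g [_ gu]] := univ _ _ _ rel.
have E1 : g = v \o f.
  apply: gu; split; first exact: star_hom_comp (subalg_val_hom Dcl) fh.
    by rewrite /= f1.
  by move=> i; rewrite /= fg; exact: tE.
have E2 : g = id by apply: gu; split.
have -> : x = v (f x) by rewrite -[LHS]/(id x) -E2 E1.
by case: (f x) => y /= /asboolP.
Qed.

(** The condition is imposed on [X] and on [X*] together, so that the elements
    satisfying it form a *-subalgebra whatever the operator [V] is. *)
Lemma cuntz_intertwine (n : nat) (O : cuntz R n) (K1 K2 : hilbertType R)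
    (r1 : O -> K1 -> K1) (r2 : O -> K2 -> K2) (V : K1 -> K2) :
  is_rep r1 -> is_rep r2 -> bounded_linear V ->
  (forall u, V (r1 (cz_one O) u) = r2 (cz_one O) (V u)) ->
  (forall i u, V (r1 (cz_gen O i) u) = r2 (cz_gen O i) (V u)) ->
  (forall i u, V (r1 (cstar (cz_gen O i)) u) = r2 (cstar (cz_gen O i)) (V u)) ->
  forall X u, V (r1 X u) = r2 X (V u).
Proof.
move=> h1 h2 Vb V1 Vg Vgs.
pose E X := forall u, V (r1 X u) = r2 X (V u).
suff : forall X, E X /\ E (cstar X) by move=> h X; exact: (h X).1.
have Ecl : closed_subspace E.
  apply: closed_forall => u; apply: closed_equalizer; last exact: rep_bl_alg.
  by apply: (bl_comp Vb); exact: rep_bl_alg.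
have EM a b : E a -> E b -> E (cmul a b).
  by move=> Ea Eb u; rewrite (repM h1) (repM h2) Ea Eb.
apply: cuntz_generated.
- split.
  + have [E0 EL Elim] := Ecl; split.
    * by rewrite cstar0.
    * move=> c x y [Ex Esx] [Ey Esy]; split; first exact: EL.
      by rewrite cstarP; exact: EL.
    * move=> x h; split; apply: Elim => e /h[y [Ey Esy] xy]; first by exists y.
      exists (cstar y) => //; rewrite -norm_cstar.
      have := cstarP (-1) (cstar y) (cstar x); rewrite !cstarK rmorphN1.
      by rewrite !scaleN1r addrC => ->; rewrite addrC.
  + move=> a b [Ea Esa] [Eb Esb]; split; first exact: EM.
    by rewrite cstarM; exact: EM.
  + by move=> a [Ea Esa]; rewrite cstarK.
- by rewrite (cunit_star (@cuntz_unit n O)).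
- by move=> i; split; [exact: Vg|exact: Vgs].
Qed.

End Cuntz.

(** * The isometries intertwining the GNS representations *)

Lemma the_map_none (X : Type) (Y : zmodType) (P : (X -> Y) -> Prop) :
  ~ (exists f, P f) -> the_map P = fun=> 0.
Proof. by move=> h; apply: xgetPN => f Pf; apply: h; exists f. Qed.

Section Slice.
Context (R : realType) (ht : htensors R) (H K : hilbertType R) (v : K).
Hypothesis v1 : hdot v v = 1.
Notation C := R[i].

Lemma norm_unit : `|v| = 1.
Proof.
by apply/eqP; rewrite -(eqrXn2 (n := 2))// -hdot_norm v1 expr1n.
Qed.

Definition line_proj (y : K) : K := hdot v y *: v.

Lemma line_proj_bounded : bounded_by 1 line_proj.
Proof.
split; first by move=> a x y; rewrite /line_proj hdotDr hdotZr scalerDl scalerA.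
move=> x; rewrite normrZ norm_unit mulr1 mul1r.
by have := cauchy_schwarz v x; rewrite norm_unit mul1r.
Qed.

Lemma bl_line_proj : bounded_linear line_proj.
Proof. exact: bounded_byW line_proj_bounded. Qed.

(** The slice map [1 (x) <v|]; it is contractive because followed by the
    isometry [x |-> x (x) v] it is the contraction [1 (x) |v><v|]. *)
Lemma slice_exists : exists2 E : ht H K -> H, bounded_by 1 E &
  forall x y, E (x ⊗[ht] y) = hdot v y *: x.
Proof.
pose Q := htens_op (ht := ht) (id : H -> H) line_proj.
have Qb : bounded_linear Q by apply: bl_htens_op; [exact: bl_id|exact: bl_line_proj].
pose G z x := exists s : seq (H * K),
  z = \sum_(p <- s) p.1 ⊗[ht] p.2 /\ x = \sum_(p <- s) hdot v p.2 *: p.1.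
have [||||E Eb EG] := @graph_extension R (ht H K) H G 1.
- exact: ler01.
- move=> a z w z' w' [s [-> ->]] [s' [-> ->]].
  exists ([seq (a *: p.1, p.2) | p <- s] ++ s'); rewrite !big_cat !big_map /=.
  split; congr (_ + _); rewrite scaler_sumr; apply: eq_bigr => p _.
    by rewrite tensZl.
  by rewrite !scalerA mulrC.
- move=> z x [s [-> ->]]; set y := (X in `|X| <= _); set u := (X in _ <= 1 * `|X|).
  have QE : Q u = y ⊗[ht] v.
    rewrite /u /y (lin_sum _ _ (bl_linear Qb)) (lin_sum _ _ (ht_linearl (ht H K) v)).
    apply: eq_bigr => p _; rewrite /Q htens_opE; [|exact: bl_id|exact: bl_line_proj].
    by rewrite /line_proj tensZr /= tensZl.
  have -> : `|y| = `|Q u| by rewrite QE norm_tens norm_unit mulr1.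
  have id1 : bounded_by 1 (id : H -> H) by split=> // x'; rewrite mul1r.
  have := htens_op_norm (ht := ht) (bl_id H) bl_line_proj ler01 ler01 id1 line_proj_bounded u.
  by rewrite mulr1.
- move=> z e e0; have [_ [s ->] zs] := closureP (ht_dense (ht H K)) z e0.
  by exists (\sum_(p <- s) p.1 ⊗[ht] p.2), (\sum_(p <- s) hdot v p.2 *: p.1); split=> //; exists s.
exists E => // x y; apply: EG; exists [:: (x, y)].
by rewrite !big_seq1.
Qed.

Definition slice : ht H K -> H := sval (cid2 slice_exists).

Lemma slice_bounded : bounded_by 1 slice.
Proof. by rewrite /slice; case: cid2. Qed.

Lemma sliceE x y : slice (x ⊗[ht] y) = hdot v y *: x.
Proof. by rewrite /slice; case: cid2. Qed.

End Slice.

Section CuntzRepresentations.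
Context (R : realType) (ht : htensors R) (ct : mtensors ht).
Context (O : forall n : posN, cuntz R n).
Notation C := R[i].

Definition phi_spec n m (f : O (pmul n m) -> ct (O n) (O m)) :=
  [/\ star_hom f, f (cz_one (O (pmul n m))) = cz_one (O n) ⊗m[ct] cz_one (O m) &
   forall (k : 'I_(pmul n m)) (i : 'I_n) (j : 'I_m), k = (m * i + j)%N :> nat ->
     f (cz_gen (O (pmul n m)) k) = cz_gen (O n) i ⊗m[ct] cz_gen (O m) j].

Lemma index_split (n m : posN) (k : 'I_(pmul n m)) :
  exists (i : 'I_n) (j : 'I_m), k = (m * i + j)%N :> nat.
Proof.
have m0 := posN_gt0 m.
have hi : (k %/ m < n)%N by rewrite ltn_divLR.
have hj : (k %% m < m)%N by rewrite ltn_mod.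
exists (Ordinal hi), (Ordinal hj) => /=.
by rewrite [X in (X + _)%N]mulnC; exact: divn_eq.
Qed.

Hypothesis phiP : forall n m, phi_spec (cuntz_phi ct O n m).

Section RepPhi.
Context (n m : posN) (K1 K2 : hilbertType R).
Context (r1 : O n -> K1 -> K1) (r2 : O m -> K2 -> K2).
Hypotheses (h1 : is_rep r1) (h2 : is_rep r2).

Lemma rep_phi_rep : is_rep (rep_phi ct O r1 r2).
Proof. by apply: rep_star_hom; [case: (phiP n m)|exact: tens_rep_rep]. Qed.

Lemma rep_phi_one x y :
  rep_phi ct O r1 r2 (cz_one _) (x ⊗[ht] y) = r1 (cz_one _) x ⊗[ht] r2 (cz_one _) y.
Proof.
by rewrite /rep_phi /=; have [_ -> _] := phiP n m; rewrite tens_repE.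
Qed.

Lemma rep_phi_gen (k : 'I_(pmul n m)) (i : 'I_n) (j : 'I_m) x y :
  k = (m * i + j)%N :> nat ->
  rep_phi ct O r1 r2 (cz_gen _ k) (x ⊗[ht] y) = r1 (cz_gen _ i) x ⊗[ht] r2 (cz_gen _ j) y.
Proof.
move=> kE; rewrite /rep_phi /=; have [_ _ /(_ _ _ _ kE) ->] := phiP n m.
by rewrite tens_repE.
Qed.

Lemma rep_phi_genV (k : 'I_(pmul n m)) (i : 'I_n) (j : 'I_m) x y :
  k = (m * i + j)%N :> nat ->
  rep_phi ct O r1 r2 (cstar (cz_gen _ k)) (x ⊗[ht] y) =
    r1 (cstar (cz_gen _ i)) x ⊗[ht] r2 (cstar (cz_gen _ j)) y.
Proof.
move=> kE; rewrite /rep_phi /=; have [[_ _ ->] _ /(_ _ _ _ kE) ->] := phiP n m.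
by rewrite mt_star tens_repE.
Qed.

End RepPhi.

(** Coassociativity: both iterated tensor products of representations agree on
    generators, after reindexing along [n (m l) = (n m) l]. *)
Lemma rep_phi_assoc (n m l : posN) (K1 K2 K3 : hilbertType R)
    (r1 : O n -> K1 -> K1) (r2 : O m -> K2 -> K2) (r3 : O l -> K3 -> K3)
    (kappa : O (pmul (pmul n m) l) -> O (pmul n (pmul m l))) :
  is_rep r1 -> is_rep r2 -> is_rep r3 -> star_hom kappa ->
  kappa (cz_one _) = cz_one _ ->
  (forall (i : 'I_(pmul (pmul n m) l)) (j : 'I_(pmul n (pmul m l))),
     i = j :> nat -> kappa (cz_gen _ i) = cz_gen _ j) ->
  forall X u, htens_assocV (rep_phi ct O r1 (rep_phi ct O r2 r3) (kappa X) u) =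
    rep_phi ct O (rep_phi ct O r1 r2) r3 X (htens_assocV (ht := ht) u).
Proof.
move=> h1 h2 h3 kh k1 kg.
have h12 := rep_phi_rep h1 h2; have h23 := rep_phi_rep h2 h3.
have hl := rep_phi_rep h12 h3; have hr := rep_star_hom kh (rep_phi_rep h1 h23).
have AVb := bl_assocV ht K1 K2 K3.
have eqg (a : O (pmul (pmul n m) l)) :
   (forall x y z, htens_assocV (rep_phi ct O r1 (rep_phi ct O r2 r3) (kappa a) (x ⊗[ht] (y ⊗[ht] z))) =
    rep_phi ct O (rep_phi ct O r1 r2) r3 a (x ⊗[ht] y ⊗[ht] z)) ->
   forall u, htens_assocV (rep_phi ct O r1 (rep_phi ct O r2 r3) (kappa a) u) =
    rep_phi ct O (rep_phi ct O r1 r2) r3 a (htens_assocV (ht := ht) u).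
  move=> h; apply: (bl_eq_total (@total_tens3r R ht K1 K2 K3)
    (S := @htens_assocV R ht K1 K2 K3 \o (rep_phi ct O r1 (rep_phi ct O r2 r3) \o kappa) a)
    (T := rep_phi ct O (rep_phi ct O r1 r2) r3 a \o @htens_assocV R ht K1 K2 K3)).
  - by apply: (bl_comp AVb); exact: rep_bl.
  - by apply: bl_comp => //; exact: rep_bl.
  by move=> [x [y z]] /=; rewrite htens_assocVE h.
(* k = l (m a + b) + c = (m l) a + (l b + c) *)
have idx (k : 'I_(pmul (pmul n m) l)) : exists (a : 'I_n) (b : 'I_m) (c : 'I_l)
   (ab : 'I_(pmul n m)) (bc : 'I_(pmul m l)) (k' : 'I_(pmul n (pmul m l))),
   [/\ k = l * ab + c :> nat, ab = m * a + b :> nat,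
     k' = pmul m l * a + bc :> nat, bc = l * b + c :> nat & k = k' :> nat]%N.
  have [ab [c kE]] := index_split k; have [a [b abE]] := index_split ab.
  have hbc : (l * b + c < pmul m l)%N.
    rewrite /= mulnC; apply: (@leq_trans (b * l + l)); first by rewrite ltn_add2l.
    by rewrite -mulSnr leq_mul2r ltn_ord orbT.
  have hk : (k < pmul n (pmul m l))%N by have := ltn_ord k; rewrite /= mulnA.
  exists a, b, c, ab, (Ordinal hbc), (Ordinal hk); split=> //=.
  by rewrite kE abE mulnDr addnA mulnA [(l * m)%N]mulnC.
apply: (cuntz_intertwine hr hl AVb).
- by apply: eqg => x y z; rewrite k1 !rep_phi_one// htens_assocVE.
- move=> k; apply: eqg => x y z; have [a [b [c [ab [bc [k' [E1 E2 E3 E4 E5]]]]]]] := idx k.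
  rewrite (kg _ _ E5) (rep_phi_gen h1 h23 _ _ E3) (rep_phi_gen h2 h3 _ _ E4).
  by rewrite (rep_phi_gen h12 h3 _ _ E1) (rep_phi_gen h1 h2 _ _ E2) htens_assocVE.
- move=> k; apply: eqg => x y z; have [a [b [c [ab [bc [k' [E1 E2 E3 E4 E5]]]]]]] := idx k.
  have [_ _ ->] := kh.
  rewrite (kg _ _ E5) (rep_phi_genV h1 h23 _ _ E3) (rep_phi_genV h2 h3 _ _ E4).
  by rewrite (rep_phi_genV h12 h3 _ _ E1) (rep_phi_genV h1 h2 _ _ E2) htens_assocVE.
Qed.

End CuntzRepresentations.

Section GNS.
Context (R : realType) (ht : htensors R) (ct : mtensors ht).
Notation C := R[i].
Context (O : forall n : posN, cuntz R n) (w : forall n, O n -> C)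
  (H : posN -> hilbertType R) (pi : forall n, O n -> H n -> H n)
  (Omega : forall n, H n).
Arguments w n _ : clear implicits.
Arguments pi n _ _ : clear implicits.
Hypotheses (w_state : forall n, is_state (w n))
  (w_GNS : forall n, is_GNS (w n) (pi n) (Omega n))
  (w_phi : forall n m, state_phi ct O (w n) (w m) =1 w (pmul n m)).
Arguments pi {n}.

(** A state has norm one. *)
Lemma state_neq0 n : ~ (forall a, w n a = 0).
Proof.
move=> w0; have [_ _ _ /(_ 0)] := w_state n.
have h a : `|w n a| <= 0 * `|a| by rewrite w0 normr0 mul0r.
by move=> /(_ h); rewrite lt_geF ?ltr01.
Qed.

(** Since [w_(nm)] is not zero, the maps of which it is the composite exist. *)
Lemma tens_state_spec n m : is_state (tens_state (ct := ct) (w n) (w m)) /\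
  forall a b, tens_state (w n) (w m) (a ⊗m[ct] b) = w n a * w m b.
Proof.
have [ex|nex] := pselect (exists f : ct (O n) (O m) -> C, is_state f /\
    forall a b, f (a ⊗m[ct] b) = w n a * w m b).
  exact: (the_mapP ex).
exfalso; apply: (@state_neq0 (pmul n m)) => a.
by rewrite -w_phi /state_phi /tens_state (the_map_none nex).
Qed.

Lemma cuntz_phi_spec n m : phi_spec (cuntz_phi ct O n m).
Proof.
have [ex|nex] := pselect (exists f, @phi_spec R ht ct O n m f).
  exact: (the_mapP ex).
exfalso; apply: (@state_neq0 (pmul n m)) => a.
rewrite -w_phi /state_phi /= /cuntz_phi (the_map_none nex).
by have [[wL _ _ _] _] := tens_state_spec n m; exact: (lin0 (V := C^o) wL).
Qed.

Lemma pi_rep n : is_rep (@pi n). Proof. by case: (w_GNS n). Qed.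

Lemma total_gns n : total_family (fun X => pi X (Omega n)).
Proof.
have [_ cyc _] := w_GNS n.
apply: (total_closure cyc) => _ [X _ <-]; exists [:: (1, X)].
by rewrite /lin_comb big_seq1 scale1r.
Qed.

Lemma wE n X : w n X = hdot (Omega n) (pi X (Omega n)).
Proof. by case: (w_GNS n). Qed.

Lemma pi_one n : @pi n (cz_one (O n)) =1 id.
Proof.
apply: (bl_eq_total (@total_gns n)); [exact: (rep_bl (pi_rep n))|exact: bl_id|].
move=> X; rewrite -(repM (pi_rep n)).
by rewrite (@cuntz_unit R n (O n) X).1.
Qed.

Lemma norm_cunit (A : cstarType R) (e : A) : is_cunit e -> `|e| <= 1.
Proof.
move=> eu; have := cnorm_star e; rewrite (cunit_star eu) (eu e).1 => h.
have [->|e0] := eqVneq e 0; first by rewrite normr0.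
have ne : `|e| != 0 by rewrite normr_eq0.
by rewrite -(mulfK ne `|e|) -expr2 -h mulfV.
Qed.

(** The norm of the functional [<Omega, pi(.) Omega>] is at most [|Omega|], which
    forces [1 <= |Omega|]; the other inequality comes from evaluating at the
    unit. *)
Lemma Omega_unit n : hdot (Omega n) (Omega n) = 1.
Proof.
have [_ _ wN wmin] := w_state n.
have e1 : hdot (Omega n) (Omega n) = w n (cz_one (O n)) by rewrite wE pi_one.
have le1 : hdot (Omega n) (Omega n) <= 1.
  rewrite -[X in X <= _](ger0_norm (hdot_ge0 _)) e1; apply: le_trans (wN _) _.
  exact: norm_cunit (@cuntz_unit R n (O n)).
have nle : `|Omega n| <= 1.
  by rewrite -(ler_pXn2r (n := 2))// ?nnegrE// expr1n -hdot_norm.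
apply/eqP; rewrite eq_le le1 hdot_norm /=; apply: exprn_ege1; apply: wmin => a.
rewrite wE; apply: le_trans (cauchy_schwarz _ _) _; apply: ler_wpM2l => //.
apply: le_trans (rep_contractive (pi_rep n) _ _) _.
by apply: ler_piMr.
Qed.

Notation rp n m := (rep_phi ct O (@pi n) (@pi m)).

Lemma rp_rep n m : is_rep (rp n m).
Proof. by apply: (rep_phi_rep cuntz_phi_spec); exact: pi_rep. Qed.

Lemma tens_stateE n m z : tens_state (ct := ct) (w n) (w m) z =
  hdot (Omega n ⊗[ht] Omega m) (tens_rep (@pi n) (@pi m) z (Omega n ⊗[ht] Omega m)).
Proof.
have [st stE] := tens_state_spec n m; move: z.
apply: (bl_eq_mtens (V := C^o) (T := hdot _ \o (tens_rep (@pi n) (@pi m))^~ _)).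
- exact: bl_state.
- apply: bl_comp; first exact: bl_hdot.
  by apply: rep_bl_alg; apply: tens_rep_rep; exact: pi_rep.
move=> a b /=; rewrite stE tens_repE; [|exact: pi_rep|exact: pi_rep].
by rewrite ht_dot !wE.
Qed.

(** The vector state of [Omega_n (x) Omega_m] under [pi_n (x)_phi pi_m] is
    [w_(nm)], so GNS uniqueness embeds [H_(nm)] in [H_n (x) H_m]. *)
Lemma gns_embed_exists n m : exists2 U : H (pmul n m) -> ht (H n) (H m),
  isometric_op U &
  forall X, U (pi X (Omega (pmul n m))) = rp n m X (Omega n ⊗[ht] Omega m).
Proof.
apply: isometry_extension; first exact: total_gns.
move=> X Y.
(* both inner products are the value of the state at X* Y *)
rewrite -[X in hdot (pi X _)]cstarK -[X in _ = hdot (rp n m X _) _]cstarK.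
rewrite (rep_star (pi_rep _)) (rep_star (rp_rep n m)).
rewrite -(repM (pi_rep _)) -(repM (rp_rep n m)) -wE -w_phi.
by rewrite /state_phi /= tens_stateE.
Qed.

Definition gns_embed n m := sval (cid2 (gns_embed_exists n m)).

Arguments gns_embed n m _ : clear implicits.

Lemma gns_embed_isometric n m : isometric_op (gns_embed n m).
Proof. by rewrite /gns_embed; case: cid2. Qed.

Lemma bl_gns_embed n m : bounded_linear (gns_embed n m).
Proof. exact/isometric_bl/gns_embed_isometric. Qed.

Lemma gns_embed_pi n m X :
  gns_embed n m (pi X (Omega (pmul n m))) = rp n m X (Omega n ⊗[ht] Omega m).
Proof. by rewrite /gns_embed; case: cid2. Qed.

Lemma gns_embed_Omega n m : gns_embed n m (Omega (pmul n m)) = Omega n ⊗[ht] Omega m.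
Proof.
rewrite -{1}(pi_one (Omega (pmul n m))) gns_embed_pi.
by rewrite (rep_phi_one cuntz_phi_spec (pi_rep n) (pi_rep m)) !pi_one.
Qed.

(** Clear on the vectors [pi Y Omega], which are total. *)
Lemma gns_embed_intertwine n m X x :
  gns_embed n m (pi X x) = rp n m X (gns_embed n m x).
Proof.
move: x; apply: (bl_eq_total (@total_gns _) (S := gns_embed n m \o pi X)
  (T := rp n m X \o gns_embed n m)).
- by apply: (bl_comp (bl_gns_embed n m)); exact: (rep_bl (pi_rep _)).
- by apply: bl_comp; [exact: (rep_bl (rp_rep n m))|exact: bl_gns_embed].
move=> Y /=; rewrite -(repM (pi_rep _)) !gns_embed_pi.
by rewrite (repM (rp_rep n m)).
Qed.

(** On elementary tensors, [W (x (x) y) = <Omega_m, y> U x], where [U] is the GNS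
    embedding. *)
Definition gns_W n m : ht (H (pmul n m)) (H m) -> ht (H n) (H m) :=
  gns_embed n m \o slice (ht := ht) (H := H (pmul n m)) (Omega_unit m).

Arguments gns_W n m _ : clear implicits.

Lemma gns_W_bounded n m : bounded_by 1 (gns_W n m).
Proof.
have [sL sM] := slice_bounded ht (H (pmul n m)) (Omega_unit m).
have [UL UN] := gns_embed_isometric n m.
by split; [exact: lin_comp|move=> x /=; rewrite UN].
Qed.

Lemma bl_gns_W n m : bounded_linear (gns_W n m).
Proof. exact: bounded_byW (gns_W_bounded n m). Qed.

Lemma gns_WE n m x y :
  gns_W n m (x ⊗[ht] y) = hdot (Omega m) y *: gns_embed n m x.
Proof.
by rewrite /gns_W /= sliceE (linZ _ _ (gns_embed_isometric n m).1).
Qed.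

(** The initial projection [W* W]. *)
Definition gns_Q n m : ht (H (pmul n m)) (H m) -> ht (H (pmul n m)) (H m) :=
  htens_op id (line_proj (Omega m)).

Arguments gns_Q n m _ : clear implicits.

Lemma gns_Q_bounded n m : bounded_by 1 (gns_Q n m).
Proof.
have b := line_proj_bounded (Omega_unit m).
have id1 : bounded_by 1 (id : H (pmul n m) -> _) by split=> // x; rewrite mul1r.
split; first by apply: bl_linear; apply: bl_htens_op; [exact: bl_id|exact: bounded_byW b].
have := htens_op_norm (ht := ht) (bl_id _) (bounded_byW b) ler01 ler01 id1 b.
by rewrite mulr1.
Qed.

Lemma gns_QE n m x y : gns_Q n m (x ⊗[ht] y) = hdot (Omega m) y *: (x ⊗[ht] Omega m).
Proof.
rewrite /gns_Q htens_opE; [|exact: bl_id|exact: (bl_line_proj (Omega_unit m))].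
by rewrite tensZr.
Qed.

Lemma gns_W_Q n m u : gns_W n m (gns_Q n m u) = gns_W n m u.
Proof.
have Qb := bounded_byW (gns_Q_bounded n m); have Wb := bl_gns_W n m.
move: u; apply: (bl_eq_tens (S := gns_W n m \o gns_Q n m)) => //; first exact: bl_comp.
move=> x y /=; rewrite gns_QE (linZ _ _ (bl_linear Wb)) !gns_WE Omega_unit.
by rewrite scale1r.
Qed.

Lemma gns_Q_dot n m u v : hdot u (gns_Q n m v) = hdot (gns_W n m u) (gns_W n m v).
Proof.
have Qb := bounded_byW (gns_Q_bounded n m); have Wb := bl_gns_W n m.
have Ib := @bl_id R (ht (H (pmul n m)) (H m)).
have tot := total_elementary (ht (H (pmul n m)) (H m)).
refine (@hdot_total R _ _ _ _ _ _ _ _ id (gns_Q n m) (gns_W n m) (gns_W n m)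
   tot tot Ib Qb Wb Wb _ u v) => -[x y] [x' y'].
rewrite /elementary /= gns_QE !gns_WE hdotZr hdotZl hdotZr ht_dot.
rewrite (isometric_hdot (gns_embed_isometric n m)) -hdotC.
by rewrite mulrCA [RHS]mulrCA [in RHS]mulrA [in RHS]mulrC.
Qed.

Lemma gns_W_partial n m : partial_isometry (gns_W n m).
Proof.
apply: (partial_isometry_criterion (Q := gns_Q n m)).
- exact: bl_gns_W.
- exact: gns_Q_dot.
- exact: gns_W_Q.
Qed.

Lemma Omega2_unit n m : hdot (Omega n ⊗[ht] Omega m) (Omega n ⊗[ht] Omega m) = 1.
Proof. by rewrite ht_dot !Omega_unit mulr1. Qed.

Lemma gns_W_neq0 n m : exists u, gns_W n m u <> 0.
Proof.
exists (Omega _ ⊗[ht] Omega _); rewrite gns_WE Omega_unit scale1r gns_embed_Omega => h.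
by have := Omega2_unit n m; rewrite h hdot0l => /esym/eqP; rewrite oner_eq0.
Qed.

Lemma gns_W_intertwine n m X :
  gns_W n m \o htens_op (pi X) id =1 rp n m X \o gns_W n m.
Proof.
have pb := rep_bl (pi_rep (pmul n m)) X.
have Ib := @bl_id R (H m).
apply: bl_eq_tens.
- by apply: bl_comp; [exact: bl_gns_W|exact: bl_htens_op].
- by apply: bl_comp; [exact: (rep_bl (rp_rep n m))|exact: bl_gns_W].
move=> x y /=; rewrite htens_opE// !gns_WE gns_embed_intertwine.
by rewrite (linZ _ _ (bl_linear (rep_bl (rp_rep n m) X))).
Qed.

(** Cyclicity makes the GNS embedding [U] unitary; then
    [v |-> U^-1 v (x) Omega_m] is an isometric section of [W]. *)
Lemma gns_W_coisometry n m :
  cyclic_vector (rp n m) (Omega n ⊗[ht] Omega m) ->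
  exists2 S, isometric_op S & forall v, gns_W n m (S v) = v.
Proof.
move=> cyc.
have tot : total_family (fun X => rp n m X (Omega n ⊗[ht] Omega m)).
  apply: (total_closure cyc) => _ [X _ <-]; exists [:: (1, X)].
  by rewrite /lin_comb big_seq1 scale1r.
have [|S Si US] := isometry_onto (gns_embed_isometric n m) tot.
  by move=> X; exists (pi X (Omega (pmul n m))); exact: gns_embed_pi.
exists (fun v => S v ⊗[ht] Omega m).
  split; first exact: (lin_comp Si.1 (ht_linearl _ _)).
  by move=> v; rewrite norm_tens (norm_unit (Omega_unit m)) mulr1 Si.2.
by move=> v; rewrite gns_WE Omega_unit scale1r US.
Qed.

Lemma gns_W_adjoint n m :
  cyclic_vector (rp n m) (Omega n ⊗[ht] Omega m) ->
  isometric_op (adjoint (gns_W n m)).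
Proof.
move=> /gns_W_coisometry[S Si WS].
exact: adjoint_isometric (gns_W_bounded n m) Si WS.
Qed.

(** ** The pentagon equation *)

(** Everything about [W n m] that is needed after transport along an equation
    [n m = k], in a form that does not mention the transport. *)
Lemma gns_transport n m k (e : pmul n m = k)
    (W' := ecast k (ht (H k) (H m) -> ht (H n) (H m)) e (gns_W n m)) :
  bounded_linear W' /\
  exists (kappa : O k -> O (pmul n m)) (U' : H k -> ht (H n) (H m)),
  [/\ star_hom kappa /\ kappa (cz_one _) = cz_one _,
      forall (i : 'I_k) (j : 'I_(pmul n m)), i = j :> nat -> kappa (cz_gen _ i) = cz_gen _ j,
      bounded_linear U',
      forall X, U' (pi X (Omega k)) = rp n m (kappa X) (Omega n ⊗[ht] Omega m) &
      forall x y, W' (x ⊗[ht] y) = hdot (Omega m) y *: U' x].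
Proof.
rewrite {}/W'; case: k / e => /=; split; first exact: bl_gns_W.
exists id, (gns_embed n m); split=> //.
- by move=> i j ij; congr cz_gen; exact: val_inj.
- exact: bl_gns_embed.
- exact: gns_embed_pi.
- exact: gns_WE.
Qed.

(** On [pi X Omega], both sides are the action of [X] on
    [Omega_n (x) Omega_m (x) Omega_l] under an iterated tensor product of
    representations, and the two iterated products coincide. *)
Lemma gns_embed_coassoc n m l (kappa : O (pmul (pmul n m) l) -> O (pmul n (pmul m l)))
    (U' : H (pmul (pmul n m) l) -> ht (H n) (H (pmul m l))) :
  star_hom kappa -> kappa (cz_one _) = cz_one _ ->
  (forall (i : 'I_(pmul (pmul n m) l)) (j : 'I_(pmul n (pmul m l))),
     i = j :> nat -> kappa (cz_gen _ i) = cz_gen _ j) ->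
  bounded_linear U' ->
  (forall X, U' (pi X (Omega _)) = rp n (pmul m l) (kappa X) (Omega n ⊗[ht] Omega (pmul m l))) ->
  forall x, htens_op (gns_embed n m) id (gns_embed (pmul n m) l x) =
    htens_assocV (htens_op id (gns_embed m l) (U' x)) :> ht (ht (H n) (H m)) (H l).
Proof.
move=> kh k1 kg Ub UE.
have Ib k := @bl_id R (H k); have Vb := bl_assocV ht (H n) (H m) (H l).
have Ub1 := bl_gns_embed n m; have Ub2 := bl_gns_embed m l.
apply: (bl_eq_total (@total_gns _) (S := htens_op (gns_embed n m) id \o gns_embed (pmul n m) l)
  (T := @htens_assocV R ht (H n) (H m) (H l) \o (htens_op id (gns_embed m l) \o U'))).
- by apply: bl_comp; [exact: bl_htens_op|exact: bl_gns_embed].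
- by apply: (bl_comp Vb); apply: bl_comp => //; exact: bl_htens_op.
move=> X /=; rewrite gns_embed_pi UE.
rewrite (tens_rep_intertwine (pi_rep (pmul n m)) (pi_rep l) (rp_rep n m) (pi_rep l) Ub1 (Ib l)
  (@gns_embed_intertwine n m) (fun _ _ => erefl)).
rewrite (tens_rep_intertwine (pi_rep n) (pi_rep (pmul m l)) (pi_rep n) (rp_rep m l) (Ib n) Ub2
  (fun _ _ => erefl) (@gns_embed_intertwine m l)).
rewrite !htens_opE// !gns_embed_Omega.
rewrite -[tens_rep (@pi n) _ _ _]/(rep_phi ct O (@pi n) (rp m l) (kappa X) _).
rewrite (rep_phi_assoc cuntz_phi_spec (pi_rep n) (pi_rep m) (pi_rep l) kh k1 kg).
by rewrite htens_assocVE.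
Qed.

(** On [x (x) y (x) z], the right side is
    [<Omega_l, z> <Omega_(ml), y> (1 (x) U) U x]. On the left, [y] is first
    replaced by [U y], whose legs are then paired with [Omega_m] and [Omega_l];
    since [U Omega_(ml) = Omega_m (x) Omega_l] and [U] is isometric, this gives
    [<Omega_l, z> <Omega_(ml), y> (U (x) 1) U x], and coassociativity of the
    embeddings concludes. *)
Lemma gns_pentagon n m l :
  leg12 (gns_W n m) \o leg13 (gns_W (pmul n m) l) \o leg23 (gns_W m l)
    =1 leg23 (gns_W m l) \o
       leg12 (ecast k (ht (H k) (H (pmul m l)) -> ht (H n) (H (pmul m l)))
                (pmulA n m l) (gns_W n (pmul m l))).
Proof.
have [W'b [kappa [U' [[kh k1] kg Ub UE W'E]]]] := gns_transport (pmulA n m l).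
move: W'b W'E; set W' := ecast _ _ _ _ => W'b W'E.
have co := gns_embed_coassoc kh k1 kg Ub UE.
have Wb i j := bl_gns_W i j; have Ib i := @bl_id R (H i).
have Ub1 := bl_gns_embed n m; have Ub2 := bl_gns_embed m l.
have UIb : bounded_linear (htens_op (ht := ht) (gns_embed n m) (id : H l -> H l)).
  exact: bl_htens_op.
have IUb : bounded_linear (htens_op (ht := ht) (id : H n -> H n) (gns_embed m l)).
  exact: bl_htens_op.
have L12 := bl_leg12 (H l) (Wb n m); have L13 := bl_leg13 (H m) (Wb (pmul n m) l).
have L23 := bl_leg23 (H n) (Wb m l).
apply: bl_eq_tens3.
- apply: (bl_comp (bl_comp L12 L13)); exact: bl_leg23.
- by apply: (bl_comp L23); exact: bl_leg12.
move=> x y z /=; rewrite leg23E// leg12E// gns_WE W'E tensZl.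
rewrite (linZ _ _ (bl_linear L23)).
have -> : leg23 (gns_W m l) (U' x ⊗[ht] z) =
    hdot (Omega l) z *: htens_op (gns_embed n m) id (gns_embed (pmul n m) l x).
  rewrite co; move: (U' x); apply: (bl_eq_tens (S := leg23 (gns_W m l) \o (ht_map _)^~ z)
     (T := fun u => _ *: (@htens_assocV R ht (H n) (H m) (H l) \o htens_op id (gns_embed m l)) u)).
  - by apply: (bl_comp L23); exact: bl_tensl.
  - by apply: bl_scale; apply: bl_comp => //; exact: bl_assocV.
  move=> p q /=; rewrite leg23E// gns_WE tensZr (linZ _ _ (bl_linear (bl_assocV _ _ _ _))).
  by rewrite htens_opE.
rewrite tensZr (linZ _ _ (bl_linear (bl_assocV _ _ _ _))).
rewrite (linZ _ _ (bl_linear L13)) (linZ _ _ (bl_linear L12)).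
rewrite [RHS]scalerA mulrC -scalerA; congr (_ *: _).
rewrite -(isometric_hdot (gns_embed_isometric m l)) gns_embed_Omega.
move: (gns_embed m l y) => v; move: v.
apply: (bl_eq_tens (S := leg12 (gns_W n m) \o leg13 (gns_W (pmul n m) l) \o
    (@htens_assocV R ht (H (pmul (pmul n m) l)) (H m) (H l) \o ht_map _ x))
  (T := fun v => hdot _ v *: htens_op (gns_embed n m) id (gns_embed (pmul n m) l x))).
- by apply: (bl_comp (bl_comp L12 L13)); apply: bl_comp; [exact: bl_assocV|exact: bl_tensr].
- have [hL hM] := bl_hdot (Omega m ⊗[ht] Omega l).
  set c := htens_op _ _ _; split.
    by move=> a u v; rewrite hdotDr hdotZr scalerDl scalerA.
  exists (`|Omega m ⊗[ht] Omega l| * `|c|) => v.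
  by rewrite normrZ mulrAC ler_wpM2r// cauchy_schwarz.
move=> p q /=; rewrite htens_assocVE leg13E// gns_WE tensZl.
rewrite (linZ _ _ (bl_linear (bl_swap _ _ _ _))) (linZ _ _ (bl_linear L12)).
rewrite ht_dot mulrC -scalerA; congr (_ *: _).
move: (gns_embed (pmul n m) l x).
apply: (bl_eq_tens (S := leg12 (gns_W n m) \o (@htens_swap23 R ht _ _ _ \o (ht_map _)^~ p))
  (T := fun u => hdot _ p *: htens_op (gns_embed n m) id u)).
- by apply: (bl_comp L12); apply: bl_comp; [exact: bl_swap|exact: bl_tensl].
- exact: bl_scale.
move=> a b /=; rewrite htens_swapE leg12E// gns_WE tensZl.
by rewrite htens_opE.
Qed.

End GNS.

(** * The comultiplication *)

Section C0Sum.
Context (R : realType) (A : posN -> cstarType R) (S : c0sum A).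
Notation C := R[i].
Notation proj := (c0_proj S).
Notation inj := (c0_inj S).

Lemma proj_linear n : linear (proj n). Proof. by case: (c0_hom S n). Qed.

Lemma proj_norm n x : `|proj n x| <= `|x|.
Proof. exact: (c0_norm x (normr_ge0 x)).1. Qed.

Lemma bl_proj n : bounded_linear (proj n).
Proof.
by split; [exact: proj_linear|exists 1 => x; rewrite mul1r proj_norm].
Qed.

Lemma c0_ext x y : (forall n, proj n x = proj n y) -> x = y.
Proof.
move=> xy; apply/eqP; rewrite -subr_eq0 -normr_le0.
apply/(c0_norm _ (lexx 0)) => n.
by rewrite (linB _ _ (@proj_linear n)) xy subrr normr0.
Qed.

Lemma c0_inj_spec n x : proj n (inj n x) = x /\ forall k, k <> n -> proj k (inj n x) = 0.
Proof.
suff : exists j : A n -> S, forall x, proj n (j x) = x /\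
    forall k, k <> n -> proj k (j x) = 0.
  by move=> /the_mapP/(_ x).
suff /choice[j jP] : forall x, exists y, proj n y = x /\ forall k, k <> n -> proj k y = 0.
  by exists j.
move=> {}x; pose f := dfwith (fun k => 0 : A k) n x.
have f0 k : k <> n -> f k = 0 by move=> kn; rewrite /f dfwithout//; exact/eqP/nesym.
have [|y yf] := c0_surj S (f := f).
  move=> e e0; exists n.+1 => k nk; rewrite f0 ?normr0// => kn.
  by rewrite kn ltnn in nk.
exists y; split; first by rewrite yf /f dfwithin.
by move=> k kn; rewrite yf f0.
Qed.

Lemma proj_inj n x : proj n (inj n x) = x. Proof. by case: (c0_inj_spec x). Qed.

Lemma proj_inj_neq n k x : k <> n -> proj k (inj n x) = 0.
Proof. by case: (c0_inj_spec x) => _; apply. Qed.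

Lemma c0_inj_hom n : star_hom (inj n).
Proof.
have hom k := c0_hom S k.
split.
- move=> a x y; apply: c0_ext => k; rewrite (@proj_linear k a).
  have [->|/eqP kn] := eqVneq k n; first by rewrite !proj_inj.
  by rewrite !proj_inj_neq// scaler0 addr0.
- move=> x y; apply: c0_ext => k; have [_ -> _] := hom k.
  have [->|/eqP kn] := eqVneq k n; first by rewrite !proj_inj.
  by rewrite !proj_inj_neq// cmul0l.
- move=> x; apply: c0_ext => k; have [_ _ ->] := hom k.
  have [->|/eqP kn] := eqVneq k n; first by rewrite !proj_inj.
  by rewrite !proj_inj_neq// cstar0.
Qed.

Lemma c0_inj_orth n k x y : n <> k -> cmul (inj n x) (inj k y) = 0.
Proof.
move=> nk; apply: c0_ext => j; have [_ -> _] := c0_hom S j.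
rewrite (lin0 (@proj_linear j)).
have [jn|/eqP jn] := eqVneq j n; last by rewrite (proj_inj_neq _ jn) cmul0l.
by rewrite [proj j (inj k y)]proj_inj_neq ?cmul0r// jn.
Qed.

Definition positives_below (N : nat) : seq posN := pmap insub (iota 0 N).

Lemma mem_positives_below N (k : posN) : (k \in positives_below N) = (k < N)%N.
Proof. by rewrite mem_pmap_sub mem_iota. Qed.

(** Truncations of a family vanishing at infinity converge to it. *)
Lemma total_c0_inj : total_family (fun t : {n : posN & A n} => inj (tag t) (tagged t)).
Proof.
move=> P [P0 PL Plim] Pinj x.
have PD y z : P y -> P z -> P (y + z) by move=> Py Pz; rewrite -[y]scale1r; exact: PL.
apply: Plim => e e0; have e20 : 0 < e / 2 by rewrite divr_gt0.
have [N hN] := c0_vanishing x e20.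
pose y := \sum_(k <- positives_below N) inj k (proj k x).
have uN : uniq (positives_below N).
  by apply: (pmap_uniq (@insubK _ _ posN)); exact: iota_uniq.
have yE k : proj k y = if (k < N)%N then proj k x else 0.
  rewrite /y (lin_sum _ _ (@proj_linear k)) -mem_positives_below.
  case: ifPn => kN.
    rewrite (bigD1_seq k)//= proj_inj big1_seq ?addr0// => j /andP[jk _].
    by rewrite proj_inj_neq//; apply/eqP; rewrite eq_sym.
  rewrite big1_seq// => j /andP[_ jN]; rewrite proj_inj_neq// => kj.
  by rewrite kj jN in kN.
exists y; last first.
  apply: (@le_lt_trans _ _ (e / 2)); last first.
    by rewrite ltr_pdivrMr// mulr_natr mulr2n ltrDl.
  apply/(c0_norm _ (ltW e20)) => k; rewrite (linB _ _ (@proj_linear k)) yE.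
  case: ltnP => kN; first by rewrite subrr normr0 ltW.
  by rewrite subr0; exact/ltW/hN.
rewrite /y; elim: (positives_below N) => [|k s IH]; first by rewrite big_nil.
by rewrite big_cons; apply: PD => //; exact: (Pinj (Tagged A (proj k x))).
Qed.

End C0Sum.
Arguments total_c0_inj {R A} S.

Section Comultiplication.
Context (R : realType) (ht : htensors R) (ct : mtensors ht).
Context (O : forall n : posN, cuntz R n) (S : c0sum (fun n => O n)).
Notation C := R[i].
Hypothesis phiP : forall n m, phi_spec (cuntz_phi ct O n m).

(** The component of the comultiplication with values in the summand
    [O_(p.1) (x) O_(p.2)]. *)
Definition theta (p : posN * posN) : O (pmul p.1 p.2) -> ct S S :=
  tens_hom (c0_inj S p.1) (c0_inj S p.2) \o cuntz_phi ct O p.1 p.2.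
Arguments theta : clear implicits.

Lemma theta_hom p : star_hom (theta p).
Proof.
apply: star_hom_comp; last by case: (phiP p.1 p.2).
by apply: tens_hom_hom; exact: c0_inj_hom.
Qed.

Lemma theta_orth p q x y : p <> q -> cmul (theta p x) (theta q y) = 0.
Proof.
move=> pq; rewrite /theta /=; move: (cuntz_phi _ _ _ _ x) (cuntz_phi _ _ _ _ y) => {x y}.
have h r : star_hom (tens_hom (ct := ct) (c0_inj S r.1) (c0_inj S r.2)).
  by apply: tens_hom_hom; exact: c0_inj_hom.
move=> x y; move: x; apply: (bl_eq_mtens (S := cmul^~ _ \o tens_hom _ _) (T := fun=> 0)).
- by apply: bl_comp; [exact: bl_cmull|exact: bl_star_hom].
- exact: bl_cst0.
move=> a b /=; move: y; apply: (bl_eq_mtens (S := cmul _ \o tens_hom _ _) (T := fun=> 0)).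
- by apply: bl_comp; [exact: bl_cmulr|exact: bl_star_hom].
- exact: bl_cst0.
move=> a' b' /=; rewrite !tens_homE; try exact: c0_inj_hom.
rewrite mt_mul; have [e1|/eqP n1] := eqVneq p.1 q.1.
  rewrite [cmul (c0_inj S p.2 _) _]c0_inj_orth.
    exact: (lin0 (mt_linearr (ct S S) _)).
  by move=> e2; apply: pq; rewrite [p]surjective_pairing e1 e2 -surjective_pairing.
by rewrite c0_inj_orth//; exact: (lin0 (mt_linearl (ct S S) _)).
Qed.

(** A finite sum of the components [theta p]; it agrees with the comultiplication
    on elements supported on the products [p.1 p.2] with [p] in [F]. *)
Definition partial_delta (F : seq (posN * posN)) (x : S) : ct S S :=
  \sum_(p <- F) theta p (c0_proj S (pmul p.1 p.2) x).

(** The components have mutually annihilating ranges. *)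
Lemma partial_delta_hom F : uniq F -> star_hom (partial_delta F).
Proof.
move=> uF; have th p := theta_hom p; split.
- move=> a x y; rewrite /partial_delta scaler_sumr -big_split; apply: eq_bigr => p _ /=.
  by rewrite (@proj_linear _ _ S _); case: (th p) => ->.
- move=> x y; rewrite /partial_delta (lin_sum _ _ (cmul_linearl _)).
  rewrite big_seq [RHS]big_seq; apply: eq_bigr => p pF.
  rewrite (lin_sum _ _ (cmul_linearr _)) (bigD1_seq p)//= big1_seq ?addr0.
    by have [_ -> _] := c0_hom S (pmul p.1 p.2); have [_ -> _] := th p.
  by move=> q /andP[qp _]; rewrite theta_orth//; apply/eqP; rewrite eq_sym.
- move=> x; rewrite /partial_delta.
  have starL : {morph (@cstar R (ct S S)) : a b / a + b}.
    by move=> a b; have := cstarP 1 a b; rewrite rmorph1 !scale1r.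
  rewrite (big_morph _ starL (cstar0 _)); apply: eq_bigr => p _.
  by have [_ _ ->] := c0_hom S (pmul p.1 p.2); have [_ _ ->] := th p.
Qed.

Definition supported (F : seq (posN * posN)) (x : S) :=
  uniq F /\ forall p, p \notin F -> c0_proj S (pmul p.1 p.2) x = 0.

Lemma partial_delta_widen F F' x : supported F x -> uniq F' -> {subset F <= F'} ->
  partial_delta F' x = partial_delta F x.
Proof.
move=> [uF F0] uF' FF'; rewrite /partial_delta (bigID (mem F))/= [X in _ + X]big1 ?addr0.
  rewrite -big_filter; apply: perm_big; apply: uniq_perm => //.
    exact: filter_uniq.
  by move=> p; rewrite mem_filter; case: (boolP (p \in F)) => //= /FF'.
move=> p /F0 ->; have [tL _ _] := theta_hom p; exact: lin0.
Qed.

Lemma supported_undup F F' x y : supported F x -> supported F' y ->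
  supported (undup (F ++ F')) x /\ supported (undup (F ++ F')) y.
Proof.
move=> [uF F0] [uF' F0']; split; split; rewrite ?undup_uniq// => p;
  rewrite mem_undup mem_cat negb_or => /andP[pF pF']; [exact: F0|exact: F0'].
Qed.

Lemma partial_delta_eq F F' x : supported F x -> supported F' x ->
  partial_delta F x = partial_delta F' x.
Proof.
move=> sF sF'; pose G := undup (F ++ F').
have uG : uniq G by exact: undup_uniq.
rewrite -(partial_delta_widen sF uG); last by move=> p pF; rewrite mem_undup mem_cat pF.
by rewrite (partial_delta_widen sF' uG)// => p pF; rewrite mem_undup mem_cat pF orbT.
Qed.

Lemma factorizations_finite (n : posN) :
  finite_set [set p : posN * posN | pmul p.1 p.2 = n].
Proof.
apply: (sub_finite_set (B := [set` [seq (i, j) | i <- positives_below n.+1,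
                                                 j <- positives_below n.+1]])).
  move=> [i j] /= ij; apply/allpairsP; exists (i, j).
  rewrite !mem_positives_below !ltnS; split=> //=; rewrite -ij /=.
    by rewrite leq_pmulr// posN_gt0.
  by rewrite leq_pmull// posN_gt0.
exact: finite_seq.
Qed.

Definition factorizations (n : posN) : seq (posN * posN) :=
  finmap.enum_fset (fset_set [set p : posN * posN | pmul p.1 p.2 = n]).

Lemma mem_factorizations n p : (p \in factorizations n) = (pmul p.1 p.2 == n).
Proof.
rewrite /factorizations in_fset_set; last exact: factorizations_finite.
by apply/idP/eqP; rewrite inE.
Qed.

Lemma supported_inj n (x : O n) : supported (factorizations n) (c0_inj S n x).
Proof.
split; first exact: finmap.fset_uniq.
move=> p; rewrite mem_factorizations => /eqP pn.
exact: proj_inj_neq.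
Qed.

Lemma sum_factorizations n (f : posN * posN -> ct S S) :
  \sum_(p \in [set p : posN * posN | pmul p.1 p.2 = n]) f p =
  \sum_(p <- factorizations n) f p.
Proof. by rewrite fsbig_finite//; exact: factorizations_finite. Qed.

(** The finite sums [partial_delta F] are *-homomorphisms, hence contractive. On
    finitely supported elements they do not depend on [F] once it is large
    enough, and such elements are dense: the comultiplication is the continuous
    extension. *)
Lemma cuntz_delta_spec : star_hom (cuntz_delta ct S) /\ forall n (x : O n),
  cuntz_delta ct S (c0_inj S n x) = partial_delta (factorizations n) (c0_inj S n x).
Proof.
suff : exists D : S -> ct S S, star_hom D /\
    forall n (x : O n), D (c0_inj S n x) =
      \sum_(p \in [set p : posN * posN | pmul p.1 p.2 = n])
        tens_hom (c0_inj S p.1) (c0_inj S p.2)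
          (cuntz_phi ct O p.1 p.2 (c0_proj S (pmul p.1 p.2) (c0_inj S n x))).
  move=> /the_mapP[h E]; split=> // n x.
  by rewrite [LHS]E sum_factorizations.
pose G x z := exists2 F, supported F x & z = partial_delta F x.
have Gc F x : supported F x -> `|partial_delta F x| <= `|x|.
  by move=> [uF _]; apply: star_hom_contractive; exact: partial_delta_hom.
have [||||D Db DG] := @graph_extension R S (ct S S) G 1.
- exact: ler01.
- move=> a x z x' z' [F sF ->] [F' sF' ->].
  have [s1 s2] := supported_undup sF sF'; pose F'' := undup (F ++ F').
  exists F''.
    split; first exact: undup_uniq.
    by move=> p pF; rewrite (@proj_linear _ _ S _) s1.2// s2.2// scaler0 addr0.
  have [L _ _] := partial_delta_hom (undup_uniq (F ++ F')).
  by rewrite L (partial_delta_eq sF s1) (partial_delta_eq sF' s2).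
- by move=> x z [F sF ->]; rewrite mul1r Gc.
- move=> x e e0; have [s xs] := total_dense (total_c0_inj S) x e0.
  suff [F sF] : exists F, supported F (lin_comb (fun t : {n : posN & O n} => c0_inj S (tag t) (tagged t)) s).
    by exists (lin_comb (fun t => c0_inj S (tag t) (tagged t)) s), (partial_delta F
      (lin_comb (fun t => c0_inj S (tag t) (tagged t)) s)); split=> //; exists F.
  rewrite /lin_comb; elim: s {xs} => [|[c t] s [F sF]].
    exists [::]; split=> // p _; rewrite big_nil.
    exact: (lin0 (@proj_linear _ _ S _)).
  have [s1 s2] := supported_undup (supported_inj (tagged t)) sF.
  exists (undup (factorizations (tag t) ++ F)); split; first exact: undup_uniq.
  by move=> p pF; rewrite big_cons (@proj_linear _ _ S _) /= s1.2// s2.2// scaler0 addr0.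
have DE F x : supported F x -> D x = partial_delta F x by move=> sF; apply: DG; exists F.
exists D; split; last first.
  move=> n x; rewrite sum_factorizations; exact: DE (supported_inj x).
apply: (star_hom_total (total_c0_inj S)).
- exact: bounded_byW Db.
- move=> [i x] [j y] /=.
  have [s1 s2] := supported_undup (supported_inj x) (supported_inj y).
  rewrite (DE _ _ s1) (DE _ _ s2); have [_ M _] := partial_delta_hom s1.1.
  rewrite -M; apply: DE; split; first exact: undup_uniq.
  move=> p pF; have [_ -> _] := c0_hom S (pmul p.1 p.2).
  by rewrite s1.2// cmul0l.
- move=> [i x] /=; have s1 := supported_inj x.
  rewrite (DE _ _ s1); have [_ _ M] := partial_delta_hom s1.1.
  rewrite -M; apply: DE; split; first exact: s1.1.
  move=> p pF; have [_ _ ->] := c0_hom S (pmul p.1 p.2).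
  by rewrite s1.2// cstar0.
Qed.

End Comultiplication.
Arguments theta {R ht} ct {O} S p _.

(** * Direct sums of Hilbert spaces *)

Section DirectSum.
Context (R : realType) (I : choiceType) (H : I -> hilbertType R) (S : hdsum H).
Notation C := R[i].
Notation inj := (hds_inj S).

Lemma bl_hinj i : bounded_linear (inj i).
Proof. exact/isometric_bl/hds_isometry. Qed.

Lemma total_hinj : total_family (fun t : {i : I & H i} => inj (tag t) (tagged t)).
Proof.
apply: (total_closure (hds_dense S)) => _ [s ->].
exists [seq (1, t) | t <- s]; rewrite /lin_comb big_map.
by apply: eq_bigr => t _; rewrite scale1r.
Qed.

Lemma bl_eq_hdsum (V : normedModType C) (T T' : S -> V) :
  bounded_linear T -> bounded_linear T' ->
  (forall i x, T (inj i x) = T' (inj i x)) -> T =1 T'.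
Proof.
by move=> Tb Tb' h; apply: (bl_eq_total total_hinj Tb Tb') => -[i x]; exact: h.
Qed.

Lemma hdot_sum_orth (K : hilbertType R) (F : seq I) (u : I -> K) : uniq F ->
  (forall i j, i != j -> hdot (u i) (u j) = 0) ->
  hdot (\sum_(i <- F) u i) (\sum_(i <- F) u i) = \sum_(i <- F) hdot (u i) (u i).
Proof.
move=> uF uo; elim: F uF => [|i F IH]; first by rewrite !big_nil hdot0r.
move=> /andP[iF uF]; rewrite !big_cons pythagoras ?IH// hdot_sumr big1_seq// => j /andP[_ jF].
by rewrite uo//; apply: contraNneq iF => ->.
Qed.

(** By Pythagoras, in the source and in the target, the bound [M] common to the
    blocks is a bound on finite sums. *)
Lemma block_operator (K : hilbertType R) (T : forall i, H i -> K) (M : C) :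
  0 <= M -> (forall i, bounded_by M (T i)) ->
  (forall i j x y, i != j -> hdot (T i x) (T j y) = 0) ->
  exists2 V : S -> K, bounded_by M V & forall i x, V (inj i x) = T i x.
Proof.
move=> M0 Tb To.
pose G z w := exists (F : seq I) (f : forall i, H i), [/\ uniq F,
  forall i, i \notin F -> f i = 0,
  z = \sum_(i <- F) inj i (f i) & w = \sum_(i <- F) T i (f i)].
have widen (V : lmodType C) (b : forall i, H i -> V) F F' f :
    (forall i, b i 0 = 0) -> uniq F -> uniq F' -> {subset F <= F'} ->
    (forall i, i \notin F -> f i = 0) ->
    \sum_(i <- F') b i (f i) = \sum_(i <- F) b i (f i).
  move=> b0 uF uF' FF' f0; rewrite (bigID (mem F))/= [X in _ + X]big1 ?addr0.
    rewrite -big_filter; apply: perm_big; apply: uniq_perm => //.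
      exact: filter_uniq.
    by move=> p; rewrite mem_filter; case: (boolP (p \in F)) => //= /FF'.
  by move=> i /f0 ->; rewrite b0.
have inj0 i : inj i 0 = 0 by exact: (lin0 (hds_isometry S i).1).
have T0 i : T i 0 = 0 by exact: (lin0 (Tb i).1).
have GL a x y x' y' : G x y -> G x' y' -> G (a *: x + x') (a *: y + y').
  move=> [F [f [uF f0 -> ->]]] [F' [f' [uF' f0' -> ->]]].
  pose F'' := undup (F ++ F').
  have uF'' : uniq F'' by exact: undup_uniq.
  have s1 : {subset F <= F''} by move=> i h; rewrite mem_undup mem_cat h.
  have s2 : {subset F' <= F''} by move=> i h; rewrite mem_undup mem_cat h orbT.
  exists F'', (fun i => a *: f i + f' i); split=> //.
  - move=> i; rewrite mem_undup mem_cat negb_or => /andP[iF iF'].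
    by rewrite f0// f0'// scaler0 addr0.
  - rewrite -(widen _ inj F F'')// -(widen _ inj F' F'')// scaler_sumr -big_split.
    by apply: eq_bigr => i _ /=; rewrite (hds_isometry S i).1.
  - rewrite -(widen _ T F F'')// -(widen _ T F' F'')// scaler_sumr -big_split.
    by apply: eq_bigr => i _ /=; rewrite (Tb i).1.
have G1 i x : G (inj i x) (T i x).
  exists [:: i], (dfwith (fun k => 0 : H k) i x); split=> //.
  - by move=> j; rewrite inE => ji; rewrite dfwithout// eq_sym.
  - by rewrite big_seq1 dfwithin.
  - by rewrite big_seq1 dfwithin.
have [||||V Vb VG] := @graph_extension R S K G M.
- exact: M0.
- exact: GL.
- move=> z w [F [f [uF f0 -> ->]]]; apply: norm_le_hdot => //.
  rewrite hdot_sum_orth//; last by move=> i j; exact: To.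
  rewrite hdot_sum_orth//; last by move=> i j /eqP ij; exact: hds_orth.
  rewrite mulr_sumr; apply: ler_sum => i _.
  rewrite !hdot_norm (hds_isometry S i).2 -exprMn.
  by rewrite ler_pXn2r// ?nnegrE ?mulr_ge0//; case: (Tb i).
- move=> z e e0; have [_ [s ->] zs] := closureP (hds_dense S) z e0.
  suff [w Gw] : exists w, G (\sum_(p <- s) inj (tag p) (tagged p)) w.
    by exists (\sum_(p <- s) inj (tag p) (tagged p)), w.
  elim: s {zs} => [|[i x] s [w Gw]].
    by exists 0, [::], (fun=> 0); rewrite !big_nil.
  exists (1 *: T i x + w); rewrite big_cons -[X in X + _]scale1r.
  exact: GL.
by exists V => // i x; exact: VG.
Qed.

Lemma block_isometry (K : hilbertType R) (T : forall i, H i -> K) :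
  (forall i, isometric_op (T i)) ->
  (forall i j x y, i != j -> hdot (T i x) (T j y) = 0) ->
  exists2 V : S -> K, isometric_op V & forall i x, V (inj i x) = T i x.
Proof.
move=> Ti To.
have [|V Vi VE] := isometry_extension total_hinj (q := fun t => T (tag t) (tagged t)).
  move=> [i x] [j y] /=; have [ij|ij] := eqVneq i j.
    by case: j / ij y => y; rewrite !isometric_hdot//; exact: hds_isometry.
  by rewrite To// hds_orth//; exact/eqP.
by exists V => // i x; exact: (VE (Tagged H x)).
Qed.

Lemma hdsum_op_spec (T : forall i, H i -> H i) (M : C) : 0 <= M ->
  (forall i, bounded_by M (T i)) ->
  bounded_linear (hdsum_op (S := S) T) /\
  forall i x, hdsum_op (S := S) T (inj i x) = inj i (T i x).
Proof.
move=> M0 Tb; apply: (the_mapP (P := fun V : S -> S => bounded_linear V /\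
  forall i x, V (inj i x) = inj i (T i x))).
have [|||V Vb VE] := @block_operator S (fun i => inj i \o T i) M.
- exact: M0.
- move=> i; have [TL TM] := Tb i; have [jL jN] := hds_isometry S i.
  by split; [exact: lin_comp|move=> x /=; rewrite jN].
- by move=> i j x y /eqP ij; exact: hds_orth.
by exists V; split=> //; exact: bounded_byW Vb.
Qed.

End DirectSum.
Arguments total_hinj {R I H} S.

Section DirectSumRep.
Context (R : realType) (A : posN -> cstarType R) (S : c0sum A).
Context (H : posN -> hilbertType R) (HS : hdsum H) (pi : forall n, A n -> H n -> H n).
Arguments pi : clear implicits.
Hypothesis pi_rep : forall n, is_rep (pi n).

Notation piS := (dsum_rep S HS pi).

Lemma dsum_rep_spec X : bounded_linear (piS X) /\
  forall n x, piS X (hds_inj HS n x) = hds_inj HS n (pi n (c0_proj S n X) x).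
Proof.
apply: (@hdsum_op_spec R _ _ _ _ `|X|) => // n.
split; first exact: bl_linear (rep_bl (pi_rep n) _).
move=> x; apply: le_trans (rep_contractive (pi_rep n) _ _) _.
by apply: ler_wpM2r => //; exact: proj_norm.
Qed.

Lemma dsum_repE X n x : piS X (hds_inj HS n x) = hds_inj HS n (pi n (c0_proj S n X) x).
Proof. exact: (dsum_rep_spec X).2. Qed.

Lemma dsum_rep_rep : is_rep piS.
Proof.
have pb X := (dsum_rep_spec X).1; have jb n := bl_hinj HS n.
split.
- exact: pb.
- move=> x a X Y; move: x; apply: bl_eq_hdsum => //; first exact: bl_lin2.
  move=> n x; rewrite !dsum_repE (@proj_linear _ _ S _).
  by rewrite (rep_linear (pi_rep n) x a) (bl_linear (jb n)).
- move=> X Y; apply: (bl_eq_hdsum (T' := piS X \o piS Y)) => //; first exact: bl_comp.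
  move=> n x; rewrite /= !dsum_repE; have [_ -> _] := c0_hom S n.
  by rewrite (repM (pi_rep n)).
- move=> X x y; have Ib := @bl_id R HS.
  refine (@hdot_total R _ _ _ _ _ _ _ _ (piS (cstar X)) id id (piS X)
    (total_hinj HS) (total_hinj HS) (pb _) Ib Ib (pb _) _ x y) => -[n u] [k v] /=.
  rewrite !dsum_repE; have [_ _ ->] := c0_hom S n.
  have [nk|/eqP nk] := eqVneq n k; last by rewrite !hds_orth.
  case: k / nk v => v; rewrite !(isometric_hdot (hds_isometry HS n)).
  exact: (rep_star (pi_rep n)).
Qed.

End DirectSumRep.

Section DirectSumTensor.
Context (R : realType) (ht : htensors R) (H : posN -> hilbertType R) (HS : hdsum H).
Notation C := R[i].
Notation inj := (hds_inj HS).

Definition inj2 (p : posN * posN) : ht (H p.1) (H p.2) -> ht HS HS :=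
  htens_op (inj p.1) (inj p.2).
Arguments inj2 : clear implicits.

Lemma inj2_isometry p : isometric_op (inj2 p).
Proof. by apply: htens_op_isometric; exact: hds_isometry. Qed.

Lemma inj2E a b x y : inj2 (a, b) (x ⊗[ht] y) = inj a x ⊗[ht] inj b y.
Proof. by rewrite /inj2 htens_opE//; exact: bl_hinj. Qed.

Lemma inj2_orth p q u v : p <> q -> hdot (inj2 p u) (inj2 q v) = 0.
Proof.
case: p q u v => a b [a' b'] u v pq.
have Z k := bl_cst0 (ht (H k.1) (H k.2)) HS.
rewrite -(hdot0r (0 : HS)).
refine (@hdot_total R _ _ _ _ _ _ _ _ (inj2 (a, b)) (inj2 (a', b')) (fun=> 0) (fun=> 0)
    (total_elementary (ht (H a) (H b))) (total_elementary (ht (H a') (H b')))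
    (isometric_bl (inj2_isometry _)) (isometric_bl (inj2_isometry _))
    (Z (a, b)) (Z (a', b')) _ u v) => -[x y] [x' y'].
rewrite /elementary !inj2E ht_dot hdot0r /=.
have [aa|/eqP aa] := eqVneq a a'; last by rewrite hds_orth// mul0r.
rewrite [hdot (inj b y) _]hds_orth ?mulr0// => bb.
by apply: pq; rewrite aa bb.
Qed.

Lemma total_inj2 : total_family (fun t : {p : posN * posN & ht (H p.1) (H p.2)} =>
  inj2 (tag t) (tagged t)).
Proof.
move=> P Pc h; have T := total_tens (ht HS HS) (total_hinj HS) (total_hinj HS).
apply: (T P Pc).
move=> [[a x] [b y]] /=; rewrite -inj2E.
exact: (h (Tagged (fun p => ht (H p.1) (H p.2) : Type) (x ⊗[ht] y : ht (H (a, b).1) (H (a, b).2)))).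
Qed.

Lemma inj2_dense : closure [set z : ht HS HS |
  exists s : seq {p : posN * posN & ht (H p.1) (H p.2)},
    z = \sum_(t <- s) inj2 (tag t) (tagged t)] = setT.
Proof.
apply/seteqP; split=> // z _ B /nbhs_ballP[e /= e0 eB].
have [s zs] := total_dense total_inj2 z e0.
exists (lin_comb (fun t => inj2 (tag t) (tagged t)) s); split; last first.
  by apply: eB; rewrite -ball_normE.
exists [seq Tagged (fun p => ht (H p.1) (H p.2) : Type)
  (t.1 *: tagged t.2 : ht (H (tag t.2).1) (H (tag t.2).2))
  | t : C * {p : posN * posN & ht (H p.1) (H p.2)} <- s].
rewrite /lin_comb big_map; apply: eq_bigr => t _.
by rewrite (linZ _ _ (inj2_isometry _).1).
Qed.

(** The square of a direct sum is the direct sum of the products of the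
    summands: operators on it may be prescribed block by block. *)
Definition hdsum2 : hdsum (fun p : posN * posN => ht (H p.1) (H p.2)) :=
  @HDSum R _ (fun p : posN * posN => ht (H p.1) (H p.2)) (ht HS HS)
    inj2 inj2_isometry (fun p q u v => @inj2_orth p q u v) inj2_dense.

Lemma inj2_eq0 p u : inj2 p u = 0 -> u = 0.
Proof.
move=> h; have [_ N] := inj2_isometry p; apply/eqP.
by rewrite -normr_eq0 -N h normr0.
Qed.

End DirectSumTensor.
Arguments inj2 {R} ht {H} HS p _.

Lemma pmul_inj (b : posN) : injective (pmul^~ b).
Proof.
move=> n n' /(congr1 (@posN_val)) /= /eqP; rewrite eqn_pmul2r ?posN_gt0// => /eqP.
exact: val_inj.
Qed.

Lemma pmul_dvd (a b : posN) : (b %| a)%N -> exists n, a = pmul n b.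
Proof.
move=> /dvdnP[k ak]; have k0 : (0 < k)%N.
  by case: k ak => // a0; have := posN_gt0 a; rewrite a0.
by exists (PosN k0); apply: val_inj.
Qed.

(** * The operator [W] on the direct sum *)

Section DirectSumW.
Context (R : realType) (ht : htensors R) (H : posN -> hilbertType R) (HS : hdsum H).
Notation C := R[i].
Notation inj := (hds_inj HS).
Notation J := (inj2 ht HS).

Lemma pair_cases (p : posN * posN) :
  (exists n m, p = (pmul n m, m)) \/ ~~ (p.2 %| p.1)%N.
Proof.
case: p => a b; case: (boolP (b %| a)%N) => [/pmul_dvd[n ->]|]; last by right.
by left; exists n, b.
Qed.

Lemma dvd_pmul (n m : posN) : (m %| pmul n m)%N.
Proof. exact: dvdn_mull. Qed.

Lemma pair_inj (n m n' m' : posN) : (pmul n m, m) = (pmul n' m', m') -> (n, m) = (n', m').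
Proof.
move=> h; have em : m = m' := congr1 snd h; move: em h => <- h.
by rewrite (@pmul_inj m n n' (congr1 fst h)).
Qed.

Context (W : forall n m, ht (H (pmul n m)) (H m) -> ht (H n) (H m)).
Arguments W : clear implicits.
Hypothesis Wb : forall n m, bounded_by 1 (W n m).

(** The block is described through elements of [HS (x) HS] so as to avoid
    transporting [W] along an equation [p = (nm, m)]. *)
Lemma block_W p : exists T : ht (H p.1) (H p.2) -> ht HS HS,
  [/\ bounded_by 1 T,
   forall n m u u', (pmul n m, m) = p -> J (pmul n m, m) u = J p u' -> T u' = J (n, m) (W n m u) &
   ~~ (p.2 %| p.1)%N -> forall u, T u = 0].
Proof.
have [[n [m ->]]|np] := pair_cases p.
  exists (fun u => J (n, m) (W n m u)); split.
  - have [L N] := inj2_isometry ht HS (n, m); have [WL WN] := Wb n m.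
    by split; [exact: (lin_comp WL L)|move=> u; rewrite N].
  - move=> n' m' u u' /pair_inj[en em]; move: en em u => -> -> u e.
    have [L _] := inj2_isometry ht HS (pmul n m, m).
    congr (J (n, m) (W n m _)); apply/esym/eqP; rewrite -subr_eq0; apply/eqP.
    by apply: (@inj2_eq0 _ ht H HS (pmul n m, m)); rewrite (linB _ _ L) e subrr.
  - by rewrite /= dvd_pmul.
exists (fun=> 0); split=> //.
- by split; [exact: lin_cst0|move=> x; rewrite normr0 mul1r].
- by move=> n m u u' e; case: p / e np u' => /=; rewrite dvd_pmul.
Qed.

(** The blocks [W n m] act between mutually orthogonal summands: [(nm, m)]
    determines [(n, m)], and conversely. *)
Lemma dsum_W_spec : [/\ bounded_by 1 (dsum_W HS W),
  forall n m u, dsum_W HS W (J (pmul n m, m) u) = J (n, m) (W n m u) &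
  forall a b : posN, ~~ (b %| a)%N -> forall u, dsum_W HS W (J (a, b) u) = 0].
Proof.
pose T p := sval (cid (block_W p)).
have Tb p : bounded_by 1 (T p) by rewrite /T; case: cid => ? [].
have TE n m u : T (pmul n m, m) u = J (n, m) (W n m u).
  by rewrite /T; case: cid => T' [_ h _] /=; exact: h.
have T0 (p : posN * posN) u : ~~ (p.2 %| p.1)%N -> T p u = 0.
  by rewrite /T; case: cid => T' [_ _ h] /= /h.
have To (p q : posN * posN) u v : p != q -> hdot (T p u) (T q v) = 0.
  move=> /eqP pq; have [[n [m e]]|np] := pair_cases p; last by rewrite T0// hdot0l.
  have [[n' [m' e']]|nq] := pair_cases q; last by rewrite [T q v]T0// hdot0r.
  move: pq u v; rewrite {}e {}e' => pq u v; rewrite !TE inj2_orth// => nm.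
  by case: nm pq => -> ->.
have [V Vb VE] := @block_operator R _ _ (hdsum2 ht HS) (ht HS HS) T 1 ler01 Tb To.
have spec : (forall n m u, V (htens_op (inj (pmul n m)) (inj m) u) =
                   htens_op (inj n) (inj m) (W n m u)) /\
    (forall a b : posN, ~~ (b %| a)%N ->
       forall u, V (htens_op (inj a) (inj b) u) = 0).
  split=> [n m u|a b ab u]; first by rewrite [LHS](VE (pmul n m, m)) TE.
  by rewrite [LHS](VE (a, b)) T0.
have : exists V : ht HS HS -> ht HS HS, bounded_linear V /\
   ((forall n m u, V (htens_op (inj (pmul n m)) (inj m) u) =
                   htens_op (inj n) (inj m) (W n m u)) /\
    (forall a b : posN, ~~ (b %| a)%N ->
       forall u, V (htens_op (inj a) (inj b) u) = 0)).
  by exists V; split=> //; exact: bounded_byW Vb.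
move=> /the_mapP[Db [D1 D2]]; split.
- suff DV : dsum_W HS W =1 V by split; [exact: bl_linear Db|move=> x; rewrite DV; case: Vb].
  apply: (bl_eq_hdsum (S := hdsum2 ht HS) Db (bounded_byW Vb)) => p.
  have [[n [m ->]]|] := pair_cases p => [u|].
    by rewrite [LHS]D1 [RHS]spec.1.
  by case: p => a b np u; rewrite [LHS]D2// [RHS]spec.2.
- exact: D1.
- exact: D2.
Qed.

Notation V := (dsum_W HS W).

Lemma dsum_W_bounded : bounded_by 1 V. Proof. by case: dsum_W_spec. Qed.
Lemma bl_dsum_W : bounded_linear V. Proof. exact: bounded_byW dsum_W_bounded. Qed.
Lemma dsum_WE n m u : V (J (pmul n m, m) u) = J (n, m) (W n m u).
Proof. by case: dsum_W_spec. Qed.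
Lemma dsum_W0 (a b : posN) u : ~~ (b %| a)%N -> V (J (a, b) u) = 0.
Proof. by move=> ab; have [_ _ ->] := dsum_W_spec. Qed.

Lemma dsum_W_orth p q u v : p != q -> hdot (V (J p u)) (V (J q v)) = 0.
Proof.
move=> /eqP pq; have [[n [m e]]|] := pair_cases p; last first.
  by case: p u {pq} => a b u ab; rewrite dsum_W0// hdot0l.
have [[n' [m' e']]|] := pair_cases q; last first.
  by case: q v {pq} => a b v ab; rewrite [V (J (a, b) v)]dsum_W0// hdot0r.
move: pq u v; rewrite {}e {}e' => pq u v; rewrite !dsum_WE inj2_orth// => nm.
by case: nm pq => -> ->.
Qed.

Lemma dsum_W_partial (Q : forall n m, ht (H (pmul n m)) (H m) -> ht (H (pmul n m)) (H m)) :
  (forall n m, bounded_by 1 (@Q n m)) ->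
  (forall n m u v, hdot u (@Q n m v) = hdot (W n m u) (W n m v)) ->
  (forall n m u, W n m (@Q n m u) = W n m u) -> partial_isometry V.
Proof.
move=> Qb Qdot WQ; have bV := bl_dsum_W.
have blockQ p : exists Qp : ht (H p.1) (H p.2) -> ht (H p.1) (H p.2),
    [/\ bounded_by 1 Qp, forall u v, hdot u (Qp v) = hdot (V (J p u)) (V (J p v)) &
        forall u, V (J p (Qp u)) = V (J p u)].
  have [[n [m ->]]|] := pair_cases p.
    exists (@Q n m); split.
    - exact: (Qb n m).
    - by move=> u v; rewrite !dsum_WE (isometric_hdot (inj2_isometry ht HS (n, m))) Qdot.
    - by move=> u; rewrite !dsum_WE WQ.
  case: p => a b /= ab; exists (fun=> 0); split.
  - by split; [exact: lin_cst0|move=> x; rewrite normr0 mul1r].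
  - by move=> u v; rewrite !dsum_W0// !hdot0r.
  - by move=> u; rewrite !dsum_W0.
pose Qp p := sval (cid (blockQ p)).
have QpP p : [/\ bounded_by 1 (Qp p),
    forall u v, hdot u (Qp p v) = hdot (V (J p u)) (V (J p v)) &
    forall u, V (J p (Qp p u)) = V (J p u)] by rewrite /Qp; case: cid.
have JL p : isometric_op (J p) by exact: inj2_isometry.
have [|||Qt Qtb QtE] := @block_operator R _ _ (hdsum2 ht HS) (ht HS HS)
   (fun p => J p \o Qp p) 1.
- exact: ler01.
- move=> p; have [[QL QN] _ _] := QpP p.
  by split; [exact: (lin_comp QL (JL p).1)|move=> x /=; rewrite (JL p).2].
- by move=> p q u v /eqP pq; exact: inj2_orth.
have bQ := bounded_byW Qtb.
apply: (partial_isometry_criterion (Q := Qt) bV).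
  move=> x y; have tot := total_hinj (hdsum2 ht HS).
  refine (@hdot_total R _ _ _ _ _ _ _ _ id Qt V V tot tot (@bl_id _ _) bQ bV bV _ x y).
  move=> [p u] [q v] /=; rewrite QtE /=.
  have [pq|pq] := eqVneq p q; last by rewrite dsum_W_orth// inj2_orth//; exact/eqP.
  case: q / pq v => v; rewrite (isometric_hdot (JL p)).
  by have [_ -> _] := QpP p.
apply: (bl_eq_hdsum (S := hdsum2 ht HS) (T := V \o Qt) (T' := V)) => //; first exact: bl_comp.
by move=> p u /=; rewrite QtE /=; have [_ _ ->] := QpP p.
Qed.

Lemma dsum_W_coisometry :
  (forall n m, exists2 S, isometric_op S & forall v, W n m (S v) = v) ->
  isometric_op (adjoint V).
Proof.
move=> ex.
pose S n m := sval (cid2 (ex n m)).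
have Si n m : isometric_op (S n m) by rewrite /S; case: cid2.
have WS n m v : W n m (S n m v) = v by rewrite /S; case: cid2.
have [||St Sti StE] := @block_isometry R _ _ (hdsum2 ht HS) (ht HS HS)
   (fun p u => J (pmul p.1 p.2, p.2) (S p.1 p.2 u)).
- move=> p; exact: (isometric_comp (inj2_isometry ht HS (pmul p.1 p.2, p.2)) (Si p.1 p.2)).
- move=> [a b] [a' b'] u v /eqP pq; rewrite inj2_orth// => /pair_inj.
  exact: pq.
apply: (adjoint_isometric dsum_W_bounded Sti).
apply: (bl_eq_hdsum (S := hdsum2 ht HS) (T := V \o St) (T' := id)).
- exact: bl_comp bl_dsum_W (isometric_bl Sti).
- exact: bl_id.
by move=> [a b] u /=; rewrite StE dsum_WE WS.
Qed.

(** ** Legs of operators on the direct sum *)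

Definition inj3 a b c : ht (ht (H a) (H b)) (H c) -> ht (ht HS HS) HS :=
  htens_op (J (a, b)) (inj c).
Arguments inj3 : clear implicits.

Lemma bl_inj2 p : bounded_linear (J p).
Proof. exact/isometric_bl/inj2_isometry. Qed.

Lemma bl_inj3 a b c : bounded_linear (inj3 a b c).
Proof. by apply: bl_htens_op; [exact: (bl_inj2 (a, b))|exact: bl_hinj]. Qed.

Lemma inj3E a b c u z : inj3 a b c (u ⊗[ht] z) = J (a, b) u ⊗[ht] inj c z.
Proof. by rewrite /inj3 htens_opE; [|exact: (bl_inj2 (a, b))|exact: bl_hinj]. Qed.

Lemma total_inj3 : total_family
  (fun t : {p : posN * posN * posN & ht (ht (H p.1.1) (H p.1.2)) (H p.2)} =>
     inj3 _ _ _ (tagged t)).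
Proof.
have T := total_tens (ht (ht HS HS) HS) (total_hinj (hdsum2 ht HS)) (total_hinj HS).
move=> P Pc h; apply: (T P Pc) => -[[[a b] u] [c z]] /=; rewrite -inj3E.
exact: (h (Tagged (fun p : posN * posN * posN =>
   ht (ht (H p.1.1) (H p.1.2)) (H p.2) : Type) (i := (a, b, c)) (u ⊗[ht] z))).
Qed.

Lemma leg12_inj3 (X : ht HS HS -> ht HS HS) a b a' b' c
    (T : ht (H a) (H b) -> ht (H a') (H b')) :
  bounded_linear X -> bounded_linear T ->
  (forall u, X (J (a, b) u) = J (a', b') (T u)) ->
  forall u, leg12 X (inj3 a b c u) = inj3 a' b' c (leg12 T u).
Proof.
move=> Xb Tb XT; have j3 := bl_inj3.
apply: (bl_eq_tens (S := leg12 X \o inj3 a b c) (T := inj3 a' b' c \o leg12 T)).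
- by apply: bl_comp => //; exact: bl_leg12.
- by apply: bl_comp => //; exact: bl_leg12.
by move=> u z /=; rewrite inj3E !leg12E// inj3E XT.
Qed.

Lemma swap_inj a b c v (y : H b) :
  htens_swap23 (J (a, c) v ⊗[ht] inj b y) = inj3 a b c (htens_swap23 (v ⊗[ht] y)).
Proof.
have j3 := bl_inj3; move: v.
apply: (bl_eq_tens (S := @htens_swap23 R ht HS HS HS \o ((ht_map _)^~ (inj b y) \o J (a, c)))
  (T := inj3 a b c \o (@htens_swap23 R ht (H a) (H c) (H b) \o (ht_map _)^~ y))).
- by apply: (bl_comp (bl_swap _ _ _ _)); apply: bl_comp; [exact: bl_tensl|exact: bl_inj2].
- by apply: (bl_comp (j3 _ _ _)); apply: bl_comp; [exact: bl_swap|exact: bl_tensl].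
by move=> x z /=; rewrite inj2E !htens_swapE inj3E inj2E.
Qed.

Lemma assocV_inj a b c (x : H a) v :
  htens_assocV (inj a x ⊗[ht] J (b, c) v) = inj3 a b c (htens_assocV (x ⊗[ht] v)).
Proof.
have j3 := bl_inj3; move: v.
apply: (bl_eq_tens (S := @htens_assocV R ht HS HS HS \o (ht_map _ (inj a x) \o J (b, c)))
  (T := inj3 a b c \o (@htens_assocV R ht (H a) (H b) (H c) \o ht_map _ x))).
- by apply: (bl_comp (bl_assocV _ _ _ _)); apply: bl_comp; [exact: bl_tensr|exact: bl_inj2].
- by apply: (bl_comp (j3 _ _ _)); apply: bl_comp; [exact: bl_assocV|exact: bl_tensr].
by move=> y z /=; rewrite inj2E !htens_assocVE inj3E inj2E.
Qed.

Lemma leg13_inj3 (X : ht HS HS -> ht HS HS) a b c a' c'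
    (T : ht (H a) (H c) -> ht (H a') (H c')) :
  bounded_linear X -> bounded_linear T ->
  (forall u, X (J (a, c) u) = J (a', c') (T u)) ->
  forall u, leg13 X (inj3 a b c u) = inj3 a' b c' (leg13 T u).
Proof.
move=> Xb Tb XT; have j3 := bl_inj3.
apply: (bl_eq_tens3 (S := leg13 X \o inj3 a b c) (T := inj3 a' b c' \o leg13 T)).
- by apply: bl_comp => //; exact: bl_leg13.
- by apply: bl_comp => //; exact: bl_leg13.
move=> x y z /=; rewrite inj3E inj2E !leg13E//.
by rewrite -inj2E XT swap_inj.
Qed.

Lemma leg23_inj3 (X : ht HS HS -> ht HS HS) a b c b' c'
    (T : ht (H b) (H c) -> ht (H b') (H c')) :
  bounded_linear X -> bounded_linear T ->
  (forall u, X (J (b, c) u) = J (b', c') (T u)) ->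
  forall u, leg23 X (inj3 a b c u) = inj3 a b' c' (leg23 T u).
Proof.
move=> Xb Tb XT; have j3 := bl_inj3.
apply: (bl_eq_tens3 (S := leg23 X \o inj3 a b c) (T := inj3 a b' c' \o leg23 T)).
- by apply: bl_comp => //; exact: bl_leg23.
- by apply: bl_comp => //; exact: bl_leg23.
move=> x y z /=; rewrite inj3E inj2E !leg23E//.
by rewrite -inj2E XT assocV_inj.
Qed.

Section Vanishing.
Context (X : ht HS HS -> ht HS HS) (a b c : posN).
Hypothesis Xb : bounded_linear X.

Lemma leg12_inj3_0 : (forall u, X (J (a, b) u) = 0) ->
  forall u, leg12 X (inj3 a b c u) = 0.
Proof.
move=> X0; apply: (bl_eq_tens (S := leg12 X \o inj3 a b c) (T := fun=> 0)).
- by apply: bl_comp; [exact: bl_leg12|exact: bl_inj3].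
- exact: bl_cst0.
by move=> u z /=; rewrite inj3E leg12E// X0 tens0l.
Qed.

Lemma leg13_inj3_0 : (forall u, X (J (a, c) u) = 0) ->
  forall u, leg13 X (inj3 a b c u) = 0.
Proof.
move=> X0; apply: (bl_eq_tens3 (S := leg13 X \o inj3 a b c) (T := fun=> 0)).
- by apply: bl_comp; [exact: bl_leg13|exact: bl_inj3].
- exact: bl_cst0.
move=> x y z /=; rewrite inj3E inj2E leg13E// -inj2E X0 tens0l.
by rewrite (lin0 (bl_linear (bl_swap _ _ _ _))).
Qed.

Lemma leg23_inj3_0 : (forall u, X (J (b, c) u) = 0) ->
  forall u, leg23 X (inj3 a b c u) = 0.
Proof.
move=> X0; apply: (bl_eq_tens3 (S := leg23 X \o inj3 a b c) (T := fun=> 0)).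
- by apply: bl_comp; [exact: bl_leg23|exact: bl_inj3].
- exact: bl_cst0.
move=> x y z /=; rewrite inj3E inj2E leg23E// -inj2E X0 tens0r.
by rewrite (lin0 (bl_linear (bl_assocV _ _ _ _))).
Qed.

End Vanishing.

Lemma dsum_W_transport n m k (e : pmul n m = k) :
  bounded_linear (ecast k (ht (H k) (H m) -> ht (H n) (H m)) e (W n m)) /\
  forall u, V (J (k, m) u) = J (n, m) (ecast k (ht (H k) (H m) -> ht (H n) (H m)) e (W n m) u).
Proof. by case: k / e; split; [exact: bounded_byW (Wb n m)|exact: dsum_WE]. Qed.

(** On the summand [H_a (x) H_b (x) H_c], both sides vanish unless [c] divides [b]
    and [b] divides [a]: on the left, if [b = m c] and [a = k c] with [m]
    dividing [k], then [b] divides [a]. In the remaining case the summand is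
    [H_(nml) (x) H_(ml) (x) H_l], and the equation is that of the blocks. *)
Lemma dsum_W_pentagonal :
  (forall n m l,
    leg12 (W n m) \o leg13 (W (pmul n m) l) \o leg23 (W m l)
      =1 leg23 (W m l) \o
         leg12 (ecast k (ht (H k) (H (pmul m l)) -> ht (H n) (H (pmul m l)))
                  (pmulA n m l) (W n (pmul m l)))) ->
  pentagonal V.
Proof.
move=> pent; have bV := bl_dsum_W; have bW n m := bounded_byW (Wb n m).
have L12 := bl_leg12 HS bV; have L13 := bl_leg13 HS bV; have L23 := bl_leg23 HS bV.
apply: (bl_eq_total total_inj3).
- exact: (bl_comp (bl_comp L12 L13) L23).
- exact: (bl_comp L23 L12).
move=> [[[a b] c] u] /=; rewrite /= in u *.
have [[m [c' [eb ec]]]|/= nbc] := pair_cases (b, c); last first.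
  rewrite leg23_inj3_0//; last by move=> v; exact: dsum_W0.
  rewrite (lin0 (bl_linear L13)) (lin0 (bl_linear L12)).
  have [[n [b' [ea eb]]]|/= nab] := pair_cases (a, b); last first.
    rewrite leg12_inj3_0//; last by move=> v; exact: dsum_W0.
    by rewrite (lin0 (bl_linear L23)).
  subst b' a.
  rewrite (leg12_inj3 (T := W n b))//; last exact: dsum_WE.
  by rewrite leg23_inj3_0// => v; exact: dsum_W0.
subst c' b.
rewrite (leg23_inj3 (T := W m c))//; last exact: dsum_WE.
have [[n [b' [ea eb]]]|/= nab] := pair_cases (a, pmul m c); last first.
  rewrite [in RHS]leg12_inj3_0//; last by move=> v; exact: dsum_W0.
  rewrite (lin0 (bl_linear L23)).
  have [[k [c' [ea ec]]]|/= nac] := pair_cases (a, c); last first.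
    rewrite leg13_inj3_0//; last by move=> v; exact: dsum_W0.
    by rewrite (lin0 (bl_linear L12)).
  subst c' a.
  rewrite (leg13_inj3 (T := W k c))//; last exact: dsum_WE.
  rewrite leg12_inj3_0// => v; apply: dsum_W0; apply: contra nab => mk.
  by rewrite /= dvdn_pmul2r ?posN_gt0.
subst b'; rewrite pmulA in ea; subst a.
rewrite (leg13_inj3 (T := W (pmul n m) c))//; last exact: dsum_WE.
rewrite (leg12_inj3 (T := W n m))//; last exact: dsum_WE.
have [Tb TE] := dsum_W_transport (pmulA n m c).
rewrite (leg12_inj3 bV Tb TE) (leg23_inj3 (T := W m c))//; last exact: dsum_WE.
by have := pent n m c u => /= ->.
Qed.

End DirectSumW.

(** * Covariance *)

Section Covariance.
Context (R : realType) (ht : htensors R) (ct : mtensors ht).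
Context (O : forall n : posN, cuntz R n) (S : c0sum (fun n => O n)).
Context (H : posN -> hilbertType R) (HS : hdsum H) (pi : forall n, O n -> H n -> H n).
Arguments pi : clear implicits.
Hypotheses (phiP : forall n m, phi_spec (cuntz_phi ct O n m))
  (pi_rep : forall n, is_rep (pi n)).
Notation piS := (dsum_rep S HS pi).
Notation J := (inj2 ht HS).

Lemma piS_rep : is_rep piS. Proof. exact: dsum_rep_rep. Qed.

Lemma tens_rep_hom (A1 A2 B1 B2 : cstarType R) (K1 K2 : hilbertType R)
    (f1 : A1 -> B1) (f2 : A2 -> B2) (r1 : B1 -> K1 -> K1) (r2 : B2 -> K2 -> K2) :
  star_hom f1 -> star_hom f2 -> is_rep r1 -> is_rep r2 ->
  forall (z : ct A1 A2) u,
  tens_rep r1 r2 (tens_hom f1 f2 z) u = tens_rep (ht := ht) (r1 \o f1) (r2 \o f2) z u.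
Proof.
move=> h1 h2 s1 s2 z u.
have rB := tens_rep_rep ct s1 s2.
have rA := tens_rep_rep ct (rep_star_hom h1 s1) (rep_star_hom h2 s2).
move: z; apply: (bl_eq_mtens (S := (tens_rep r1 r2)^~ u \o tens_hom f1 f2)).
- by apply: bl_comp; [exact: (rep_bl_alg rB)|exact/bl_star_hom/tens_hom_hom].
- exact: (rep_bl_alg rA).
move=> a b /=; move: u; apply: bl_eq_tens; [exact: (rep_bl rB)|exact: (rep_bl rA)|].
move=> x y; rewrite tens_homE// !tens_repE//; exact: rep_star_hom.
Qed.

Lemma theta_block n b y v :
  tens_rep piS piS (theta ct S (n, b) y) (J (n, b) v) =
  J (n, b) (rep_phi ct O (pi n) (pi b) y v).
Proof.
rewrite /theta /= tens_rep_hom; try exact: piS_rep; try exact: c0_inj_hom.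
have hn := rep_star_hom (c0_inj_hom S n) piS_rep.
have hb := rep_star_hom (c0_inj_hom S b) piS_rep.
apply/esym.
apply: (tens_rep_intertwine (pi_rep n) (pi_rep b) hn hb (bl_hinj HS n) (bl_hinj HS b)).
- by move=> a x /=; rewrite dsum_repE// proj_inj.
- by move=> a x /=; rewrite dsum_repE// proj_inj.
Qed.

(** One of the two factors [pi (c0_inj a)] acts on a summand on which it is zero. *)
Lemma theta_block0 (p q : posN * posN) y v : p <> q ->
  tens_rep piS piS (theta ct S p y) (J q v) = 0.
Proof.
move=> pq; rewrite /theta /= tens_rep_hom; try exact: piS_rep; try exact: c0_inj_hom.
have h1 := rep_star_hom (c0_inj_hom S p.1) piS_rep.
have h2 := rep_star_hom (c0_inj_hom S p.2) piS_rep.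
have rB := tens_rep_rep ct h1 h2.
move: (cuntz_phi _ _ _ _ _); apply: (bl_eq_mtens (S := (tens_rep _ _)^~ _) (T := fun=> 0)).
- exact: (rep_bl_alg rB).
- exact: bl_cst0.
move=> a b; move: v; apply: (bl_eq_tens (S := tens_rep _ _ _ \o J q) (T := fun=> 0)).
- by apply: (bl_comp (rep_bl rB _)); exact/isometric_bl/inj2_isometry.
- exact: bl_cst0.
case: q pq => c d pq x y' /=; rewrite inj2E tens_repE//= !dsum_repE//.
have [e1|/eqP n1] := eqVneq c p.1; last first.
  by rewrite (proj_inj_neq S _ n1) (lin0 (rep_linear (pi_rep c) x)) (lin0 (hds_isometry HS c).1) tens0l.
rewrite [c0_proj S d _]proj_inj_neq.
  by rewrite (lin0 (rep_linear (pi_rep d) y')) (lin0 (hds_isometry HS d).1) tens0r.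
by move=> e2; apply: pq; rewrite e1 e2 -surjective_pairing.
Qed.

(** Among the components of [Delta X], only [theta (n, b)] acts non trivially on
    the summand [H_n (x) H_b]. *)
Lemma delta_block n b X v :
  tens_rep piS piS (cuntz_delta ct S X) (J (n, b) v) =
  J (n, b) (rep_phi ct O (pi n) (pi b) (c0_proj S (pmul n b) X) v).
Proof.
have [Dh DE] := cuntz_delta_spec S phiP.
have rS := tens_rep_rep ct piS_rep piS_rep.
have rp := rep_phi_rep phiP (pi_rep n) (pi_rep b).
move: X; apply: (bl_eq_total (total_c0_inj S)
  (S := (tens_rep piS piS)^~ (J (n, b) v) \o cuntz_delta ct S)
  (T := J (n, b) \o ((rep_phi ct O (pi n) (pi b))^~ v \o c0_proj S (pmul n b)))).
- by apply: bl_comp; [exact: (rep_bl_alg rS)|exact: bl_star_hom].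
- apply: bl_comp; first exact/isometric_bl/inj2_isometry.
  by apply: bl_comp; [exact: (rep_bl_alg rp)|exact: bl_proj].
move=> [k x] /=; rewrite DE /partial_delta (lin_sum _ _ (rep_linear rS _)).
set X := c0_inj S k x; set t := (X in _ = X).
have term p : tens_rep piS piS (theta ct S p (c0_proj S (pmul p.1 p.2) X)) (J (n, b) v) =
    if p == (n, b) then t else 0.
  by case: eqP => [->|pq]; [exact: theta_block|exact: theta_block0].
rewrite (eq_bigr _ (fun p _ => term p)).
have [nb|nb] := eqVneq (pmul n b) k.
  rewrite (bigD1_seq (n, b)) ?mem_factorizations ?nb ?finmap.fset_uniq//= eqxx big1 ?addr0//.
  by move=> p /negPf ->.
rewrite big1_seq; last first.
  move=> p /andP[_]; rewrite mem_factorizations => /eqP pk.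
  by case: eqP => // pnb; move: nb; rewrite -pk pnb eqxx.
rewrite /t /X proj_inj_neq; last exact/eqP.
by rewrite (lin0 (rep_linear rp v)) (lin0 (inj2_isometry ht HS (n, b)).1).
Qed.

Lemma dsum_W_intertwine (W : forall n m, ht (H (pmul n m)) (H m) -> ht (H n) (H m)) :
  (forall n m, bounded_by 1 (@W n m)) ->
  (forall n m X, @W n m \o htens_op (pi (pmul n m) X) id
     =1 rep_phi ct O (pi n) (pi m) X \o @W n m) ->
  forall X, dsum_W HS W \o htens_op (piS X) id =1
    tens_rep piS piS (cuntz_delta ct S X) \o dsum_W HS W.
Proof.
move=> Wb WI X.
have bV := bl_dsum_W HS Wb; have bX := rep_bl piS_rep X; have Ib := @bl_id R HS.
have rS := tens_rep_rep ct piS_rep piS_rep.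
have opb : bounded_linear (htens_op (ht := ht) (piS X) (id : HS -> HS)) by exact: bl_htens_op.
have block a b u : htens_op (piS X) id (J (a, b) u) =
    J (a, b) (htens_op (pi a (c0_proj S a X)) id u).
  have ba := rep_bl (pi_rep a) (c0_proj S a X); have Ibb := @bl_id R (H b).
  have Jb := isometric_bl (inj2_isometry ht HS (a, b)).
  move: u; apply: (bl_eq_tens (S := htens_op (piS X) id \o J (a, b)) (T := J (a, b) \o htens_op _ id)).
  - exact: bl_comp.
  - by apply: (bl_comp Jb); exact: bl_htens_op.
  by move=> x y /=; rewrite inj2E !htens_opE// inj2E dsum_repE.
apply: (bl_eq_hdsum (S := hdsum2 ht HS)).
- exact: bl_comp.
- by apply: (bl_comp _ bV); exact: (rep_bl rS).
move=> [a b] u; rewrite /comp /= block.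
have [[n [m [ea eb]]]|/= ab] := pair_cases (a, b); last first.
  by rewrite !dsum_W0// (lin0 (bl_linear (rep_bl rS _))).
subst b a; rewrite !dsum_WE// delta_block; congr (J _ _).
exact: WI.
Qed.

End Covariance.

Theorem theorem1p6 (R : realType) (ht : htensors R) (ct : mtensors ht)
  (O : forall n : posN, cuntz R n) (Ostar : c0sum (fun n => O n))
  (w : forall n, O n -> R[i])
  (H : posN -> hilbertType R) (HH : hdsum H)
  (pi : forall n, O n -> H n -> H n) (Omega : forall n, H n)
  (w_state : forall n, is_state (w n))
  (w_GNS : forall n, is_GNS (w n) (pi n) (Omega n))
  (w_phi : forall n m, state_phi ct O (w n) (w m) =1 w (pmul n m)) :
  exists W : forall n m, ht (H (pmul n m)) (H m) -> ht (H n) (H m),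
  [/\ forall n m, partial_isometry (W n m) /\ (exists u, W n m u <> 0),
      forall n m X,
        W n m \o htens_op (pi (pmul n m) X) id
          =1 rep_phi ct O (pi n) (pi m) X \o W n m,
      forall n m,
        cyclic_vector (rep_phi ct O (pi n) (pi m)) (Omega n ⊗[ht] Omega m) ->
        isometric_op (adjoint (W n m)),
      forall n m l,
        leg12 (W n m) \o leg13 (W (pmul n m) l) \o leg23 (W m l)
          =1 leg23 (W m l) \o
             leg12 (ecast k (ht (H k) (H (pmul m l)) -> ht (H n) (H (pmul m l)))
                      (pmulA n m l) (W n (pmul m l))) &
      [/\ quasi_covariant (cuntz_delta ct Ostar) (dsum_rep Ostar HH pi) (dsum_W HH W),
          pentagonal (dsum_W HH W) &
          (forall n m, cyclic_vector (rep_phi ct O (pi n) (pi m))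
                         (Omega n ⊗[ht] Omega m)) ->
          covariant (cuntz_delta ct Ostar) (dsum_rep Ostar HH pi) (dsum_W HH W) /\
          pentagonal (dsum_W HH W)]].
Proof.
pose W n m := @gns_W R ht ct O w H pi Omega w_state w_GNS w_phi n m.
have phiP := cuntz_phi_spec w_state w_phi.
have pr n : is_rep (pi n) by case: (w_GNS n).
have Wb n m : bounded_by 1 (W n m) by exact: gns_W_bounded.
have WI n m X : W n m \o htens_op (pi (pmul n m) X) id
    =1 rep_phi ct O (pi n) (pi m) X \o W n m by exact: gns_W_intertwine.
have pent : pentagonal (dsum_W HH W).
  by apply: (dsum_W_pentagonal Wb) => n m l; exact: gns_pentagon.
have quasi : quasi_covariant (cuntz_delta ct Ostar) (dsum_rep Ostar HH pi) (dsum_W HH W).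
  split.
  - exact: dsum_rep_rep.
  - apply: (dsum_W_partial HH Wb (Q := fun n m => @gns_Q R ht H Omega n m)) => n m.
    + exact: gns_Q_bounded w_state w_GNS _ _.
    + exact: gns_Q_dot.
    + exact: gns_W_Q.
  - pose p := PosN (ltn0Sn 0); have [u Wu] := gns_W_neq0 w_state w_GNS w_phi p p.
    exists (inj2 ht HH (pmul p p, p) u); rewrite dsum_WE// => /inj2_eq0.
    exact: Wu.
  - exact: dsum_W_intertwine.
exists W; split.
- by move=> n m; split; [exact: gns_W_partial|exact: gns_W_neq0].
- exact: WI.
- by move=> n m; exact: gns_W_adjoint.
- by move=> n m l; exact: gns_pentagon.
- split=> // cyc; split=> //; split=> //.
  apply: (dsum_W_coisometry HH Wb) => n m; exact: gns_W_coisometry.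
Qed.
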